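(* Fix $\eta\in(0,1)$. Let $k\ge1$, let $K\subseteq\mathbb{R}^k$ be a bounded closed set, and let $f:K\times K\to[-1,1]$ be a continuous function. There exist a constant $c>0$ depending only on $\eta$, for each $\varepsilon>0$ a constant $C(\varepsilon)$ depending only on $\varepsilon$ and $\eta$, and numbers $C(K,k,f,n)$, $n\ge1$, depending only on $K,k,f,n$ and $\eta$, with $$\lim_{n\to\infty}C(K,k,f,n)=0,$$ such that: for every $n\ge1$, all $\beta_1,\dots,\beta_n\in K$, and every $p\in[0,1]$ with $p\ge n^{-1+\varepsilon}$ for some $\varepsilon>0$, if $M$ is the $n\times n$ matrix whose $(i,j)$th element is $f(\beta_i,\beta_j)$, then the USVT estimator $\hat M$ with tuning parameter $\eta$ satisfies $$\operatorname{MSE}(\hat M)\le\frac{C(K,k,f,n)}{\sqrt p}+C(\varepsilon)e^{-cnp}.$$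
   Context: The data matrix has the form $x_{ij}=f(\beta_i,\beta_j)+\varepsilon_{ij}$ with independent mean-zero errors such that $|x_{ij}|\le1$ almost surely; precisely, one of the following models (order $n\times n$) holds. Asymmetric model (with $m=n$): $X$ is a random $n\times n$ matrix with independent entries, $\mathbb{E}(x_{ij})=m_{ij}$ and $|x_{ij}|\le 1$ almost surely; each entry of $X$ is observed with probability $p$ and unobserved with probability $1-p$, independently of everything else. Symmetric model (when $M$ is symmetric): $X$ is symmetric, its entries on and above the diagonal are independent with $\mathbb{E}(x_{ij})=m_{ij}$ and $|x_{ij}|\le1$ almost surely; each entry on and above the diagonal is observed with probability $p$, independently of everything else, and for $i<j$ the entry $(j,i)$ is observed if and only if $(i,j)$ is. $\operatorname{MSE}(\hat M):=\mathbb{E}\big[\frac1{n^2}\sum_{i,j=1}^n(\hat m_{ij}-m_{ij})^2\big]$. USVT estimator with tuning parameter $\eta\in(0,1)$: let $y_{ij}=x_{ij}$ if $x_{ij}$ is observed and $y_{ij}=0$ otherwise, $Y=(y_{ij})$, with singular value decomposition $Y=\sum_{i=1}^n s_iu_iv_i^T$. Let $\hat p$ be the proportion of observed entries of $X$ (in the symmetric model: among those on and above the diagonal). Let $S:=\{i: s_i\ge(2+\eta)\sqrt{n\hat p}\}$ and $W:=\frac1{\hat p}\sum_{i\in S}s_iu_iv_i^T$ (if $\hat p=0$, put $W:=0$). Finally $\hat m_{ij}$ is the truncation of $w_{ij}$ to $[-1,1]$ ($\hat m_{ij}=w_{ij}$ if $|w_{ij}|\le1$, $1$ if $w_{ij}>1$,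 $-1$ if $w_{ij}<-1$). *)

(* Defs.v *)
From HB Require Import structures.
From mathcomp Require Import all_boot all_order all_algebra.
From mathcomp Require Import all_classical all_reals all_analysis.

Set Implicit Arguments.
Unset Strict Implicit.
Unset Printing Implicit Defensive.

Import Order.TTheory GRing.Theory Num.Theory.
Import numFieldNormedType.Exports.

Local Open Scope classical_set_scope.
Local Open Scope ring_scope.

(* Mutual independence of the set systems G i, for i in D: the product rule
   holds for every subfamily. *)
Definition mutually_independent {d : measure_display} {T : measurableType d}
    {R : realType} (P : probability T R) (I : finType) (D : {set I})
    (G : I -> set (set T)) : Prop :=
  forall (J : {set I}) (A : I -> set T),
    J \subset D -> (forall i, i \in J -> G i (A i)) ->
    P (\bigcap_(i in [set` J]) A i) = (\prod_(i in J) P (A i))%E.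

Definition sigma_of {d d' : measure_display} {T : measurableType d}
    {U : measurableType d'} (Z : T -> U) : set (set T) :=
  preimage_set_system [set: T] Z measurable.

Inductive model := Asymmetric | Symmetric.

(* The positions of the entries that are drawn and observed independently;
   in the symmetric model the others are obtained by reflection. *)
Definition free_entries (mo : model) (n : nat) : {set 'I_n * 'I_n} :=
  match mo with
  | Asymmetric => [set: 'I_n * 'I_n]%SET
  | Symmetric => [set ij : 'I_n * 'I_n | (ij.1 <= ij.2)%N]%SET
  end.

(* X i j is the (i,j)th entry of the data matrix; O i j w says whether that
   entry is observed at the outcome w. *)
Record data_model (mo : model) {d : measure_display} {T : measurableType d}
    {R : realType} (P : probability T R) (n : nat) (p : R) (M : 'M[R]_n)
    (X : 'I_n -> 'I_n -> {RV P >-> R}) (O : 'I_n -> 'I_n -> {RV P >-> bool})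
    : Prop := DataModel {
  data_mean : forall i j, (i, j) \in free_entries mo n ->
    ('E_P[X i j] = (M i j)%:E)%E;
  data_bounded : forall i j, (i, j) \in free_entries mo n ->
    {ae P, forall w, `|X i j w| <= 1};
  data_observed : forall i j, (i, j) \in free_entries mo n ->
    P (O i j @^-1` [set true]) = p%:E;
  (* All the entries (inl) and all the observation indicators (inr) together. *)
  data_independent : mutually_independent P
    [set u : ('I_n * 'I_n) + ('I_n * 'I_n) |
      match u with
      | inl ij => ij \in free_entries mo n
      | inr ij => ij \in free_entries mo n
      end]%SET
    (fun u => match u with
      | inl ij => sigma_of (X ij.1 ij.2)
      | inr ij => sigma_of (O ij.1 ij.2)
      end);
  data_symmetric : mo = Symmetric ->
    [/\ forall i j, M i j = M j i,
        forall i j w, X i j w = X j i w &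
        forall i j w, O i j w = O j i w]
}.

Definition observed_matrix {R : realType} (n : nat) (x : 'M[R]_n)
    (o : 'I_n -> 'I_n -> bool) : 'M[R]_n :=
  \matrix_(i, j) if o i j then x i j else 0.

Definition observed_proportion (R : realType) (mo : model) (n : nat)
    (o : 'I_n -> 'I_n -> bool) : R :=
  #|[set ij in free_entries mo n | o ij.1 ij.2]%SET|%:R
    / #|free_entries mo n|%:R.

(* Y = sum_i s_i u_i v_i^T, where the u_i and the v_i are the columns of U
   and V; the singular values need not be sorted. *)
Definition is_svd {R : realType} (n : nat) (Y U : 'M[R]_n) (s : 'I_n -> R)
    (V : 'M[R]_n) : Prop :=
  [/\ U^T *m U = 1%:M, V^T *m V = 1%:M, forall i, 0 <= s i &
      Y = \sum_i s i *: (col i U *m (col i V)^T)].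

Definition truncate {R : realType} (x : R) : R := Num.min 1 (Num.max (-1) x).

(* N is the USVT estimate computed from the matrix Y and the proportion ph of
   observed entries. It does not depend on the choice of the decomposition. *)
Definition is_usvt {R : realType} (n : nat) (eta : R) (Y : 'M[R]_n) (ph : R)
    (N : 'M[R]_n) : Prop :=
  exists (U V : 'M[R]_n) (s : 'I_n -> R), is_svd Y U s V /\
    let W := if ph == 0 then 0 else
      ph^-1 *: \sum_(i | (2 + eta) * Num.sqrt (n%:R * ph) <= s i)
                 s i *: (col i U *m (col i V)^T) in
    N = map_mx truncate W.

Definition usvt_estimator {d : measure_display} {T : measurableType d}
    {R : realType} (P : probability T R) (mo : model) (n : nat) (eta : R)
    (X : 'I_n -> 'I_n -> {RV P >-> R}) (O : 'I_n -> 'I_n -> {RV P >-> bool})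
    (Mhat : T -> 'M[R]_n) : Prop :=
  forall w, let o i j := O i j w in
    is_usvt eta (observed_matrix (\matrix_(i, j) X i j w) o)
      (observed_proportion R mo o) (Mhat w).

Definition MSE {d : measure_display} {T : measurableType d} {R : realType}
    (P : probability T R) (n : nat) (Mhat : T -> 'M[R]_n) (M : 'M[R]_n)
    : \bar R :=
  ('E_P[fun w => ((n%:R ^+ 2)^-1 * \sum_(i < n) \sum_(j < n)
                   (Mhat w i j - M i j) ^+ 2)%R])%E.

(* Main.v *)
(* Both C / sqrt p and the trivial bound MSE <= 4 make small p harmless, so it is
   enough that the MSE tends to 0 uniformly over p >= del, for every fixed del,
   and C(eps) can be taken to be 0.

   Write Y = p M + E and let H project onto the left singular vectors of Y kept
   by the threshold, r of them. With Q the matrix that averages columns over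
   finitely many small cells of K, M is close to M Q by uniform continuity and
   H Y - p M = H E - (1 - H) (Y - E) Q - (1 - H) p (M - M Q). The middle term is
   controlled by the threshold since Q has bounded rank, and
   |H E|_F^2 = tr (H E E^T) is small as soon as r = o(n).

   For r = o(n), let A be the (symmetrised, normalised) noise. Multiplying a sum
   over self-avoiding paths by A either extends the path, or retraces its first
   edge, or closes a cycle. Cycles and the fluctuation of the squared entry at a
   retraced edge contribute only O(1) in expected squared Frobenius norm. The
   monomials of distinct self-avoiding paths with a common end vertex are
   orthogonal, so each path sum has expected squared norm at most N. Hence k
   multiplications by A give at most 2^k path sums, of total expected squared
   norm at most 4^k N up to O(1), against a factor (2 + eta/2)^(2k) gained on
   the singular vectors kept by the threshold; the signal only adds a matrix of
   bounded rank and a small one. *)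
Require Import Defs.
From HB Require Import structures.
From mathcomp Require Import all_boot all_order all_algebra.
From mathcomp Require Import all_classical all_reals all_analysis.
From mathcomp Require Import measurable_realfun.
From mathcomp Require Import ring lra.
Import Order.TTheory GRing.Theory Num.Theory.
Import numFieldNormedType.Exports.
Local Open Scope classical_set_scope.
Local Open Scope ring_scope.

Set Implicit Arguments.
Unset Strict Implicit.
Unset Printing Implicit Defensive.

(** * Expectation of bounded random variables and independence *)

(** The singular vectors are functions of the noise, so no expectation can be taken while they are
    present. They are first eliminated by inequalities that hold at every outcome: a weighted AM-GM
    inequality separates H from E E^T, and the number of kept singular values is bounded by a
    statistic in which the path sums meet only deterministic matrices. After that, second moments of
    path sums suffice, for a number of multiplications fixed while n grows; no bound on the operator
    norm of the noise enters. Half of eta is held back from the threshold to pay for the observed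
    proportion being different from p. The estimator is an arbitrary function of the outcome,
    possibly not measurable, so each bound on the loss is a pointwise bound by a bounded measurable
    majorant. Path counting needs a symmetric noise matrix whose row sums of variances are at most
    1. The asymmetric model provides one through its dilation of order 2n, which is the origin of
    many factors 2 in the bounds. *)

Section BoundedExpectation.
Context {d : measure_display} {T : measurableType d} {R : realType}.
Variable P : probability T R.
Implicit Types f g : T -> R.

Definition bounded_rv f : Prop :=
  measurable_fun [set: T] f /\ exists C : R, forall x, `|f x| <= C.

Definition Ex f : R := (\int[P]_x f x)%R.

Lemma bounded_rv_integrable f : bounded_rv f ->
  P.-integrable [set: T] (EFin \o f).
Proof.
move=> [mf [C Cf]]; apply: (measurable_bounded_integrable _ _ mf) => //.
  by rewrite (le_lt_trans (probability_le1 P measurableT)) ?ltry.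
exists C; split; first exact: num_real.
by move=> M /ltW CM x _; apply: le_trans CM; exact: Cf.
Qed.

Lemma bounded_rv_cst r : bounded_rv (cst r).
Proof. by split; [exact: measurable_cst|exists `|r| => x /=]. Qed.

Lemma bounded_rvD f g : bounded_rv f -> bounded_rv g ->
  bounded_rv (fun x => f x + g x).
Proof.
move=> [mf [C Cf]] [mg [D Dg]]; split; first exact: measurable_funD.
by exists (C + D) => x; rewrite (le_trans (ler_normD _ _))// lerD.
Qed.

Lemma bounded_rvM f g : bounded_rv f -> bounded_rv g ->
  bounded_rv (fun x => f x * g x).
Proof.
move=> [mf [C Cf]] [mg [D Dg]]; split; first exact: measurable_funM.
by exists (C * D) => x; rewrite normrM ler_pM.
Qed.

Lemma bounded_rvB f g : bounded_rv f -> bounded_rv g ->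
  bounded_rv (fun x => f x - g x).
Proof.
move=> bf bg; rewrite (_ : (fun _ => _) = fun x => f x + (-1) * g x).
  by apply: bounded_rvD => //; apply: bounded_rvM => //; exact: bounded_rv_cst.
by apply/funext => x; rewrite mulN1r.
Qed.

Lemma bounded_rvX f n : bounded_rv f -> bounded_rv (fun x => f x ^+ n).
Proof.
move=> bf; elim: n => [|n IH]; first exact: (bounded_rv_cst 1).
under eq_fun do rewrite exprS; exact: bounded_rvM.
Qed.

Lemma bounded_rv_sum I (r : seq I) (Q : pred I) (F : I -> T -> R) :
  (forall i, bounded_rv (F i)) ->
  bounded_rv (fun x => \sum_(i <- r | Q i) F i x).
Proof.
move=> bF; elim: r => [|i r IH].
  by under eq_fun do rewrite big_nil; exact: bounded_rv_cst.
under eq_fun do rewrite big_cons.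
by case: (Q i) => //; exact: bounded_rvD.
Qed.

Lemma bounded_rv_prod I (r : seq I) (Q : pred I) (F : I -> T -> R) :
  (forall i, bounded_rv (F i)) ->
  bounded_rv (fun x => \prod_(i <- r | Q i) F i x).
Proof.
move=> bF; elim: r => [|i r IH].
  by under eq_fun do rewrite big_nil; exact: bounded_rv_cst.
under eq_fun do rewrite big_cons.
by case: (Q i) => //; exact: bounded_rvM.
Qed.

Lemma bounded_rv_horner (p : {poly R}) f : bounded_rv f ->
  bounded_rv (fun x => p.[f x]).
Proof.
move=> bf; under eq_fun do rewrite horner_coef.
apply: bounded_rv_sum => i; apply: bounded_rvM; first exact: bounded_rv_cst.
exact: bounded_rvX.
Qed.

Lemma bounded_rv_indic (A : set T) : measurable A -> bounded_rv (\1_A).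
Proof.
move=> mA; split; first exact: measurable_indic.
by exists 1 => x; rewrite indicE; case: (_ \in _); rewrite ?normr1 ?normr0.
Qed.

Lemma Ex_cst r : Ex (cst r) = r.
Proof.
rewrite /Ex /Rintegral (_ : (fun x => _) = cst r%:E)//.
by rewrite integral_cst//= probability_setT mule1.
Qed.

Lemma ExD f g : bounded_rv f -> bounded_rv g ->
  Ex (fun x => f x + g x) = Ex f + Ex g.
Proof. by move=> bf bg; apply: RintegralD => //; exact: bounded_rv_integrable. Qed.

Lemma ExZ r f : bounded_rv f -> Ex (fun x => r * f x) = r * Ex f.
Proof. by move=> bf; apply: RintegralZl => //; exact: bounded_rv_integrable. Qed.

Lemma ExB f g : bounded_rv f -> bounded_rv g ->
  Ex (fun x => f x - g x) = Ex f - Ex g.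
Proof. by move=> bf bg; apply: RintegralB => //; exact: bounded_rv_integrable. Qed.

Lemma Ex_sum I (r : seq I) (Q : pred I) (F : I -> T -> R) :
  (forall i, bounded_rv (F i)) ->
  Ex (fun x => \sum_(i <- r | Q i) F i x) = \sum_(i <- r | Q i) Ex (F i).
Proof.
move=> bF; elim: r => [|i r IH].
  by rewrite big_nil -[RHS](Ex_cst 0); congr Ex; apply/funext => x; rewrite big_nil.
rewrite big_cons; under [in LHS]eq_fun do rewrite big_cons.
by case: (Q i) => //; rewrite ExD ?IH//; exact: bounded_rv_sum.
Qed.

Lemma le_Ex f g : bounded_rv f -> bounded_rv g ->
  (forall x, f x <= g x) -> Ex f <= Ex g.
Proof.
move=> bf bg fg; apply: le_Rintegral => //; exact: bounded_rv_integrable.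
Qed.

Lemma Ex_ge0 f : (forall x, 0 <= f x) -> 0 <= Ex f.
Proof. by move=> f0; apply: Rintegral_ge0. Qed.

Lemma Ex_le_cst f C : bounded_rv f -> (forall x, f x <= C) -> Ex f <= C.
Proof.
by move=> bf fC; rewrite -[leRHS]Ex_cst; apply: le_Ex => //; exact: bounded_rv_cst.
Qed.

Lemma norm_Ex_le f C : bounded_rv f -> (forall x, `|f x| <= C) -> `|Ex f| <= C.
Proof.
move=> bf fC; rewrite ler_norml; apply/andP; split; last first.
  by apply: Ex_le_cst => // x; exact: le_trans (ler_norm _) (fC x).
rewrite -[leLHS]Ex_cst; apply: le_Ex => //; first exact: bounded_rv_cst.
by move=> x /=; have := fC x; rewrite ler_norml => /andP[].
Qed.

Lemma Ex_indic (A : set T) : measurable A -> (Ex (\1_A))%:E = P A.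
Proof.
move=> mA; rewrite /Ex /Rintegral fineK.
  by rewrite integral_indic// setIT.
by rewrite integral_indic// setIT fin_num_measure.
Qed.

Lemma Ex_expectation f : bounded_rv f -> ((Ex f)%:E = 'E_P[f])%E.
Proof.
move=> bf; rewrite unlock /Ex /Rintegral fineK//.
by apply: integrable_fin_num => //; exact: bounded_rv_integrable.
Qed.

End BoundedExpectation.

(** * From independent events to expectations of products of functions *)

Section Independence.
Context {d : measure_display} {T : measurableType d} {R : realType}.
Variable P : probability T R.

(** Half-open intervals of length e cover [-C, C], and each y is replaced by the left endpoint of
    its interval. The approximation is uniform, so it controls expectations without a limit theorem.
    The extra interval in [n] holds the endpoint y = C. *)
Lemma step_approx (C e : R) : 0 < e ->
  exists n (c : 'I_n -> R) (B : 'I_n -> set R),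
    (forall i, measurable (B i)) /\
    forall y, `|y| <= C -> `|y - \sum_i c i * \1_(B i) y| <= e.
Proof.
move=> e0; pose n := (Num.truncn ((C + C) / e)).+1.
exists n, (fun i => - C + i%:R * e),
  (fun i => `[- C + i%:R * e, - C + i.+1%:R * e[%classic); split.
  by move=> i; exact: measurable_itv.
move=> y; rewrite ler_norml => /andP[Cy yC].
have z0 : 0 <= (y + C) / e by apply: divr_ge0; lra.
have := Num.Theory.truncn_itv z0.
set j := Num.truncn _ => /andP[j1 j2].
have jn : (j < n)%N.
  rewrite ltnS /j; apply: Num.Theory.le_truncn; rewrite ler_pM2r ?invr_gt0// lerD2r//.
rewrite ler_pdivlMr// in j1; rewrite ltr_pdivrMr// in j2.
rewrite (bigD1 (Ordinal jn))//= big1 ?addr0 => [|i ij].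
  rewrite indicE mem_set /=; last first.
    by rewrite in_itv/=; apply/andP; split; lra.
  rewrite mulr1 ler_norml; move: j2; rewrite -[in j.+1%:R]natr1.
  by move=> j2; apply/andP; split; nra.
rewrite indicE memNset ?mulr0//= in_itv/= => /andP[i1 i2].
move/eqP: ij; apply; apply/val_inj => /=; apply/eqP; rewrite eqn_leq.
have ij1 : (i < j.+1)%N by rewrite -(ltr_nat R) -(ltr_pM2r e0); lra.
have ji1 : (j < i.+1)%N by rewrite -(ltr_nat R) -(ltr_pM2r e0); lra.
by rewrite -ltnS ij1 -ltnS.
Qed.

(** Both sides are linear in f and agree when f is a step function of itself; a uniform error e' in
    f then costs at most e' D on either side. The + 1 in the denominator of [e'] covers D = 0. *)
Lemma Ex_mul_indep (f g : T -> R) : bounded_rv f -> bounded_rv g ->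
  (forall B, measurable B -> Ex P (fun x => \1_(f @^-1` B) x * g x) =
     Ex P (\1_(f @^-1` B)) * Ex P g) ->
  Ex P (fun x => f x * g x) = Ex P f * Ex P g.
Proof.
move=> bf bg fg; have [mf [C fC]] := bf; have [_ [D gD]] := bg.
have D0 : 0 <= D by exact: le_trans (gD point).
apply/eqP; rewrite -subr_eq0 -normr_le0; apply/ler_addgt0Pl => e e0.
rewrite addr0; pose e' := e / (2 * D + 1).
have e'0 : 0 < e' by rewrite divr_gt0//; lra.
have [n [c [B [mB cB]]]] := step_approx C e'0.
pose q x := \sum_i c i * \1_(f @^-1` B i) x.
have mfB i : measurable (f @^-1` B i) by rewrite -[X in measurable X]setTI; exact: mf.
have bI i : bounded_rv (\1_(f @^-1` B i) : T -> R) by exact: bounded_rv_indic.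
have bcI i : bounded_rv (fun x => c i * \1_(f @^-1` B i) x).
  by apply: bounded_rvM => //; exact: bounded_rv_cst.
have bq : bounded_rv q by apply: bounded_rv_sum.
have fq x : `|f x - q x| <= e'.
  by apply: le_trans (cB _ (fC x)); rewrite /q.
have qg : Ex P (fun x => q x * g x) = Ex P q * Ex P g.
  rewrite /q; under eq_fun do rewrite mulr_suml.
  rewrite Ex_sum; last by move=> i; exact: bounded_rvM.
  rewrite Ex_sum// mulr_suml; apply: eq_bigr => i _.
  under eq_fun do rewrite -mulrA.
  by rewrite !ExZ ?fg ?mulrA//; exact: bounded_rvM.
have -> : Ex P (fun x => f x * g x) - Ex P f * Ex P g =
    Ex P (fun x => (f x - q x) * g x) - Ex P (fun x => f x - q x) * Ex P g.
  under [in X in _ = X - _]eq_fun do rewrite mulrBl.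
  by rewrite !ExB ?qg//; [ring|exact: bounded_rvM..].
have bfq : bounded_rv (fun x => f x - q x) by exact: bounded_rvB.
have e'E : e' * (2 * D + 1) = e by rewrite /e' divfK//; lra.
apply: (@le_trans _ _ (e' * D + e' * D)); last by nra.
apply: le_trans (ler_normB _ _) _; apply: lerD.
  apply: norm_Ex_le; first exact: bounded_rvM.
  by move=> x; rewrite normrM ler_pM.
by rewrite normrM ler_pM//; exact: norm_Ex_le.
Qed.

(** Independence speaks of events, the conclusion of functions. The passage is made one index at a
    time, all other indices being kept either as functions or as indicators. *)
Lemma indep_Ex_prod (I : finType) (D : {set I}) (G : I -> set (set T))
    (f : I -> T -> R) (s : seq I) :
  mutually_independent P D G ->
  (forall i A, G i A -> measurable A) ->
  (forall i, bounded_rv (f i)) ->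
  (forall i B, i \in s -> measurable B -> G i (f i @^-1` B)) ->
  uniq s -> {subset s <= D} ->
  Ex P (fun x => \prod_(i <- s) f i x) = \prod_(i <- s) Ex P (f i).
Proof.
move=> indG mG bf adf us sD.
(* The list s' holds the indices still represented by events. With no function left this is the
   product rule; in the inductive step the claim for every preimage at u yields the claim for the
   function at u. *)
suff H s' A : uniq (s ++ s') -> {subset s' <= D} ->
    (forall i, i \in s' -> G i (A i)) ->
    Ex P (fun x => (\prod_(i <- s) f i x) * \prod_(i <- s') \1_(A i) x) =
    (\prod_(i <- s) Ex P (f i)) * \prod_(i <- s') Ex P (\1_(A i)).
  have := H [::] (fun=> set0); rewrite cats0 big_nil mulr1 => <-//.
  by congr Ex; apply/funext => x; rewrite big_nil mulr1.
elim: s adf us sD s' A => [|u s IH] adf us sD s' A.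
  rewrite cat0s => us' s'D GA.
  rewrite big_nil mul1r; under eq_fun do rewrite big_nil mul1r.
  have mA i : i \in s' -> measurable (A i) by move/GA/mG.
  pose J := [set i in s']%SET.
  have PA : P (\bigcap_(i in [set` J]) A i) = (\prod_(i in J) P (A i))%E.
    apply: indG; first by apply/fintype.subsetP => i; rewrite inE => /s'D.
    by move=> i; rewrite inE; exact: GA.
  have mI : measurable (\bigcap_(i in [set` J]) A i).
    apply: fin_bigcap_measurable; first exact: finite_finset.
    by move=> i /=; rewrite inE; exact: mA.
  rewrite (_ : (fun x => _) = \1_(\bigcap_(i in [set` J]) A i)); last first.
    apply/funext => x; rewrite indicE; case: (boolP (x \in _)) => [|/negP] xA.
      move: xA; rewrite inE => xA; rewrite big_seq big1// => i si.
      by rewrite indicE mem_set//; apply: xA; rewrite /= inE.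
    have [i si Aix] : exists2 i, i \in s' & ~ A i x.
      apply: contrapT => h; apply: xA; rewrite inE => i /=; rewrite inE => si.
      by apply: contrapT => Aix; apply: h; exists i.
    by rewrite (big_rem i)//= indicE memNset// mul0r.
  apply: EFin_inj; rewrite Ex_indic// PA.
  rewrite (eq_bigl (mem s')); last by move=> i; rewrite inE.
  rewrite -big_uniq//= big_seq [in RHS]big_seq.
  rewrite -prodEFin; apply: eq_bigr => i si; rewrite Ex_indic//; exact: mA.
rewrite cat_cons cons_uniq mem_cat negb_or => /andP[/andP[us0 us1] us'] s'D GA.
have sD1 : {subset s <= D} by move=> i si; apply: sD; rewrite inE si orbT.
have us2 : uniq s by move: us => /=/andP[].
have adf1 i B : i \in s -> measurable B -> G i (f i @^-1` B).
  by move=> si; apply: adf; rewrite inE si orbT.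
have uD : u \in D by apply: sD; rewrite inE eqxx.
have mfB B : measurable B -> measurable (f u @^-1` B).
  by move=> mB; apply: mG (adf u _ _ mB); rewrite inE eqxx.
(* The events are known to be measurable only on s'; the value [set0] elsewhere makes every
   indicator a bounded variable. *)
pose A' i := if i \in s' then A i else set0.
have A'E i : i \in s' -> A i = A' i by rewrite /A' => ->.
have mA' i : measurable (A' i).
  by rewrite /A'; case: ifPn => // /GA/mG.
have bA' i : bounded_rv (\1_(A' i) : T -> R) by exact: bounded_rv_indic.
have PE x : \prod_(i <- s') \1_(A i) x = \prod_(i <- s') \1_(A' i) x :> R.
  by rewrite big_seq [RHS]big_seq; apply: eq_bigr => i /A'E ->.
rewrite big_cons -mulrA -(IH adf1 us2 sD1 s' A us' s'D GA).
rewrite -Ex_mul_indep//; last 2 first.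
- under eq_fun do rewrite PE.
  by apply: bounded_rvM; apply: bounded_rv_prod.
- move=> B mB.
  pose A1 i := if i == u then f u @^-1` B else A i.
  have A1u : A1 u = f u @^-1` B by rewrite /A1 eqxx.
  have us1' : uniq (s ++ u :: s').
    by rewrite uniq_catC /= mem_cat negb_or us1 us0/= uniq_catC.
  have s'E (F : set T -> R) : \prod_(i <- s') F (A1 i) = \prod_(i <- s') F (A i).
    rewrite big_seq [RHS]big_seq; apply: eq_bigr => i si.
    by rewrite /A1; case: eqP => // iu; rewrite -iu si in us1.
  have := IH adf1 us2 sD1 (u :: s') A1 us1'.
  rewrite (IH adf1 us2 sD1 s' A us' s'D GA).
  rewrite big_cons (s'E (fun B => Ex P (\1_B))) A1u mulrCA => <-.
  + congr Ex; apply/funext => x.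
    by rewrite big_cons (s'E (fun B => \1_B x)) A1u mulrCA.
  + by move=> i; rewrite inE => /orP[/eqP->//|/s'D].
  + move=> i; rewrite inE /A1; case: eqP => [-> _|_ /=]; last exact: GA.
    by apply: adf => //; rewrite inE eqxx.
by congr Ex; apply/funext => x; rewrite big_cons mulrA.
Qed.

End Independence.

(** * The squared Frobenius norm *)

Section SquaredFrobenius.
Context {R : realFieldType}.

Definition sqfrob m n (A : 'M[R]_(m, n)) : R := \sum_i \sum_j A i j ^+ 2.

Lemma sqfrob_ge0 m n (A : 'M[R]_(m, n)) : 0 <= sqfrob A.
Proof. by apply: sumr_ge0 => i _; apply: sumr_ge0 => j _; exact: sqr_ge0. Qed.

Lemma sqfrob_mxtrace m n (A : 'M[R]_(m, n)) : sqfrob A = \tr (A *m A^T).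
Proof.
apply: eq_bigr => i _; rewrite mxE; apply: eq_bigr => j _.
by rewrite mxE expr2.
Qed.

Lemma sqfrobT m n (A : 'M[R]_(m, n)) : sqfrob A^T = sqfrob A.
Proof.
rewrite /sqfrob exchange_big; apply: eq_bigr => i _; apply: eq_bigr => j _.
by rewrite mxE.
Qed.

Lemma sqfrob0 m n : sqfrob (0 : 'M[R]_(m, n)) = 0.
Proof. by rewrite sqfrob_mxtrace mul0mx mxtrace0. Qed.

Lemma sqfrob1 n : sqfrob (1%:M : 'M[R]_n) = n%:R.
Proof. by rewrite sqfrob_mxtrace trmx1 mulmx1 mxtrace1. Qed.

Lemma sqfrobZ m n c (A : 'M[R]_(m, n)) : sqfrob (c *: A) = c ^+ 2 * sqfrob A.
Proof.
rewrite /sqfrob mulr_sumr; apply: eq_bigr => i _; rewrite mulr_sumr.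
by apply: eq_bigr => j _; rewrite mxE exprMn.
Qed.

Lemma sqfrobN m n (A : 'M[R]_(m, n)) : sqfrob (- A) = sqfrob A.
Proof. by rewrite -scaleN1r sqfrobZ sqrrN expr1n mul1r. Qed.

Lemma sqfrobD m n (A B : 'M[R]_(m, n)) :
  sqfrob (A + B) <= 2 * sqfrob A + 2 * sqfrob B.
Proof.
rewrite /sqfrob !mulr_sumr -big_split; apply: ler_sum => i _.
rewrite !mulr_sumr -big_split; apply: ler_sum => j _; rewrite mxE /=.
by have := sqr_ge0 (A i j - B i j); nra.
Qed.

Lemma sqfrobB m n (A B : 'M[R]_(m, n)) :
  sqfrob (A - B) <= 2 * sqfrob A + 2 * sqfrob B.
Proof. by rewrite -(sqfrobN B); exact: sqfrobD. Qed.

Lemma sqfrobD3 m n (A B C : 'M[R]_(m, n)) :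
  sqfrob (A + B + C) <= 3 * sqfrob A + 3 * sqfrob B + 3 * sqfrob C.
Proof.
rewrite /sqfrob !mulr_sumr -!big_split; apply: ler_sum => i _ /=.
rewrite !mulr_sumr -!big_split; apply: ler_sum => j _; rewrite !mxE /=.
have := sqr_ge0 (A i j - B i j); have := sqr_ge0 (A i j - C i j).
by have := sqr_ge0 (B i j - C i j); nra.
Qed.

Lemma sqr_sum_le I (s : seq I) (F : I -> R) :
  (\sum_(i <- s) F i) ^+ 2 <= (size s)%:R * \sum_(i <- s) F i ^+ 2.
Proof.
elim: s => [|i s IH]; first by rewrite !big_nil expr0n mul0r.
rewrite !big_cons /= -natr1; set S := \sum_(_ <- _) _ in IH *.
set S2 := \sum_(_ <- _) _ in IH *; set k := (size s)%:R in IH *.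
have k0 : 0 <= k by [].
have S20 : 0 <= S2 by apply: sumr_ge0 => j _; exact: sqr_ge0.
have [k00|k_gt0] := leP k 0.
  have kE : k = 0 by apply/eqP; rewrite eq_le k00.
  rewrite kE mul0r in IH; have S0 : S = 0.
    by apply/eqP; rewrite -sqrf_eq0 eq_le IH sqr_ge0.
  by rewrite S0 kE add0r mul1r addr0 lerDl.
have : 2 * F i * S <= k * F i ^+ 2 + S ^+ 2 / k.
  rewrite -subr_ge0 (_ : _ - _ = (k * F i - S) ^+ 2 / k).
    by rewrite divr_ge0// sqr_ge0.
  by field; rewrite gt_eqF.
have : S ^+ 2 / k <= S2 by rewrite ler_pdivrMr// mulrC.
nra.
Qed.

Lemma sqfrob_sum m n I (s : seq I) (F : I -> 'M[R]_(m, n)) :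
  sqfrob (\sum_(i <- s) F i) <= (size s)%:R * \sum_(i <- s) sqfrob (F i).
Proof.
rewrite {2}/sqfrob [X in _ <= _ * X]exchange_big mulr_sumr.
apply: ler_sum => i _; rewrite [X in _ <= _ * X]exchange_big mulr_sumr.
by apply: ler_sum => j _; rewrite summxE; exact: sqr_sum_le.
Qed.

Lemma sqfrob_mul_isometry m n p (A : 'M[R]_(m, n)) (U : 'M[R]_(n, p)) :
  U *m U^T = 1%:M -> sqfrob (A *m U) = sqfrob A.
Proof.
by move=> UU; rewrite !sqfrob_mxtrace trmx_mul mulmxA -(mulmxA A) UU mulmx1.
Qed.

Lemma sqfrob_isometry_mul m n p (A : 'M[R]_(m, n)) (U : 'M[R]_(p, m)) :
  U^T *m U = 1%:M -> sqfrob (U *m A) = sqfrob A.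
Proof.
move=> UU; rewrite -sqfrobT trmx_mul sqfrob_mul_isometry ?sqfrobT//.
by rewrite trmxK.
Qed.

Lemma sqfrob_mul_diag m n (A : 'M[R]_(m, n)) (v : 'rV[R]_n) C :
  (forall i, `|v 0 i| <= C) -> sqfrob (A *m diag_mx v) <= C ^+ 2 * sqfrob A.
Proof.
move=> vC; rewrite /sqfrob mulr_sumr; apply: ler_sum => i _.
rewrite mulr_sumr; apply: ler_sum => j _; rewrite mul_mx_diag mxE exprMn mulrC.
rewrite ler_wpM2r ?sqr_ge0// -(real_normK (num_real (v 0 j))) ler_sqr ?nnegrE//.
exact: le_trans (vC j).
Qed.

Lemma sqfrob_diag_mul m n (A : 'M[R]_(m, n)) (v : 'rV[R]_m) C :
  (forall i, `|v 0 i| <= C) -> sqfrob (diag_mx v *m A) <= C ^+ 2 * sqfrob A.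
Proof.
by move=> vC; rewrite -sqfrobT trmx_mul tr_diag_mx -(sqfrobT A) sqfrob_mul_diag.
Qed.

Lemma sqfrob_proj_mul m n (A : 'M[R]_(m, n)) (Q : 'M[R]_m) :
  Q^T = Q -> Q *m Q = Q ->
  sqfrob A = sqfrob (Q *m A) + sqfrob (A - Q *m A).
Proof.
move=> QT QQ; have AE : A = Q *m A + (A - Q *m A) by rewrite addrC subrK.
rewrite {1}AE /sqfrob -big_split; set B := A - _; set C := Q *m A.
have : \tr (C^T *m B) = 0.
  by rewrite /B /C trmx_mul QT -mulmxA mulmxBr mulmxA QQ subrr mulmx0 mxtrace0.
rewrite mxtrace_mulC => tr0; apply/eqP; rewrite -subr_eq0 -sumrB.
apply/eqP; transitivity (2 * \tr (B *m C^T)); last by rewrite tr0 mulr0.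
rewrite /mxtrace mulr_sumr; apply: eq_bigr => i _ /=.
have -> : (B *m C^T) i i = \sum_j B i j * C i j.
  by rewrite mxE; apply: eq_bigr => j _; rewrite [C^T _ _]mxE.
rewrite mulr_sumr -big_split -sumrB; apply: eq_bigr => j _ /=.
by rewrite [(C + B) i j]mxE; ring.
Qed.

Lemma sqfrob_proj_le m n (A : 'M[R]_(m, n)) (Q : 'M[R]_m) :
  Q^T = Q -> Q *m Q = Q -> sqfrob (Q *m A) <= sqfrob A.
Proof.
by move=> QT QQ; rewrite [leRHS](sqfrob_proj_mul _ QT QQ) lerDl sqfrob_ge0.
Qed.

Lemma sqfrob_projC_le m n (A : 'M[R]_(m, n)) (Q : 'M[R]_m) :
  Q^T = Q -> Q *m Q = Q -> sqfrob (A - Q *m A) <= sqfrob A.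
Proof.
by move=> QT QQ; rewrite [leRHS](sqfrob_proj_mul _ QT QQ) lerDr sqfrob_ge0.
Qed.

Lemma sqfrob_eq0 m n (A : 'M[R]_(m, n)) : sqfrob A = 0 -> A = 0.
Proof.
move=> A0; apply/matrixP => i j; rewrite mxE; apply/eqP; rewrite -sqrf_eq0.
have /eqP := A0; rewrite psumr_eq0; last first.
  by move=> k _; apply: sumr_ge0 => l _; exact: sqr_ge0.
move=> /allP /(_ i); rewrite mem_index_enum => /(_ isT) /=.
rewrite psumr_eq0; last by move=> l _; exact: sqr_ge0.
by move=> /allP /(_ j); rewrite mem_index_enum => /(_ isT).
Qed.

(** AM-GM with a free weight a. It detaches the projection, which depends on the noise, from E E^T,
    so that the two squared norms are averaged separately. *)
Lemma mxtrace_mul_le m n (A B : 'M[R]_(m, n)) (a : R) : 0 < a ->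
  \tr (A *m B^T) <= (a * sqfrob A + a^-1 * sqfrob B) / 2.
Proof.
move=> a0; rewrite /sqfrob !mulr_sumr -big_split mulr_suml; apply: ler_sum => i _.
rewrite mxE /= !mulr_sumr -big_split mulr_suml; apply: ler_sum => j _.
rewrite mxE /= -subr_ge0.
rewrite (_ : _ - _ = (a * A i j - B i j) ^+ 2 / (2 * a)).
  by rewrite divr_ge0 ?sqr_ge0// mulr_ge0// ltW.
by field; rewrite gt_eqF.
Qed.

Lemma sqfrob_proj_mxtrace m n (Q : 'M[R]_m) (A : 'M[R]_(m, n)) :
  Q^T = Q -> Q *m Q = Q -> sqfrob (Q *m A) = \tr (Q *m (A *m A^T)^T).
Proof.
move=> QT QQ; rewrite sqfrob_mxtrace [(Q *m A)^T]trmx_mul QT -mulmxA mxtrace_mulC.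
by rewrite !trmx_mul trmxK -!mulmxA QQ mulmxA; exact: mxtrace_mulC.
Qed.

(** With B a free family of rows spanning those of G, the projection is B^T (B B^T)^-1 B. The Gram
    matrix is invertible because v B B^T = 0 makes the squared norm of v B vanish, and cyclicity of
    the trace gives the rank. *)
Lemma orthogonal_projection m n (G : 'M[R]_(m, n)) :
  exists Q : 'M[R]_n,
    [/\ Q^T = Q, Q *m Q = Q, G *m Q = G & \tr Q = (\rank G)%:R].
Proof.
have [r rE] : exists r, r = \rank G by eexists.
rewrite -rE; have [B [Bfree GB]] : exists B : 'M[R]_(r, n), row_free B /\ (G <= B)%MS.
  by rewrite rE; exists (row_base G); split; [exact: row_base_free|rewrite eq_row_base].
have BBu : B *m B^T \in unitmx.
  rewrite -row_free_unit; apply/inj_row_free => v vBB.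
  apply/eqP; rewrite -(mulmx_free_eq0 _ Bfree).
  apply/eqP/sqfrob_eq0; rewrite sqfrob_mxtrace trmx_mul mulmxA -(mulmxA v).
  by rewrite vBB mul0mx mxtrace0.
exists (B^T *m invmx (B *m B^T) *m B); split.
- by rewrite !(trmx_mul, trmx_inv, trmxK) mulmxA.
- by rewrite -!mulmxA (mulmxA B B^T) mulKmx// !mulmxA.
- have /submxP[C GE] := GB; rewrite [in LHS]GE [in RHS]GE.
  by rewrite -!mulmxA (mulmxA B B^T) mulKVmx.
by rewrite -mulmxA mxtrace_mulC -mulmxA mulVmx ?mxtrace1.
Qed.

(** Let Q project onto the row space of J^T Z. Off Q the projection D coincides with J^T F, hence
    has squared norm at most that of F; on Q it contributes at most \tr Q, which is at most \rank Z.
    The two parts add up to the squared norm of D, which is its trace. *)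
Lemma partial_isometry_rank m n (J F Z : 'M[R]_(m, n)) (D : 'M[R]_n) :
  D^T = D -> D *m D = D -> J^T *m J = D -> J = F + Z ->
  sqfrob (J^T *m F) <= sqfrob F ->
  \tr D <= (\rank Z)%:R + sqfrob F.
Proof.
move=> DT DD JJ JE JF.
have [Q [QT QQ GQ trQ]] := orthogonal_projection (J^T *m Z).
have IQT : (1%:M - Q)^T = 1%:M - Q by rewrite raddfB /= trmx1 QT.
have IQQ : (1%:M - Q) *m (1%:M - Q) = 1%:M - Q.
  by rewrite mulmxBl !mulmxBr !mul1mx !mulmx1 QQ subrr subr0.
have DQ : D *m (1%:M - Q) = (J^T *m F) *m (1%:M - Q).
  have {1}-> : D = J^T *m F + J^T *m Z by rewrite -mulmxDr -JE JJ.
  by rewrite mulmxDl (mulmxBr (J^T *m Z)) mulmx1 GQ subrr addr0.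
have leF : sqfrob (D *m (1%:M - Q)) <= sqfrob F.
  apply: le_trans JF; rewrite DQ -sqfrobT trmx_mul IQT -(sqfrobT (J^T *m F)).
  exact: sqfrob_proj_le.
have trD : \tr D = sqfrob D by rewrite sqfrob_mxtrace DT DD.
rewrite trD -(sqfrobT D) DT (sqfrob_proj_mul _ QT QQ) lerD//.
  rewrite (le_trans (y := sqfrob Q))//.
    rewrite -sqfrobT trmx_mul QT DT; exact: sqfrob_proj_le.
  by rewrite sqfrob_mxtrace QT QQ trQ ler_nat mxrankM_maxr.
by rewrite (le_trans _ leF)// -[leRHS]sqfrobT trmx_mul IQT DT mulmxBl mul1mx.
Qed.

Lemma sqfrob_mul_le m n q (A : 'M[R]_(m, n)) (B : 'M[R]_(n, q)) :
  sqfrob (A *m B) <= sqfrob A * sqfrob B.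
Proof.
have CS (I : finType) (f g : I -> R) :
    (\sum_i f i * g i) ^+ 2 <= (\sum_i f i ^+ 2) * (\sum_i g i ^+ 2).
  set F := \sum_i f i ^+ 2; set G := \sum_i g i ^+ 2; set H := \sum_i f i * g i.
  have F0 : 0 <= F by apply: sumr_ge0 => i _; exact: sqr_ge0.
  have : 0 <= \sum_i (H * f i - F * g i) ^+ 2.
    by apply: sumr_ge0 => i _; exact: sqr_ge0.
  have -> : \sum_i (H * f i - F * g i) ^+ 2 = F * (F * G - H ^+ 2).
    rewrite (eq_bigr (fun i => H ^+ 2 * f i ^+ 2 - 2 * H * F * (f i * g i) +
      F ^+ 2 * g i ^+ 2)); last by move=> i _; ring.
    by rewrite big_split sumrB -!mulr_sumr -/F -/G -/H /=; ring.
  move: F0; rewrite le_eqVlt => /orP[/eqP F0 _|F0]; last first.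
    by rewrite pmulr_rge0// subr_ge0.
  rewrite -F0 mul0r /H big1 ?expr0n// => i _.
  have /eqP := esym F0; rewrite psumr_eq0 => [|j _]; last exact: sqr_ge0.
  by move=> /allP/(_ i (mem_index_enum _))/=; rewrite sqrf_eq0 => /eqP->; rewrite mul0r.
rewrite /sqfrob mulr_suml; apply: ler_sum => i _.
rewrite [X in _ * X]exchange_big mulr_sumr; apply: ler_sum => j _.
by rewrite mxE; exact: CS.
Qed.

Lemma sqfrob_row_mx m n1 n2 (A : 'M[R]_(m, n1)) (B : 'M[R]_(m, n2)) :
  sqfrob (row_mx A B) = sqfrob A + sqfrob B.
Proof.
rewrite -big_split; apply: eq_bigr => i _; rewrite big_split_ord /=.
by congr (_ + _); apply: eq_bigr => j _; rewrite ?row_mxEl ?row_mxEr.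
Qed.

Lemma sqfrob_col_mx m1 m2 n (A : 'M[R]_(m1, n)) (B : 'M[R]_(m2, n)) :
  sqfrob (col_mx A B) = sqfrob A + sqfrob B.
Proof. by rewrite -sqfrobT tr_col_mx sqfrob_row_mx !sqfrobT. Qed.

Lemma sqfrob_block_mx m1 m2 n1 n2 (A : 'M[R]_(m1, n1)) (B : 'M[R]_(m1, n2))
    (C : 'M[R]_(m2, n1)) (D : 'M[R]_(m2, n2)) :
  sqfrob (block_mx A B C D) = sqfrob A + sqfrob B + (sqfrob C + sqfrob D).
Proof. by rewrite /block_mx sqfrob_col_mx !sqfrob_row_mx. Qed.

End SquaredFrobenius.

(** * Self-avoiding paths *)

Section Words.
Variable V : finType.

Fixpoint words (k : nat) : seq (seq V) :=
  if k is k'.+1 then [seq x :: s | x <- enum V, s <- words k'] else [:: [::]].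

Lemma words_uniq k : uniq (words k).
Proof.
elim: k => //= k IH; apply: allpairs_uniq => //; first exact: enum_uniq.
by move=> [x s] [y t] _ _ /= [-> ->].
Qed.

Lemma size_words k t : t \in words k -> size t = k.
Proof.
elim: k t => [|k IH] t /=; first by rewrite inE => /eqP->.
by move=> /allpairsP[[x s] /= [_ /IH sk ->]] /=; rewrite sk.
Qed.

Lemma big_wordsS (A : Type) (idx : A) (op : Monoid.com_law idx) k
    (Q : pred (seq V)) (F : seq V -> A) :
  \big[op/idx]_(t <- words k.+1 | Q t) F t =
  \big[op/idx]_x \big[op/idx]_(s <- words k | Q (x :: s)) F (x :: s).
Proof.
rewrite /= big_mkcond big_allpairs_dep/= big_enum/=.
by apply: eq_bigr => x _; rewrite -big_mkcond.
Qed.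

(** This will count the paths confined to the vertices of a given path, the only ones that can be
    correlated with it. *)
Lemma count_words k (A : seq V) :
  (\sum_(t <- words k | all (mem A) t) 1 <= size A ^ k)%N.
Proof.
elim: k => [|k IH]; first by rewrite big_cons big_nil.
rewrite big_wordsS expnS (bigID (mem A)) /= [X in (_ + X)%N]big1 => [|x xA].
  rewrite addn0; apply: (@leq_trans (\sum_(x in A) size A ^ k)%N).
    by apply: leq_sum => x xA; apply: leq_trans IH; rewrite xA.
  by rewrite sum_nat_const leq_mul2r card_size orbT.
by rewrite big_pred0// => s; rewrite (negbTE xA).
Qed.

Lemma size_wordsE k : size (words k) = (#|V| ^ k)%N.
Proof. by elim: k => //= k IH; rewrite size_allpairs IH -cardT expnS. Qed.

End Words.

Section Paths.
Variable N : nat.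
Local Notation V := 'I_N.
Implicit Types (x y z : V) (s t : seq V).

(** A canonical representative of the unordered pair, so that noise indexed by edges is
    symmetric. *)
Definition edge x y : V * V := if (x <= y)%N then (x, y) else (y, x).

Lemma edgeC x y : edge x y = edge y x.
Proof.
rewrite /edge; case: (ltngtP x y) => //= /val_inj ->; by rewrite ?leqnn.
Qed.

Lemma edge_inj x y x' y' : edge x y = edge x' y' ->
  (x = x' /\ y = y') \/ (x = y' /\ y = x').
Proof.
by rewrite /edge; case: ifP; case: ifP => _ _ [-> ->]; [left|right|right|left].
Qed.

Fixpoint path_edges x s : seq (V * V) :=
  if s is y :: s' then edge x y :: path_edges y s' else [::].

Lemma mem_path_edges a b x s : edge a b \in path_edges x s ->
  (a \in x :: s) && (b \in x :: s).
Proof.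
elim: s x => //= y s IH x; rewrite inE => /orP[/eqP/edge_inj|/IH].
  by case=> -[-> ->]; rewrite !inE !eqxx ?orbT.
by rewrite !(in_cons x) => /andP[-> ->]; rewrite !orbT.
Qed.

Lemma path_edges_uniq x s : uniq (x :: s) -> uniq (path_edges x s).
Proof.
elim: s x => // y s IH x /= /andP[xs us].
rewrite IH ?andbT//; apply: contra xs.
by move=> /mem_path_edges/andP[].
Qed.

Lemma path_edges_rcons x s z :
  path_edges x (rcons s z) = rcons (path_edges x s) (edge (last x s) z).
Proof. by elim: s x => //= y s IH x; rewrite IH. Qed.

Lemma path_edges_cover x s z : z \in s ->
  exists z', edge z' z \in path_edges x s.
Proof.
elim: s x => // y s IH x; rewrite inE => /orP[/eqP->|].
  by exists x; rewrite /= inE eqxx.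
by move=> /(IH y)[z' zz']; exists z'; rewrite /= inE zz' orbT.
Qed.

(* A self-avoiding path is determined by its last vertex and its edges: the
   only edge at the last vertex is the last one. *)
Lemma path_edges_inj x s x' s' : uniq (x :: s) -> uniq (x' :: s') ->
  last x s = last x' s' -> path_edges x s =i path_edges x' s' ->
  x :: s = x' :: s'.
Proof.
elim/last_ind: s s' => [|s z IH] s'.
  case: s' => [|y' s'] /= _ _; first by move=> ->.
  by move=> _ /(_ (edge x' y')); rewrite mem_head.
case/lastP: s' => [|s' z'] us us'.
  by move=> _ /(_ (edge (last x s) z)); rewrite path_edges_rcons mem_rcons mem_head.
rewrite !last_rcons => zz'; rewrite -{z'}zz' in us' *.
move: us us'; rewrite -!rcons_cons !rcons_uniq.
move=> /andP[zs us] /andP[zs' us'].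
rewrite !path_edges_rcons => ee.
have last_eq : last x s = last x' s'.
  have := ee (edge (last x s) z); rewrite !mem_rcons mem_head in_cons.
  move=> /esym/orP[/eqP/edge_inj[[//]|[h _]]|/mem_path_edges/andP[_]].
    by rewrite -h mem_last in zs.
  by rewrite (negbTE zs').
suff -> : x :: s = x' :: s' by [].
apply: IH => // e; have := ee e; rewrite !mem_rcons !inE -last_eq.
have ne u r : z \notin u :: r -> e \in path_edges u r -> e != edge (last x s) z.
  move=> zr er; apply/eqP => ee'; move: er; rewrite ee'.
  by move=> /mem_path_edges/andP[_]; rewrite (negbTE zr).
case: (boolP (e \in path_edges x s)) => [e1|e1].
  by rewrite (negbTE (ne _ _ zs e1)) /= => <-.
case: (boolP (e \in path_edges x' s')) => [e2|//].
by rewrite (negbTE (ne _ _ zs' e2)).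
Qed.

(** Every vertex of a closed walk lies on one of its edges, so equal edge sets force equal vertex
    sets. The walk itself is not recovered, which is why correlated closed walks are counted rather
    than identified. *)
Lemma path_edges_closed_sub x y s x' y' s' :
  (edge x y :: path_edges y s) =i (edge x' y' :: path_edges y' s') ->
  x \in y :: s -> x' \in y' :: s' -> {subset y' :: s' <= y :: s}.
Proof.
move=> ee xs xs' z.
have sub a b : edge a b \in edge x y :: path_edges y s -> b \in y :: s.
  rewrite inE => /orP[/eqP/edge_inj|/mem_path_edges/andP[]//].
  by case=> -[_ ->//]; rewrite mem_head.
rewrite inE => /orP[/eqP->|].
  by apply: (sub x'); rewrite ee mem_head.
by move=> /(path_edges_cover y')[z' h]; apply: (sub z'); rewrite ee inE h orbT.
Qed.

Lemma path_edges_sub x s x' s' : s' != [::] ->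
  path_edges x s =i path_edges x' s' -> {subset x' :: s' <= x :: s}.
Proof.
case: s' => // y' s' _ ee z.
have sub a b : edge a b \in path_edges x' (y' :: s') -> (a \in x :: s) && (b \in x :: s).
  by rewrite -ee; exact: mem_path_edges.
rewrite inE => /orP[/eqP->|].
  by case/andP: (sub x' y' (mem_head _ _)).
by move=> /(path_edges_cover x')[z' /sub/andP[]].
Qed.

End Paths.

(** * Moments of sums over self-avoiding paths *)

Section Monomials.
Context {d : measure_display} {T : measurableType d} {R : realType}.
Variable P : probability T R.

(** Independence is expressed through polynomials: only moments of path sums are computed, and the
    product of two monomials is again a product of one polynomial per edge. *)
Record independent_noise (E : finType) (xi : E -> T -> R) (b : R) : Prop :=
  IndependentNoise {
    noise_bounded : forall e, bounded_rv (xi e);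
    noise_le : forall e w, `|xi e w| <= b;
    noise_mean : forall e, Ex P (xi e) = 0;
    noise_indep : forall phi : E -> {poly R},
      Ex P (fun w => \prod_e (phi e).[xi e w]) =
      \prod_e Ex P (fun w => (phi e).[xi e w])
  }.

Lemma bounded_rv_sqfrob m n (A : T -> 'M[R]_(m, n)) :
  (forall i j, bounded_rv (fun w => A w i j)) ->
  bounded_rv (fun w => sqfrob (A w)).
Proof.
move=> bA; apply: bounded_rv_sum => i; apply: bounded_rv_sum => j.
exact: bounded_rvX.
Qed.

Lemma Ex_sqfrob m n (A : T -> 'M[R]_(m, n)) :
  (forall i j, bounded_rv (fun w => A w i j)) ->
  Ex P (fun w => sqfrob (A w)) = \sum_i \sum_j Ex P (fun w => A w i j ^+ 2).
Proof.
move=> bA; rewrite /sqfrob Ex_sum; last first.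
  by move=> i; apply: bounded_rv_sum => j; exact: bounded_rvX.
by apply: eq_bigr => i _; rewrite Ex_sum// => j; exact: bounded_rvX.
Qed.

Lemma bounded_rv_mulmx m n p (A : T -> 'M[R]_(m, n)) (D : 'M[R]_(n, p)) :
  (forall i j, bounded_rv (fun w => A w i j)) ->
  forall i j, bounded_rv (fun w => (A w *m D) i j).
Proof.
move=> bA i j; under eq_fun do rewrite mxE; apply: bounded_rv_sum => l.
by apply: bounded_rvM => //; exact: bounded_rv_cst.
Qed.

Lemma bounded_rv_addmx m n (A B : T -> 'M[R]_(m, n)) :
  (forall i j, bounded_rv (fun w => A w i j)) ->
  (forall i j, bounded_rv (fun w => B w i j)) ->
  forall i j, bounded_rv (fun w => (A w + B w) i j).
Proof.
by move=> bA bB i j; under eq_fun do rewrite mxE; exact: bounded_rvD.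
Qed.

Lemma Forall_sum_le (I : Type) (L : seq I) (F : I -> R) (C : R) :
  List.Forall (fun l => F l <= C) L ->
  \sum_(l <- L) F l <= (size L)%:R * C.
Proof.
elim=> [|l L' FC _ IH]; first by rewrite big_nil mul0r.
by rewrite big_cons /= -natr1 mulrDl mul1r addrC lerD.
Qed.

Lemma bounded_rv_sum_mx (I : Type) (L : seq I) m n (F : I -> T -> 'M[R]_(m, n)) :
  (forall l i j, bounded_rv (fun w => F l w i j)) ->
  forall i j, bounded_rv (fun w => (\sum_(l <- L) F l w) i j).
Proof.
by move=> bF i j; under eq_fun do rewrite summxE; exact: bounded_rv_sum.
Qed.

Lemma Ex_sqfrob_sum_le (I : Type) (L : seq I) m n (F : I -> T -> 'M[R]_(m, n))
    (h : nat) (C : R) :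
  (forall l i j, bounded_rv (fun w => F l w i j)) -> (size L <= h)%N -> 0 <= C ->
  List.Forall (fun l => Ex P (fun w => sqfrob (F l w)) <= C) L ->
  Ex P (fun w => sqfrob (\sum_(l <- L) F l w)) <= h%:R ^+ 2 * C.
Proof.
move=> bF Lh C0 FC.
have bs l : bounded_rv (fun w => sqfrob (F l w)) by exact: bounded_rv_sqfrob.
apply: (@le_trans _ _ ((size L)%:R * Ex P (fun w => \sum_(l <- L) sqfrob (F l w)))).
  rewrite -ExZ; last exact: bounded_rv_sum.
  apply: le_Ex; last by move=> w; exact: sqfrob_sum.
    by apply: bounded_rv_sqfrob; exact: bounded_rv_sum_mx.
  by apply: bounded_rvM; [exact: bounded_rv_cst|exact: bounded_rv_sum].
rewrite Ex_sum// expr2 -mulrA ler_pM ?ler_nat//.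
  by apply: sumr_ge0 => l _; apply: Ex_ge0 => w; exact: sqfrob_ge0.
apply: le_trans (Forall_sum_le FC) _.
by rewrite ler_wpM2r// ler_nat.
Qed.

Variables (E : finType) (xi : E -> T -> R) (b : R).
Hypothesis xiP : independent_noise xi b.

Definition entry_var e : R := Ex P (fun w => xi e w ^+ 2).

Lemma entry_var_ge0 e : 0 <= entry_var e.
Proof. by apply: Ex_ge0 => w; exact: sqr_ge0. Qed.

Lemma noise_sqr_le e w : xi e w ^+ 2 <= b ^+ 2.
Proof.
rewrite -(real_normK (num_real (xi e w))) ler_sqr ?nnegrE//.
  exact: noise_le xiP _ _.
exact: le_trans (noise_le xiP e w).
Qed.

Lemma entry_var_le e : entry_var e <= b ^+ 2.
Proof.
apply: Ex_le_cst; first by apply: bounded_rvX; exact: noise_bounded xiP e.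
by move=> w; exact: noise_sqr_le.
Qed.

Definition mono (phi : E -> {poly R}) w : R := \prod_e (phi e).[xi e w].

Lemma bounded_mono phi : bounded_rv (mono phi).
Proof.
by apply: bounded_rv_prod => e; apply: bounded_rv_horner; exact: noise_bounded xiP e.
Qed.

Lemma Ex_monoM phi psi : Ex P (fun w => mono phi w * mono psi w) =
  \prod_e Ex P (fun w => (phi e * psi e).[xi e w]).
Proof.
rewrite -(noise_indep xiP); congr Ex; apply/funext => w.
by rewrite /mono -big_split; apply: eq_bigr => e _; rewrite hornerM.
Qed.

Definition centered_on (L : seq E) (phi : E -> {poly R}) :=
  (forall e, e \in L -> Ex P (fun w => (phi e).[xi e w]) = 0) /\
  (forall e, e \notin L -> phi e = 1).

(** An edge in exactly one of the two lists contributes a factor of mean zero to the factorised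
    expectation. *)
Lemma Ex_mono_orth L L' phi psi : centered_on L phi -> centered_on L' psi ->
  ~ (L =i L') -> Ex P (fun w => mono phi w * mono psi w) = 0.
Proof.
move=> [Lphi0 Lphi1] [Lpsi0 Lpsi1] LL'; rewrite Ex_monoM.
have [e eLL'] : exists e, (e \in L) != (e \in L').
  by apply: contrapT => h; apply: LL' => e; apply/eqP/negP => /negP ee; apply: h; exists e.
rewrite (bigD1 e)//= (_ : Ex _ _ = 0) ?mul0r//.
case: (boolP (e \in L)) eLL' => eL; case: (boolP (e \in L')) => // eL' _.
  by rewrite Lpsi1//; under eq_fun do rewrite mulr1; exact: Lphi0.
by rewrite Lphi1//; under eq_fun do rewrite mul1r; exact: Lpsi0.
Qed.

Definition edge_poly (L : seq E) e : {poly R} := if e \in L then 'X else 1.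

Lemma centered_edge_poly L : centered_on L (edge_poly L).
Proof.
rewrite /edge_poly; split=> e; last by move/negbTE => ->.
by move=> ->; under eq_fun do rewrite hornerX; exact: noise_mean xiP e.
Qed.

Lemma mono_edge_poly L w : uniq L ->
  mono (edge_poly L) w = \prod_(e <- L) xi e w.
Proof.
move=> uL; rewrite big_uniq//= big_mkcond; apply: eq_bigr => e _.
by rewrite /edge_poly; case: ifP => _; rewrite ?hornerX ?hornerC.
Qed.

Lemma Ex_mono_edge_poly_sqr L : uniq L ->
  Ex P (fun w => mono (edge_poly L) w * mono (edge_poly L) w) =
  \prod_(e <- L) entry_var e.
Proof.
move=> uL; rewrite big_uniq//= big_mkcond Ex_monoM; apply: eq_bigr => e _.
rewrite /edge_poly; case: ifP => _.
  by congr Ex; apply/funext => w; rewrite hornerM hornerX expr2.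
by under eq_fun do rewrite mulr1 hornerC; rewrite (Ex_cst P 1).
Qed.

(** The monomial of a path preceded by the retraced edge [e0]. Subtracting the variance centres the
    squared entry, so orthogonality still applies; the variance itself goes into the weights of
    shorter paths. *)
Definition square_edge_poly (e0 : E) (L : seq E) e : {poly R} :=
  if e == e0 then 'X ^+ 2 - (entry_var e0)%:P else edge_poly L e.

Lemma centered_square_edge_poly e0 L :
  centered_on (e0 :: L) (square_edge_poly e0 L).
Proof.
have [L0 L1] := centered_edge_poly L.
rewrite /square_edge_poly; split=> e; rewrite inE; case: eqVneq => //=.
  move=> -> _; under eq_fun do rewrite hornerD hornerN hornerXn hornerC.
  rewrite ExB ?(Ex_cst P (entry_var e0)) ?subrr//; last exact: bounded_rv_cst.
  by apply: bounded_rvX; exact: noise_bounded xiP e0.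
- by move=> _; exact: L0.
- by move=> _; exact: L1.
Qed.

Lemma mono_square_edge_poly e0 L w : uniq (e0 :: L) ->
  mono (square_edge_poly e0 L) w =
  (xi e0 w ^+ 2 - entry_var e0) * \prod_(e <- L) xi e w.
Proof.
move=> /= /andP[e0L uL]; rewrite -(mono_edge_poly _ uL) /mono.
rewrite (bigD1 e0)//= [in RHS](bigD1 e0)//= {1}/square_edge_poly eqxx.
rewrite hornerD hornerN hornerXn !hornerC {1}/edge_poly (negbTE e0L) hornerC.
rewrite mul1r; congr (_ * _); apply: eq_bigr => e /negbTE ee0.
by rewrite /square_edge_poly ee0.
Qed.

Lemma Ex_sqr_sum (I : Type) (L : seq I) (Q : pred I) (c : I -> R)
    (phi : I -> E -> {poly R}) :
  Ex P (fun w => (\sum_(t <- L | Q t) c t * mono (phi t) w) ^+ 2) =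
  \sum_(t <- L | Q t) \sum_(t' <- L | Q t')
    c t * c t' * Ex P (fun w => mono (phi t) w * mono (phi t') w).
Proof.
have bm t t' : bounded_rv (fun w => mono (phi t) w * mono (phi t') w).
  by apply: bounded_rvM; exact: bounded_mono.
have bc t t' : bounded_rv
    (fun w => c t * c t' * (mono (phi t) w * mono (phi t') w)).
  by apply: bounded_rvM => //; exact: bounded_rv_cst.
transitivity (Ex P (fun w => \sum_(t <- L | Q t) \sum_(t' <- L | Q t')
    c t * c t' * (mono (phi t) w * mono (phi t') w))).
  congr Ex; apply/funext => w; rewrite expr2 mulr_suml; apply: eq_bigr => t _.
  by rewrite mulr_sumr; apply: eq_bigr => t' _; ring.
rewrite Ex_sum; last by move=> t; exact: bounded_rv_sum.
apply: eq_bigr => t _; rewrite Ex_sum//.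
by apply: eq_bigr => t' _; rewrite ExZ.
Qed.

Lemma Ex_sqr_sum_orth (I : eqType) (L : seq I) (Q : pred I) (c : I -> R)
    (phi : I -> E -> {poly R}) : uniq L ->
  (forall t t', Q t -> Q t' -> t != t' ->
    Ex P (fun w => mono (phi t) w * mono (phi t') w) = 0) ->
  Ex P (fun w => (\sum_(t <- L | Q t) c t * mono (phi t) w) ^+ 2) =
  \sum_(t <- L | Q t)
    c t ^+ 2 * Ex P (fun w => mono (phi t) w * mono (phi t) w).
Proof.
move=> uL orth; rewrite Ex_sqr_sum big_seq_cond [in RHS]big_seq_cond.
apply: eq_bigr => t /andP[tL Qt].
rewrite (big_rem t)//= Qt big1_seq ?addr0 ?expr2// => t' /andP[Qt'].
by rewrite mem_rem_uniq// inE eq_sym => /andP[tt' _]; rewrite orth ?mulr0.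
Qed.

(** The substitute for orthogonality when distinct indices may have correlated monomials: r contains
    all correlated pairs, each pair costs at most B^2, and it remains to count them. *)
Lemma Ex_sqr_sum_le (I : Type) (L : seq I) (Q : pred I) (c : I -> R)
    (phi : I -> E -> {poly R}) (r : I -> I -> bool) (B : R) : 0 <= B ->
  (forall t, `|c t| <= 1) ->
  (forall t w, Q t -> `|mono (phi t) w| <= B) ->
  (forall t t', Q t -> Q t' -> ~~ r t t' ->
    Ex P (fun w => mono (phi t) w * mono (phi t') w) = 0) ->
  Ex P (fun w => (\sum_(t <- L | Q t) c t * mono (phi t) w) ^+ 2) <=
  B ^+ 2 * (\sum_(t <- L | Q t) \sum_(t' <- L | Q t' && r t t') 1)%:R.
Proof.
move=> B0 c1 monoB orth; rewrite Ex_sqr_sum natr_sum mulr_sumr.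
apply: ler_sum => t Qt; rewrite natr_sum mulr_sumr big_mkcondr/=.
apply: ler_sum => t' Qt'; case: ifPn => [_|rtt']; last by rewrite orth// mulr0.
apply: le_trans (ler_norm _) _; rewrite normrM normrM mulr1.
have n0 (x : R) : 0 <= `|x| by [].
have : `|Ex P (fun w => mono (phi t) w * mono (phi t') w)| <= B ^+ 2.
  apply: norm_Ex_le; first by apply: bounded_rvM; exact: bounded_mono.
  by move=> w; rewrite normrM expr2 ler_pM// monoB.
have : `|c t| * `|c t'| <= 1 by rewrite mulr_ile1.
move: (n0 (c t)) (n0 (c t')) (n0 (Ex P (fun w => mono (phi t) w * mono (phi t') w))).
set X := `|Ex _ _|; set y := `|c t|; set z := `|c t'| => y0 z0 X0 yz XB.
by rewrite -[leRHS]mul1r ler_pM// mulr_ge0.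
Qed.

Lemma prod_noise_le (L : seq E) w :
  `|\prod_(e <- L) xi e w| <= b ^+ size L.
Proof.
rewrite normr_prod; elim: L => [|e L IH]; first by rewrite big_nil.
rewrite big_cons exprS ler_pM// ?prodr_ge0//; exact: noise_le xiP _ _.
Qed.

End Monomials.

(** * Expansion of powers of the noise matrix into self-avoiding paths *)

Section PathMatrices.
Context {d : measure_display} {T : measurableType d} {R : realType}.
Variable P : probability T R.
Variables (N : nat) (xi : 'I_N * 'I_N -> T -> R) (b : R).
Local Notation V := 'I_N.
Hypothesis xiP : independent_noise P xi b.
Local Notation v := (entry_var P xi).
Hypothesis row_le1 : forall x : V, \sum_y v (edge x y) <= 1.
Implicit Types (k : nat) (c : seq V -> R) (i x y : V) (s t : seq V).

Definition noise_mx w : 'M[R]_N := \matrix_(x, y) xi (edge x y) w.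

Definition saw_to i x s := uniq (x :: s) && (last x s == i).

(** The column is the start of the path and the row its end, so right multiplication by the noise
    matrix prepends a vertex. The weight c is an arbitrary function of the whole vertex list, since
    retracing produces weights that depend on it. *)
Definition saw_mx k c w : 'M[R]_N := \matrix_(i, x)
  \sum_(s <- words V k | saw_to i x s)
    c (x :: s) * \prod_(e <- path_edges x s) xi e w.

Definition extend c t := c (behead t).

(** The walk x, y, x followed by s is shortened to x :: s: the squared entry at the retraced edge is
    replaced by its mean, and the weight collects all the vertices y that were removed. *)
Definition backtrack c t : R :=
  if t is x :: s then \sum_(y | y \notin t) v (edge y x) * c (y :: t) else 0.

(** The prepended vertex x already lies on the path but is not its second vertex, since that would
    be a retraced edge. The case x = y is a loop, coming from a diagonal entry. *)
Definition closing_mx k c w : 'M[R]_N := \matrix_(i, x)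
  \sum_y \sum_(s <- words V k |
      saw_to i y s && (x \in y :: s) && (ohead s != Some x))
    c (y :: s) * \prod_(e <- edge y x :: path_edges y s) xi e w.

Definition fluctuation_mx k c w : 'M[R]_N := \matrix_(i, x)
  \sum_y \sum_(s <- words V k | uniq (y :: x :: s) && (last x s == i))
    c (y :: x :: s) * ((xi (edge y x) w ^+ 2 - v (edge y x)) *
                       \prod_(e <- path_edges x s) xi e w).

Definition error_mx k c w : 'M[R]_N :=
  closing_mx k c w + (if k is k'.+1 then fluctuation_mx k' c w else 0).

(* Prepending a vertex to a self-avoiding path either extends it, or retraces
   its first edge, or closes a cycle. *)
Lemma saw_mx_mul k c w : saw_mx k c w *m noise_mx w =
  saw_mx k.+1 (extend c) w +
  (if k is k'.+1 then saw_mx k' (backtrack c) w else 0) + error_mx k c w.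
Proof.
apply/matrixP => i x; rewrite [LHS]mxE.
pose F y s := c (y :: s) * \prod_(e <- edge y x :: path_edges y s) xi e w.
rewrite (eq_bigr (fun y => \sum_(s <- words V k | saw_to i y s) F y s)); last first.
  move=> y _; rewrite !mxE mulr_suml; apply: eq_bigr => s _.
  by rewrite /F big_cons -mulrA [xi _ _ * _]mulrC.
rewrite (eq_bigr (fun y =>
    \sum_(s <- words V k | saw_to i y s && (x \notin y :: s)) F y s +
    (\sum_(s <- words V k | saw_to i y s && (ohead s == Some x)) F y s +
     \sum_(s <- words V k |
        saw_to i y s && (x \in y :: s) && (ohead s != Some x)) F y s)));
  last first.
  move=> y _; rewrite (bigID (fun s => x \notin y :: s)) /=; congr (_ + _).
  rewrite (bigID (fun s => ohead s == Some x)) /=; congr (_ + _).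
    apply: eq_bigl => s; rewrite negbK -andbA; congr (_ && _).
    case: eqVneq => [|_]; rewrite ?andbF// andbT.
    by case: s => //= z s [->]; rewrite !inE eqxx orbT.
  by apply: eq_bigl => s; rewrite negbK.
rewrite !big_split /=.
have mxDE (A B : 'M[R]_N) : (A + B) i x = A i x + B i x by rewrite mxE.
have -> : \sum_y \sum_(s <- words V k | saw_to i y s && (x \notin y :: s)) F y s =
    saw_mx k.+1 (extend c) w i x.
  rewrite mxE big_wordsS; apply: eq_bigr => y _; apply: eq_big => s.
    by rewrite /saw_to (cons_uniq x) andbC andbA.
  by move=> _; rewrite /F /extend /= (edgeC x y).
have -> : \sum_y \sum_(s <- words V k |
    saw_to i y s && (x \in y :: s) && (ohead s != Some x)) F y s =
    closing_mx k c w i x by rewrite mxE.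
have -> : \sum_y \sum_(s <- words V k | saw_to i y s && (ohead s == Some x)) F y s =
    (if k is k'.+1 then saw_mx k' (backtrack c) w else 0) i x +
    (if k is k'.+1 then fluctuation_mx k' c w else 0) i x.
  case: k @F => [|k] F.
    rewrite !mxE addr0 big1// => y _; rewrite big_mkcond/= big_cons big_nil.
    by rewrite andbF addr0.
  rewrite [saw_mx _ _ _ i x]mxE [fluctuation_mx _ _ _ i x]mxE.
  transitivity (\sum_y \sum_(s <- words V k | saw_to i y (x :: s)) F y (x :: s)).
    apply: eq_bigr => y _; rewrite big_wordsS (bigD1 x)//= [X in _ + X]big1.
      by rewrite addr0; apply: eq_bigl => s; rewrite eqxx andbT.
    by move=> z zx; rewrite big_pred0// => s; rewrite (inj_eq Some_inj) (negbTE zx) andbF.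
  (* The entry at the retraced edge occurs twice; its square is its mean plus a fluctuation, which
     feed [backtrack] and [fluctuation_mx] respectively. *)
  transitivity (\sum_y \sum_(s <- words V k | saw_to i y (x :: s))
      (v (edge y x) * c (y :: x :: s) * \prod_(e <- path_edges x s) xi e w +
       c (y :: x :: s) * ((xi (edge y x) w ^+ 2 - v (edge y x)) *
                       \prod_(e <- path_edges x s) xi e w))).
    apply: eq_bigr => y _; apply: eq_bigr => s _.
    by rewrite /F /= !big_cons; ring.
  under eq_bigr do rewrite big_split /=.
  rewrite big_split /=; congr (_ + _).
  under eq_bigr do rewrite big_mkcond /=.
  rewrite exchange_big /= [RHS]big_mkcond; apply: eq_bigr => s _ /=.
  rewrite -big_mkcond /=; case: ifPn => sxs; last first.
    rewrite big_pred0// => y; move: sxs; rewrite /saw_to /= !negb_and.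
    by case: (y \in _) => //=; case: (x \in s) => //=; case: (uniq s) => //= /negbTE ->.
  rewrite mulr_suml; apply: eq_bigl => y.
  by move: sxs; rewrite /saw_to /= => /andP[-> ->]; rewrite !andbT.
by rewrite !mxDE; ring.
Qed.

Definition steps (kc : nat * (seq V -> R)) : seq (nat * (seq V -> R)) :=
  (kc.1.+1, extend kc.2) ::
  (if kc.1 is k'.+1 then [:: (k', backtrack kc.2)] else [::]).

(** The lengths and weights of the path sums present after m multiplications, a binary branching in
    which paths of length 0 cannot be retraced. Errors are split off at the multiplication that
    creates them and not propagated. *)
Fixpoint states m : seq (nat * (seq V -> R)) :=
  if m is m'.+1 then flatten [seq steps kc | kc <- states m']
  else [:: (0%N, fun=> 1)].

Definition states_mx m w := \sum_(kc <- states m) saw_mx kc.1 kc.2 w.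
Definition states_error m w := \sum_(kc <- states m) error_mx kc.1 kc.2 w.

Lemma saw_mx0 w : saw_mx 0 (fun=> 1) w = 1%:M.
Proof.
apply/matrixP => i x; rewrite !mxE big_mkcond /= big_cons big_nil addr0.
by rewrite /saw_to /= eq_sym; case: eqP => _; rewrite ?big_nil ?mulr1.
Qed.

Lemma states_mx0 w : states_mx 0 w = 1%:M.
Proof. by rewrite /states_mx big_cons big_nil addr0 saw_mx0. Qed.

Lemma states_mx_mul m w :
  states_mx m w *m noise_mx w = states_mx m.+1 w + states_error m w.
Proof.
rewrite /states_mx /states_error mulmx_suml /= big_flatten big_map -big_split.
apply: eq_bigr => -[k c] _ /=; rewrite saw_mx_mul; congr (_ + _).
by case: k => [|k]; rewrite big_cons ?big_nil ?addr0// big_cons big_nil ?addr0.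
Qed.

Lemma size_states m : (size (states m) <= 2 ^ m)%N.
Proof.
elim: m => // m IH /=; rewrite size_flatten /shape -map_comp sumnE big_map.
apply: (@leq_trans (\sum_(kc <- states m) 2)%N).
  by apply: leq_sum => -[[|k] c] _.
by rewrite big_const_seq count_predT iter_addn_0 expnS leq_mul2l IH.
Qed.

(** Here the normalisation of the row sums of variances is used: retracing averages the weights with
    total mass at most 1, so they stay bounded however often it occurs. *)
Lemma backtrack_le1 c : (forall t, `|c t| <= 1) -> forall t, `|backtrack c t| <= 1.
Proof.
move=> c1 [|x s] /=; first by rewrite normr0.
apply: le_trans (ler_norm_sum _ _ _) _.
apply: le_trans (row_le1 x); rewrite big_mkcond /=; apply: ler_sum => y _.
have v0 := entry_var_ge0 P xi (edge x y).
case: ifP => // _; rewrite edgeC normrM (ger0_norm v0).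
by rewrite -[leRHS]mulr1 ler_wpM2l.
Qed.

Lemma states_Forall m : List.Forall
  (fun kc => (kc.1 <= m)%N /\ forall t, `|kc.2 t| <= 1) (states m).
Proof.
elim: m => [|m IH] /=; first by constructor => //=; split=> // t; rewrite normr1.
elim: IH => [|[k c] L /= [km c1] _ IHL] /=; first by constructor.
constructor; first by split=> // t; exact: c1.
case: k km => [|k] km //=; constructor => //; split => /=.
  exact: leq_trans (ltnW km) (leqnSn _).
exact: backtrack_le1.
Qed.

Lemma sum_path_var_le1 k x :
  \sum_(s <- words V k) \prod_(e <- path_edges x s) v e <= 1.
Proof.
elim: k x => [|k IH] x; first by rewrite big_cons !big_nil addr0.
rewrite big_wordsS; apply: le_trans (row_le1 x); apply: ler_sum => y _.
under eq_bigr do rewrite big_cons.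
by rewrite -mulr_sumr -[leRHS]mulr1 ler_wpM2l// entry_var_ge0.
Qed.

Lemma bounded_rv_noise_prod (L : seq (V * V)) :
  bounded_rv (fun w => \prod_(e <- L) xi e w).
Proof. by apply: bounded_rv_prod => e; exact: noise_bounded xiP e. Qed.

Lemma bounded_rv_saw k c i x : bounded_rv (fun w => saw_mx k c w i x).
Proof.
under eq_fun do rewrite mxE; apply: bounded_rv_sum => s.
by apply: bounded_rvM; [exact: bounded_rv_cst|exact: bounded_rv_noise_prod].
Qed.

Lemma bounded_rv_closing k c i x : bounded_rv (fun w => closing_mx k c w i x).
Proof.
under eq_fun do rewrite mxE; apply: bounded_rv_sum => y.
apply: bounded_rv_sum => s.
by apply: bounded_rvM; [exact: bounded_rv_cst|exact: bounded_rv_noise_prod].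
Qed.

Lemma bounded_rv_fluctuation k c i x :
  bounded_rv (fun w => fluctuation_mx k c w i x).
Proof.
under eq_fun do rewrite mxE; apply: bounded_rv_sum => y.
apply: bounded_rv_sum => s.
apply: bounded_rvM; first exact: bounded_rv_cst.
apply: bounded_rvM; last exact: bounded_rv_noise_prod.
apply: bounded_rvB; last exact: bounded_rv_cst.
by apply: bounded_rvX; exact: noise_bounded xiP _.
Qed.

Lemma bounded_rv_error k c i x : bounded_rv (fun w => error_mx k c w i x).
Proof.
apply: bounded_rv_addmx; first exact: bounded_rv_closing.
move=> {}i {}x; case: k => [|k]; last exact: bounded_rv_fluctuation.
by under eq_fun do rewrite mxE; exact: bounded_rv_cst.
Qed.

(** For a fixed end i, distinct paths have orthogonal monomials, so the second moment of an entry is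
    a sum over single paths. The factor of D depends only on the start x. Summing over i frees the
    end, and the products of variances over all paths from x sum to at most 1. *)
Lemma Ex_sqfrob_saw_mul k c r (D : 'M[R]_(N, r)) :
  (forall t, `|c t| <= 1) ->
  Ex P (fun w => sqfrob (saw_mx k c w *m D)) <= sqfrob D.
Proof.
move=> c1.
have bSD i l : bounded_rv (fun w => (saw_mx k c w *m D) i l).
  by apply: bounded_rv_mulmx => {}i {}l; exact: bounded_rv_saw.
rewrite Ex_sqfrob//.
pose ep i t := path_edges (head i t) (behead t).
pose Q i t := [&& uniq t, last i t == i & t != [::]].
have entryE i l w : (saw_mx k c w *m D) i l = \sum_(t <- words V k.+1 | Q i t)
    (c t * D (head i t) l) * mono xi (edge_poly (ep i t)) w.
  rewrite mxE big_wordsS; apply: eq_bigr => x _; rewrite mxE mulr_suml.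
  apply: eq_big => s; first by rewrite /Q /= andbT.
  move=> /andP[us _]; rewrite /ep /= mono_edge_poly; last exact: path_edges_uniq.
  by rewrite mulrAC.
have entry_le i l : Ex P (fun w => (saw_mx k c w *m D) i l ^+ 2) <=
    \sum_x \sum_(s <- words V k | saw_to i x s)
      D x l ^+ 2 * \prod_(e <- path_edges x s) v e.
  under eq_fun do rewrite entryE.
  rewrite (Ex_sqr_sum_orth xiP); last 2 first.
  - exact: words_uniq.
  - move=> [|x s] [|x' s'] //=; rewrite /Q ?andbF// !andbT.
    move=> /andP[us /eqP ls] /andP[us' /eqP ls'] ss'.
    apply: (Ex_mono_orth xiP (centered_edge_poly xiP _) (centered_edge_poly xiP _)).
    move=> ee; move/eqP: ss'; apply; apply: path_edges_inj => //=.
    by rewrite /= in ls ls'; rewrite ls ls'.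
  rewrite big_wordsS; apply: ler_sum => x _.
  rewrite (eq_bigl (saw_to i x)); last by move=> s; rewrite /Q /= andbT.
  apply: ler_sum => s /andP[us _].
  rewrite (Ex_mono_edge_poly_sqr xiP)//; last exact: path_edges_uniq.
  rewrite ler_wpM2r ?prodr_ge0//; first by move=> e _; exact: entry_var_ge0.
  rewrite exprMn -[leRHS]mul1r ler_wpM2r ?sqr_ge0//.
  by rewrite -(real_normK (num_real _)) exprn_ile1.
rewrite /sqfrob [leRHS]exchange_big [leLHS]exchange_big /=; apply: ler_sum => l _.
apply: le_trans (ler_sum _ (fun i _ => entry_le i l)) _.
rewrite exchange_big /=; apply: ler_sum => x _.
under eq_bigr do rewrite big_mkcond /=.
rewrite exchange_big /=.
apply: (@le_trans _ _ (\sum_(s <- words V k)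
    D x l ^+ 2 * \prod_(e <- path_edges x s) v e)).
  apply: ler_sum => s _; rewrite -big_mkcond /= /saw_to.
  case: (uniq _); last first.
    rewrite big_pred0// mulr_ge0 ?sqr_ge0// prodr_ge0// => e _.
    exact: entry_var_ge0.
  by rewrite (eq_bigl (pred1 (last x s))) ?big_pred1_eq// => i; rewrite /= eq_sym.
by rewrite -mulr_sumr -[leRHS]mulr1 ler_wpM2l ?sqr_ge0// sum_path_var_le1.
Qed.

Hypothesis b_ge0 : 0 <= b.

(** Each of the k + 1 entries of a monomial contributes b^2, matched by one factor N for each of the
    k + 1 vertices; the closing vertex is one of these, so no free factor N is left. It has k + 1
    choices, and correlated partners live on the same vertices, which gives the remaining (k + 1)^(k
    + 1). *)
Lemma Ex_sqfrob_closing k c : (forall t, `|c t| <= 1) ->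
  Ex P (fun w => sqfrob (closing_mx k c w)) <=
  (b ^+ 2 * N%:R) ^+ k.+1 * (k.+1 ^ k.+2)%:R.
Proof.
move=> c1; rewrite Ex_sqfrob; last exact: bounded_rv_closing.
pose L x t := edge (head x t) x :: path_edges (head x t) (behead t).
pose Q i x t := [&& size t == k.+1, saw_to i (head x t) (behead t), x \in t &
  ohead (behead t) != Some x].
(* The closing edge is not on the path: the only path edge at the first vertex leads to the second
   one, which the condition on [ohead] excludes. *)
have uL i x t : Q i x t -> uniq (L x t).
  case: t => [|y s] //; rewrite /L /Q /= => /and4P[_ /andP[us _] xys xs].
  rewrite path_edges_uniq// andbT; apply/negP.
  case: s us xys xs => [|z s] //= us _ zx; rewrite inE => /orP[/eqP/edge_inj|].
    by case=> -[h1 h2]; rewrite h2 ?h1 eqxx in zx.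
  by move=> /mem_path_edges/andP[yzs _]; rewrite yzs in us.
have entryE i x w : closing_mx k c w i x = \sum_(t <- words V k.+1 | Q i x t)
    c t * mono xi (edge_poly (L x t)) w.
  rewrite mxE big_wordsS; apply: eq_bigr => y _.
  rewrite big_seq_cond [RHS]big_seq_cond; apply: eq_big => s.
    case: (boolP (s \in _)) => //= /size_words sk.
    by rewrite /Q /= sk eqxx /= andbA.
  move=> /andP[/size_words sk Qs]; rewrite mono_edge_poly//.
  by apply: (uL i x (y :: s)); rewrite /Q /= sk eqxx /= andbA.
have entry_le i x : Ex P (fun w => closing_mx k c w i x ^+ 2) <=
    (b ^+ k.+1) ^+ 2 *
    (\sum_(t <- words V k.+1 | Q i x t) k.+1 ^ k.+1)%:R.
  under eq_fun do rewrite entryE.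
  apply: (@le_trans _ _ ((b ^+ k.+1) ^+ 2 * (\sum_(t <- words V k.+1 | Q i x t)
      \sum_(t' <- words V k.+1 | Q i x t' && all (mem t) t') 1)%:R)).
    apply: (@Ex_sqr_sum_le _ _ _ _ _ _ _ xiP _ _ _ _ _ (fun t t' => all (mem t) t')) => //.
    - exact: exprn_ge0.
    - move=> t w Qt; rewrite mono_edge_poly; last exact: uL Qt.
      apply: le_trans (prod_noise_le xiP _ _) _.
      suff -> : size (L x t) = k.+1 by [].
      case: t Qt => [//|y s]; rewrite /Q /L /= => /andP[/eqP[<-] _].
      by congr _.+1; elim: s y => //= z s IH y; rewrite IH.
    - move=> t t' Qt Qt' tt'.
      apply: (Ex_mono_orth xiP (centered_edge_poly xiP _) (centered_edge_poly xiP _)).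
      case: t Qt tt' => [/andP[]//|y s] /and4P[_ _ xs _].
      case: t' Qt' => [/andP[]//|y' s'] /and4P[_ _ xs' _] /negP ss' ee; apply: ss'.
      apply/allP => z zs'; apply: (@path_edges_closed_sub N x y s x y' s') => //.
      by move=> e; have := ee e; rewrite /L /= (edgeC x y) (edgeC x y').
  rewrite ler_wpM2l ?sqr_ge0// ler_nat big_seq_cond [leqRHS]big_seq_cond.
  apply: leq_sum => t /andP[/size_words tk _].
  apply: (@leq_trans (\sum_(t' <- words V k.+1 | all (mem t) t') 1)%N).
    by rewrite big_mkcond [leqRHS]big_mkcond leq_sum//= => t' _; case: (Q _ _ _).
  by rewrite -{2}tk; exact: count_words.
apply: le_trans (ler_sum _ (fun i _ => ler_sum _ (fun x _ => entry_le i x))) _.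
under eq_bigr do rewrite -mulr_sumr -natr_sum.
rewrite -mulr_sumr -natr_sum exprMn -exprM mulnC exprM -mulrA.
rewrite ler_wpM2l ?exprn_ge0// -natrX -natrM ler_nat.
under eq_bigr do (under eq_bigr do rewrite big_mkcond /=; rewrite exchange_big /=).
rewrite exchange_big /= (expnS _ k.+1) mulnA.
apply: (@leq_trans (\sum_(t <- words V k.+1) k.+1 * k.+1 ^ k.+1)%N); last first.
  rewrite big_const_seq count_predT iter_addn_0 size_wordsE card_ord.
  by rewrite mulnC mulnA.
rewrite -/(words V k.+1).
rewrite big_seq [leqRHS]big_seq; apply: leq_sum => t /size_words tk.
rewrite exchange_big /=.
apply: (@leq_trans (\sum_(x in t) k.+1 ^ k.+1)%N); last first.
  by rewrite sum_nat_const leq_mul2r -[leqRHS]tk card_size orbT.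
rewrite [leqRHS]big_mkcond /=; apply: leq_sum => x _.
rewrite (bigD1 (last (head x t) (behead t)))//= big1 => [|i /negbTE it].
  by rewrite addn0; case: ifP => [/and4P[_ _ -> _]|].
by rewrite /Q /saw_to (eq_sym (last _ _)) it !(andbF, andFb).
Qed.

(** The centred square counts as two entries, so a monomial has size b^(k + 2), and y together with
    the path has k + 2 vertices: powers of b^2 and N match again. A partner shares the column x, so
    only k + 1 of its vertices are chosen among k + 2. *)
Lemma Ex_sqfrob_fluctuation k c : (forall t, `|c t| <= 1) ->
  Ex P (fun w => sqfrob (fluctuation_mx k c w)) <=
  (b ^+ 2 * N%:R) ^+ k.+2 * (k.+2 ^ k.+1)%:R.
Proof.
move=> c1; rewrite Ex_sqfrob; last exact: bounded_rv_fluctuation.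
(* Here t lists y and then s; the column x, the second vertex of the full path, is left out. *)
pose phi x t := square_edge_poly P xi (edge (head x t) x) (path_edges x (behead t)).
pose Q i x t := [&& size t == k.+1, uniq (head x t :: x :: behead t) &
  last x (behead t) == i].
pose c' x t := c (head x t :: x :: behead t).
have monoE i x t w : Q i x t -> mono xi (phi x t) w =
    (xi (edge (head x t) x) w ^+ 2 - v (edge (head x t) x)) *
    \prod_(e <- path_edges x (behead t)) xi e w.
  move=> /and3P[_ ux _]; rewrite mono_square_edge_poly//.
  exact: path_edges_uniq ux.
have entryE i x w : fluctuation_mx k c w i x = \sum_(t <- words V k.+1 | Q i x t)
    c' x t * mono xi (phi x t) w.
  rewrite mxE big_wordsS; apply: eq_bigr => y _.
  rewrite big_seq_cond [RHS]big_seq_cond; apply: eq_big => s.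
    case: (boolP (s \in _)) => //= /size_words sk.
    by rewrite /Q /= sk eqxx.
  by move=> /andP[/size_words sk Qs]; rewrite (monoE i)// /Q /= sk eqxx.
have entry_le i x : Ex P (fun w => fluctuation_mx k c w i x ^+ 2) <=
    (b ^+ k.+2) ^+ 2 *
    (\sum_(t <- words V k.+1 | Q i x t) k.+2 ^ k.+1)%:R.
  under eq_fun do rewrite entryE.
  apply: (@le_trans _ _ ((b ^+ k.+2) ^+ 2 * (\sum_(t <- words V k.+1 | Q i x t)
      \sum_(t' <- words V k.+1 | Q i x t' && all (mem (x :: t)) t') 1)%:R)).
    apply: (@Ex_sqr_sum_le _ _ _ _ _ _ _ xiP _ _ _ _ _ (fun t t' => all (mem (x :: t)) t')) => //.
    - exact: exprn_ge0.
    - by move=> t; exact: c1.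
    - move=> t w Qt; rewrite (monoE i)// normrM.
      have -> : b ^+ k.+2 = b ^+ 2 * b ^+ k by rewrite -exprD.
      have sizeE : size (path_edges x (behead t)) = k.
        case: t Qt => [/andP[]//|y s] /andP[/eqP[<-] _] /=.
        by elim: s x => //= z s IH x; rewrite IH.
      apply: ler_pM => //; last first.
        by rewrite -sizeE; exact: prod_noise_le xiP _ _.
      have := noise_sqr_le xiP (edge (head x t) x) w.
      have := entry_var_le xiP (edge (head x t) x).
      have := entry_var_ge0 P xi (edge (head x t) x).
      have := sqr_ge0 (xi (edge (head x t) x) w).
      by rewrite ler_norml => *; apply/andP; split; lra.
    - move=> t t' Qt Qt' tt'.
      apply: (Ex_mono_orth xiP (centered_square_edge_poly xiP _ _) (centered_square_edge_poly xiP _ _)).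
      case: t Qt tt' => [/andP[]//|y s] /and3P[_ us _].
      case: t' Qt' => [/andP[]//|y' s'] /and3P[_ us' _] /negP ss' ee; apply: ss'.
      apply/allP => z zs'.
      have := @path_edges_sub N y (x :: s) y' (x :: s') isT ee z.
      by move: zs'; rewrite !inE; case: (z == x) => //= h /(_ h).
  rewrite ler_wpM2l ?sqr_ge0// ler_nat.
  rewrite big_seq_cond [leqRHS]big_seq_cond.
  apply: leq_sum => t /andP[/size_words tk _].
  apply: (@leq_trans (\sum_(t' <- words V k.+1 | all (mem (x :: t)) t') 1)%N).
    by rewrite big_mkcond [leqRHS]big_mkcond leq_sum//= => t' _; case: (Q _ _ _).
  by rewrite -{2}tk; exact: count_words.
apply: le_trans (ler_sum _ (fun i _ => ler_sum _ (fun x _ => entry_le i x))) _.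
under eq_bigr do rewrite -mulr_sumr -natr_sum.
have -> : (b ^+ k.+2) ^+ 2 = (b ^+ 2) ^+ k.+2 by rewrite -!exprM mulnC.
rewrite -mulr_sumr -natr_sum (exprMn k.+2 (b ^+ 2)) -[leRHS]mulrA.
rewrite ler_wpM2l ?exprn_ge0 ?sqr_ge0// -natrX -natrM ler_nat.
rewrite exchange_big.
apply: (@leq_trans (\sum_(x < N) \sum_(t <- words V k.+1) k.+2 ^ k.+1)%N).
  apply: leq_sum => x _; under eq_bigr do rewrite big_mkcond.
  rewrite exchange_big; apply: leq_sum => t _.
  rewrite (bigD1 (last x (behead t)))//= big1 => [|i /negbTE it].
    by rewrite addn0; case: ifP.
  by rewrite /Q (eq_sym (last _ _)) it !andbF.
rewrite sum_nat_const card_ord big_const_seq count_predT iter_addn_0.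
by rewrite size_wordsE card_ord (expnS N k.+1) -mulnA leq_mul2l (mulnC (k.+2 ^ _)%N) leqnn orbT.
Qed.

(** Since C is at least 1, all lengths k up to m fit under the power m + 1 of C. The 4 comes from
    two summands, each doubled by [sqfrobD]. *)
Lemma Ex_sqfrob_error m k c : (k <= m)%N -> (forall t, `|c t| <= 1) ->
  forall C, 1 <= C -> b ^+ 2 * N%:R <= C ->
  Ex P (fun w => sqfrob (error_mx k c w)) <= 4 * (C ^+ m.+1 * (m.+1 ^ m.+2)%:R).
Proof.
move=> km c1 C C1 bC; have C0 : 0 <= C by exact: le_trans C1.
have bN0 : 0 <= b ^+ 2 * N%:R by rewrite mulr_ge0 ?sqr_ge0.
have bound j : (j <= m.+1)%N -> (b ^+ 2 * N%:R) ^+ j <= C ^+ m.+1.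
  move=> jm; apply: (@le_trans _ _ (C ^+ j)); first by rewrite lerXn2r ?nnegrE.
  by rewrite ler_weXn2l.
have bE : bounded_rv (fun w => sqfrob (closing_mx k c w)).
  by apply: bounded_rv_sqfrob; exact: bounded_rv_closing.
have bF : bounded_rv (fun w => sqfrob
    (if k is k'.+1 then fluctuation_mx k' c w else 0)).
  case: k {km bE} => [|k].
    by under eq_fun do rewrite sqfrob0; exact: bounded_rv_cst.
  by apply: bounded_rv_sqfrob; exact: bounded_rv_fluctuation.
have bA (f : T -> R) : bounded_rv f -> bounded_rv (fun w => 2 * f w).
  by move=> bf; apply: bounded_rvM => //; exact: bounded_rv_cst.
apply: (@le_trans _ _ (Ex P (fun w => 2 * sqfrob (closing_mx k c w) +
    2 * sqfrob (if k is k'.+1 then fluctuation_mx k' c w else 0)))).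
  apply: le_Ex; last by move=> w; exact: sqfrobD.
    by apply: bounded_rv_sqfrob; exact: bounded_rv_error.
  by apply: bounded_rvD; exact: bA.
rewrite ExD; [|exact: bA|exact: bA].
rewrite !ExZ//; set K := C ^+ _ * _.
have -> : 4 * K = 2 * K + 2 * K by ring.
apply: lerD; rewrite ler_wpM2l//.
  apply: le_trans (Ex_sqfrob_closing k c1) _; rewrite ler_pM ?exprn_ge0//.
    exact: bound.
  by rewrite ler_nat (leq_trans (n := k.+1 ^ m.+2)%N) ?leq_pexp2l ?leq_exp2r.
case: k km {bE bF} => [|k] km.
  under eq_fun do rewrite sqfrob0.
  by rewrite (Ex_cst P 0) mulr_ge0// exprn_ge0.
apply: le_trans (Ex_sqfrob_fluctuation k c1) _; rewrite ler_pM ?exprn_ge0//.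
  exact: bound.
rewrite ler_nat (leq_trans (n := k.+2 ^ m.+2)%N) ?leq_exp2r// leq_pexp2l//.
by rewrite ltnS; apply: leq_trans (leqnSn _); rewrite (leq_trans _ km).
Qed.

Lemma bounded_rv_states m i x : bounded_rv (fun w => states_mx m w i x).
Proof.
by apply: bounded_rv_sum_mx => kc {}i {}x; exact: bounded_rv_saw.
Qed.

Lemma bounded_rv_states_error m i x :
  bounded_rv (fun w => states_error m w i x).
Proof.
by apply: bounded_rv_sum_mx => kc {}i {}x; exact: bounded_rv_error.
Qed.

(** Cauchy-Schwarz over at most 2^m path sums, none of which enlarges D in expected squared norm. *)
Lemma Ex_sqfrob_states_mul m r (D : 'M[R]_(N, r)) :
  Ex P (fun w => sqfrob (states_mx m w *m D)) <= 4 ^+ m * sqfrob D.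
Proof.
under eq_fun do rewrite /states_mx mulmx_suml.
rewrite (_ : 4 ^+ m = (2 ^ m)%:R ^+ 2); last first.
  by rewrite -!natrX -expnM mulnC expnM.
apply: Ex_sqfrob_sum_le.
- by move=> kc; apply: bounded_rv_mulmx => i x; exact: bounded_rv_saw.
- exact: size_states.
- exact: sqfrob_ge0.
apply: List.Forall_impl (states_Forall m) => kc [_ c1].
exact: Ex_sqfrob_saw_mul.
Qed.

Lemma Ex_sqfrob_states_error m C : 1 <= C -> b ^+ 2 * N%:R <= C ->
  Ex P (fun w => sqfrob (states_error m w)) <=
  4 ^+ m * (4 * (C ^+ m.+1 * (m.+1 ^ m.+2)%:R)).
Proof.
move=> C1 bC; rewrite (_ : 4 ^+ m = (2 ^ m)%:R ^+ 2); last first.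
  by rewrite -!natrX -expnM mulnC expnM.
apply: Ex_sqfrob_sum_le.
- by move=> kc i x; exact: bounded_rv_error.
- exact: size_states.
- by rewrite !mulr_ge0// exprn_ge0// (le_trans _ C1).
apply: List.Forall_impl (states_Forall m) => kc [km c1].
exact: Ex_sqfrob_error.
Qed.

End PathMatrices.

(** * Counting singular values above the threshold *)

Section PowerExpansion.
Context {R : realFieldType}.
Variables (N n : nat) (A B Q : 'M[R]_N) (S E : nat -> 'M[R]_N).
Variables (J : nat -> 'M[R]_(N, n)) (l : 'rV[R]_n) (D : 'M[R]_n) (t : R).
Hypothesis S0 : S 0%N = 1%:M.
Hypothesis SA : forall j, S j *m A = S j.+1 + E j.
Hypothesis JE : forall j, J j = (A + B) *m J j.+1 *m diag_mx l.
Hypothesis J_le : forall j (X : 'M[R]_N), sqfrob (X *m J j) <= sqfrob X.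
Hypothesis DT : D^T = D.
Hypothesis DD : D *m D = D.
Hypothesis JJ : (J 0%N)^T *m J 0%N = D.
Hypothesis JT_le : forall X : 'M[R]_(N, n), sqfrob ((J 0%N)^T *m X) <= sqfrob X.
Hypothesis t_le1 : 0 <= t <= 1.
Hypothesis l_le : forall i, `|l 0 i| <= t.

Let lpow j : 'M[R]_n := diag_mx (\row_i l 0 i ^+ j).

Let lpowS j : diag_mx l *m lpow j = lpow j.+1.
Proof.
rewrite /lpow mul_diag_mx; apply/matrixP => i i'; rewrite !mxE exprS.
by rewrite mulrnAr.
Qed.

Let sqfrob_lpow m (X : 'M[R]_(m, n)) j :
  sqfrob (X *m lpow j) <= (t ^+ j) ^+ 2 * sqfrob X.
Proof.
have /andP[t0 t1] := t_le1.
by apply: sqfrob_mul_diag => i; rewrite mxE normrX lerXn2r ?nnegrE.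
Qed.

(** Each step replaces J m by (A + B) J (m + 1) times the scaling, and S m A by S (m + 1) + E m. The
    equation for J is the singular vector equation solved for the vectors, so every step gains a
    factor l. *)
Lemma power_expansion m :
  J 0%N = S m *m J m *m lpow m +
    \sum_(j < m) (E j + S j *m B) *m J j.+1 *m lpow j.+1.
Proof.
elim: m => [|m IH].
  rewrite big_ord0 addr0 S0 mul1mx /lpow (_ : \row__ _ = const_mx 1).
    by rewrite diag_const_mx mulmx1.
  by apply/rowP => i; rewrite !mxE.
have step : S m *m J m *m lpow m = S m.+1 *m J m.+1 *m lpow m.+1 +
    (E m + S m *m B) *m J m.+1 *m lpow m.+1.
  rewrite {1}JE -!mulmxA lpowS !mulmxA mulmxDr SA -!mulmxDl.
  by rewrite -addrA.
by rewrite big_ord_recr /= {1}IH step -addrA [in LHS](addrC _ (\sum_(_ < _) _)).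
Qed.

(* The columns of J 0 are orthonormal and invariant up to scaling; the part of
   the expansion that factors through Q has rank at most m * \rank Q, so the
   remaining part has to be large when there are many columns. *)
Lemma trace_expansion_le m :
  \tr D <= (m * \rank Q)%:R + 2 * (t ^+ m) ^+ 2 * sqfrob (S m) +
    4 * m%:R * \sum_(j < m) (sqfrob (E j) + sqfrob (S j *m (B - B *m Q))).
Proof.
have /andP[t0 t1] := t_le1.
pose G j := (E j + S j *m (B - B *m Q)) *m J j.+1 *m lpow j.+1.
pose F := S m *m J m *m lpow m + \sum_(j < m) G j.
pose Z := \sum_(j < m) S j *m B *m Q *m J j.+1 *m lpow j.+1.
have J0E : J 0%N = F + Z.
  rewrite (power_expansion m) -addrA; congr (_ + _).
  rewrite -big_split; apply: eq_bigr => j _ /=.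
  rewrite -!mulmxDl; congr (_ *m _ *m _).
  by rewrite mulmxBr !mulmxA -addrA subrK.
have rankZ : (\rank Z <= m * \rank Q)%N.
  rewrite /Z; elim: (m) => [|k IH]; first by rewrite big_ord0 mxrank0.
  rewrite big_ord_recr /= mulSnr; apply: leq_trans (mxrank_add _ _) _.
  rewrite leq_add//; do 2!apply: leq_trans (mxrankM_maxl _ _) _.
  exact: mxrankM_maxr.
(* In the sum the powers of l are merely bounded by 1; only the leading term keeps its gain t^m. *)
have G_le j : sqfrob (G j) <= 2 * (sqfrob (E j) + sqfrob (S j *m (B - B *m Q))).
  rewrite mulrDr; apply: le_trans (sqfrobD _ _).
  apply: le_trans (J_le j.+1 _); apply: le_trans (sqfrob_lpow _ _) _.
  rewrite -[leRHS]mul1r ler_wpM2r ?sqfrob_ge0// exprn_ile1 ?exprn_ge0//.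
  by rewrite exprn_ile1.
have F_le : sqfrob F <= 2 * (t ^+ m) ^+ 2 * sqfrob (S m) +
    4 * m%:R * \sum_(j < m) (sqfrob (E j) + sqfrob (S j *m (B - B *m Q))).
  apply: le_trans (sqfrobD _ _) _; apply: lerD.
    rewrite -mulrA ler_wpM2l//; apply: le_trans (sqfrob_lpow _ _) _.
    by rewrite ler_wpM2l// exprn_ge0// exprn_ge0.
  rewrite (_ : 4 * m%:R = 2 * (m%:R * 2)); last by ring.
  rewrite -!mulrA ler_wpM2l//; apply: le_trans (sqfrob_sum _ _) _.
  rewrite -[X in (size X)%:R]enumT size_enum_ord ler_wpM2l// mulr_sumr.
  by apply: ler_sum => j _; exact: G_le.
have ZR : (\rank Z)%:R <= (m * \rank Q)%:R :> R by rewrite ler_nat.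
have := partial_isometry_rank DT DD JJ J0E (JT_le F).
by move=> /le_trans; apply; rewrite -addrA lerD.
Qed.

End PowerExpansion.

(** * Error of singular value thresholding at a fixed outcome *)

Section Thresholding.
Context {R : realType}.

Lemma sum_col_mul n (U V : 'M[R]_n) (a : 'I_n -> R) :
  \sum_i a i *: (col i U *m (col i V)^T) = U *m diag_mx (\row_i a i) *m V^T.
Proof.
apply/matrixP => i j; rewrite summxE mxE; apply: eq_bigr => k _.
by rewrite mul_mx_diag !mxE big_ord1 !mxE mulrA [a k * _]mulrC.
Qed.

Lemma truncate_sqr_le (x m : R) : -1 <= m <= 1 ->
  (truncate x - m) ^+ 2 <= (x - m) ^+ 2.
Proof.
by move=> /andP[m1 m2]; rewrite /truncate minEle maxEle; case: ifP; case: ifP; nra.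
Qed.

Lemma truncate_le1 (x : R) : -1 <= truncate x <= 1.
Proof.
by rewrite /truncate minEle maxEle; case: ifP; case: ifP => *; apply/andP; split; lra.
Qed.

Variables (n : nat) (Y U V : 'M[R]_n) (s : 'I_n -> R).
Hypothesis svd : is_svd Y U s V.

Lemma svd_left : U *m U^T = 1%:M.
Proof. by case: svd => UU _ _ _; exact: mulmx1C. Qed.

Lemma svd_right : V *m V^T = 1%:M.
Proof. by case: svd => _ VV _ _; exact: mulmx1C. Qed.

Lemma svd_prod : Y = U *m diag_mx (\row_i s i) *m V^T.
Proof. by case: svd => _ _ _ ->; rewrite sum_col_mul. Qed.

Variable S : pred 'I_n.

Definition mask : 'M[R]_n := diag_mx (\row_i (S i)%:R).

Lemma mask_tr : mask^T = mask.
Proof. exact: tr_diag_mx. Qed.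

Lemma mask_idem : mask *m mask = mask.
Proof.
rewrite /mask mulmx_diag; congr diag_mx; apply/rowP => i; rewrite !mxE.
by case: (S i); rewrite ?mulr1 ?mulr0.
Qed.

Definition top_proj : 'M[R]_n := U *m mask *m U^T.

Lemma top_proj_tr : top_proj^T = top_proj.
Proof. by rewrite /top_proj !trmx_mul trmxK mask_tr mulmxA. Qed.

Lemma top_proj_idem : top_proj *m top_proj = top_proj.
Proof.
case: svd => UU _ _ _.
by rewrite /top_proj -!mulmxA (mulmxA U^T) UU mul1mx (mulmxA mask) mask_idem.
Qed.

Lemma sqfrob_top_proj : sqfrob top_proj = \tr mask.
Proof.
case: svd => UU _ _ _.
by rewrite sqfrob_mxtrace top_proj_tr top_proj_idem /top_proj mxtrace_mulC mulmxA UU mul1mx.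
Qed.

Lemma thresholded_svd :
  \sum_(i | S i) s i *: (col i U *m (col i V)^T) = top_proj *m Y.
Proof.
case: svd => UU _ _ _.
rewrite big_mkcond (eq_bigr (fun i => ((S i)%:R * s i) *: (col i U *m (col i V)^T))).
  rewrite sum_col_mul svd_prod /top_proj !mulmxA -(mulmxA _ U^T) UU mulmx1.
  rewrite -(mulmxA U mask) /mask mulmx_diag; congr (_ *m diag_mx _ *m _).
  by apply/rowP => i; rewrite !mxE.
by move=> i _; case: (S i); rewrite ?mul1r// mul0r scale0r.
Qed.

(** What the projection removes from Y has the singular values outside S, all at most t, between two
    orthogonal matrices. *)
Lemma sqfrob_bottom_le (t : R) (Q : 'M[R]_n) : 0 <= t ->
  (forall i, ~~ S i -> s i <= t) ->
  sqfrob ((1%:M - top_proj) *m Y *m Q) <= t ^+ 2 * sqfrob Q.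
Proof.
move=> t0 st; case: svd => UU VV s0 _.
have -> : (1%:M - top_proj) *m Y =
    U *m (diag_mx (\row_i ((~~ S i)%:R * s i)) *m V^T).
  rewrite mulmxBl mul1mx -thresholded_svd {1}svd_prod -sum_col_mul.
  rewrite [X in _ - X]big_mkcond -sumrB mulmxA -sum_col_mul.
  apply: eq_bigr => i _; case: (S i); rewrite ?subrr ?mul0r ?scale0r//.
  by rewrite subr0 mul1r.
rewrite -!mulmxA sqfrob_isometry_mul//.
rewrite -(sqfrob_isometry_mul Q (_ : (V^T)^T *m V^T = 1%:M)) ?trmxK ?svd_right//.
apply: sqfrob_diag_mul => i; rewrite mxE.
case: (boolP (S i)) => Si; rewrite ?mul0r ?normr0// mul1r ger0_norm//.
exact: st.
Qed.

Lemma sqfrob_threshold_error (p a t : R) (M E Q : 'M[R]_n) :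
  Y = p *: M + E -> 0 < a -> 0 <= t -> (forall i, ~~ S i -> s i <= t) ->
  sqfrob (top_proj *m Y - p *: M) <=
    3 / 2 * (a * \tr mask + a^-1 * sqfrob (E *m E^T)) +
    6 * (t ^+ 2 * sqfrob Q + sqfrob (E *m Q)) +
    3 * (p ^+ 2 * sqfrob (M - M *m Q)).
Proof.
move=> YE a0 t0 st; set H := top_proj.
have pM : p *: M = Y - E by rewrite YE addrK.
have -> : H *m Y - p *: M = H *m E - (1%:M - H) *m ((Y - E) *m Q) -
    (1%:M - H) *m (p *: (M - M *m Q)).
  have -> : p *: (M - M *m Q) = (Y - E) - (Y - E) *m Q.
    by rewrite scalerBr scalemxAl pM.
  rewrite pM -addrA -opprD -mulmxDr [(Y - E) *m Q + _]addrC subrK.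
  by rewrite mulmxBl mul1mx [in RHS]opprB addrA -mulmxDr [E + _]addrC subrK.
apply: le_trans (sqfrobD3 _ _ _) _; rewrite !sqfrobN; apply: lerD; first apply: lerD.
- have -> : sqfrob (H *m E) = \tr (H *m (E *m E^T)^T). exact: sqfrob_proj_mxtrace top_proj_tr top_proj_idem.
  have := mxtrace_mul_le H (E *m E^T) a0; rewrite sqfrob_top_proj; lra.
- have -> : 6 * (t ^+ 2 * sqfrob Q + sqfrob (E *m Q)) = 3 *
    (2 * (t ^+ 2 * sqfrob Q) + 2 * sqfrob (E *m Q)) by ring.
  rewrite ler_wpM2l// [(Y - E) *m Q]mulmxBl mulmxBr; apply: le_trans (sqfrobB _ _) _.
  rewrite lerD// ler_wpM2l//; first by rewrite mulmxA; exact: sqfrob_bottom_le.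
  rewrite mulmxBl mul1mx.
  exact: sqfrob_projC_le top_proj_tr top_proj_idem.
- rewrite ler_wpM2l// -sqfrobZ mulmxBl mul1mx.
  exact: sqfrob_projC_le top_proj_tr top_proj_idem.
Qed.

End Thresholding.

(** * The noise matrix of the model *)

Section MaskedVariables.
Context {d : measure_display} {T : measurableType d} {R : realType}.
Variable P : probability T R.
Variables (E : finType) (D : {set E}) (X O : E -> T -> R) (p : R).
Hypothesis bX : forall e, bounded_rv (X e).
Hypothesis bO : forall e, bounded_rv (O e).
Hypothesis O01 : forall e w, O e w = 0 \/ O e w = 1.
Hypothesis indep_XO : forall (s : seq E) (a : E -> {poly R}) (c : E -> R * R),
  uniq s -> {subset s <= D} ->
  Ex P (fun w => \prod_(e <- s) ((a e).[X e w] * ((c e).1 * O e w + (c e).2))) =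
  \prod_(e <- s) (Ex P (fun w => (a e).[X e w]) * ((c e).1 * p + (c e).2)).

Let bounded_factor (a : {poly R}) (c : R * R) e :
  bounded_rv (fun w => a.[X e w] * (c.1 * O e w + c.2)).
Proof.
apply: bounded_rvM; first exact: bounded_rv_horner.
apply: bounded_rvD; last exact: bounded_rv_cst.
by apply: bounded_rvM; first exact: bounded_rv_cst.
Qed.

Let bounded_masked e : bounded_rv (fun w => O e w * X e w).
Proof. exact: bounded_rvM. Qed.

(** O is 0 or 1, so a polynomial in O X is a combination of two products of a function of X and an
    affine function of O. This is why [indep_XO] only involves affine functions of O. *)
Let horner_masked (f : {poly R}) e w : f.[O e w * X e w] =
  f.[X e w] * (1 * O e w + 0) + (f.[0])%:P.[X e w] * (-1 * O e w + 1).
Proof.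
by rewrite hornerC; case: (O01 e w) => ->; rewrite ?mul0r ?mul1r; ring.
Qed.

Let Ex_const (c : R) e : Ex P (fun w => c%:P.[X e w]) = c.
Proof. by under eq_fun do rewrite hornerC; exact: (Ex_cst P c). Qed.

Lemma Ex_masked (f : {poly R}) e : e \in D ->
  Ex P (fun w => f.[O e w * X e w]) =
  Ex P (fun w => f.[X e w]) * p + f.[0] * (1 - p).
Proof.
move=> eD; under eq_fun do rewrite horner_masked.
rewrite (ExD P (bounded_factor f (1, 0) e) (bounded_factor (f.[0])%:P (-1, 1) e)).
have base (a : {poly R}) (c : R * R) :
    Ex P (fun w => a.[X e w] * (c.1 * O e w + c.2)) =
    Ex P (fun w => a.[X e w]) * (c.1 * p + c.2).
  have sub : {subset [:: e] <= D} by move=> e'; rewrite inE => /eqP->.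
  have := indep_XO (s := [:: e]) (fun=> a) (fun=> c) isT sub.
  rewrite big_cons big_nil mulr1 => <-.
  by congr Ex; apply/funext => w; rewrite big_cons big_nil mulr1.
rewrite (base f (1, 0)) (base (f.[0])%:P (-1, 1)) /=.
by rewrite Ex_const; ring.
Qed.

Lemma masked_indep (s : seq E) (f : E -> {poly R}) :
  uniq s -> {subset s <= D} ->
  Ex P (fun w => \prod_(e <- s) (f e).[O e w * X e w]) =
  \prod_(e <- s) Ex P (fun w => (f e).[O e w * X e w]).
Proof.
move=> us sD.
suff H s' (a : E -> {poly R}) (c : E -> R * R) :
    uniq (s ++ s') -> {subset s' <= D} ->
    Ex P (fun w => (\prod_(e <- s) (f e).[O e w * X e w]) *
      \prod_(e <- s') ((a e).[X e w] * ((c e).1 * O e w + (c e).2))) =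
    (\prod_(e <- s) Ex P (fun w => (f e).[O e w * X e w])) *
      \prod_(e <- s') (Ex P (fun w => (a e).[X e w]) * ((c e).1 * p + (c e).2)).
  have := H [::] (fun=> 0) (fun=> (0, 0)); rewrite cats0 big_nil mulr1 => <-//.
  by congr Ex; apply/funext => w; rewrite big_nil mulr1.
elim: s us sD s' a c => [|u s IH] us sD s' a c.
  move=> us' s'D; rewrite big_nil mul1r -indep_XO//; congr Ex.
  by apply/funext => w; rewrite big_nil mul1r.
rewrite cat_cons cons_uniq mem_cat negb_or => /andP[/andP[us0 us1] us'] s'D.
have sD1 : {subset s <= D} by move=> i si; apply: sD; rewrite inE si orbT.
have us2 : uniq s by move: us => /=/andP[].
have uD : u \in D by apply: sD; rewrite inE eqxx.
have us1' : uniq (s ++ u :: s').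
  by rewrite uniq_catC /= mem_cat negb_or us1 us0/= uniq_catC.
have us'D : {subset u :: s' <= D} by move=> i; rewrite inE => /orP[/eqP->//|/s'D].
pose upd (A : Type) (g : E -> A) (x : A) e := if e == u then x else g e.
have updu A (g : E -> A) x : upd A g x u = x by rewrite /upd eqxx.
have updn (A : Type) (g : E -> A) x i : i \in s' -> upd A g x i = g i.
  by move=> si; rewrite /upd; case: eqP => // iu; rewrite -iu si in us1.
pose rest w := (\prod_(e <- s) (f e).[O e w * X e w]) *
  \prod_(e <- s') ((a e).[X e w] * ((c e).1 * O e w + (c e).2)).
pose Erest := (\prod_(e <- s) Ex P (fun w => (f e).[O e w * X e w])) *
  \prod_(e <- s') (Ex P (fun w => (a e).[X e w]) * ((c e).1 * p + (c e).2)).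
have brest : bounded_rv rest.
  apply: bounded_rvM; apply: bounded_rv_prod => e //.
  exact: bounded_rv_horner.
(* The induction hypothesis with u moved to the list of split factors, for any polynomial in X and
   any affine function of O at u. *)
have key (g : {poly R}) (b : R * R) :
    Ex P (fun w => g.[X u w] * (b.1 * O u w + b.2) * rest w) =
    Ex P (fun w => g.[X u w]) * (b.1 * p + b.2) * Erest.
  have := IH us2 sD1 (u :: s') (upd _ a g) (upd _ c b) us1' us'D.
  have e1 : \prod_(e <- s') (Ex P (fun w => (upd _ a g e).[X e w]) *
        ((upd _ c b e).1 * p + (upd _ c b e).2)) =
      \prod_(e <- s') (Ex P (fun w => (a e).[X e w]) * ((c e).1 * p + (c e).2)).
    by rewrite big_seq [RHS]big_seq; apply: eq_bigr => i si; rewrite !updn.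
  have e2 w : \prod_(e <- s') ((upd _ a g e).[X e w] *
        ((upd _ c b e).1 * O e w + (upd _ c b e).2)) =
      \prod_(e <- s') ((a e).[X e w] * ((c e).1 * O e w + (c e).2)).
    by rewrite big_seq [RHS]big_seq; apply: eq_bigr => i si; rewrite !updn.
  rewrite big_cons !updu e1 mulrCA -/Erest => <-; congr Ex; apply/funext => w.
  by rewrite big_cons !updu e2 mulrCA.
rewrite big_cons -mulrA -/Erest.
transitivity (Ex P (fun w =>
   (f u).[X u w] * (((1, 0) : R * R).1 * O u w + ((1, 0) : R * R).2) * rest w +
   ((f u).[0])%:P.[X u w] *
     (((-1, 1) : R * R).1 * O u w + ((-1, 1) : R * R).2) * rest w)).
  congr Ex; apply/funext => w.
  by rewrite big_cons -mulrA -/(rest w) horner_masked mulrDl.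
rewrite ExD; [|by apply: bounded_rvM..].
rewrite !key Ex_masked//=.
by rewrite Ex_const; ring.
Qed.

End MaskedVariables.

Section ModelNoise.
Context {d : measure_display} {T : measurableType d} {R : realType}.
Variable P : probability T R.
Variables (mo : model) (n : nat) (p : R) (M : 'M[R]_n).
Variables (X : 'I_n -> 'I_n -> {RV P >-> R}) (O : 'I_n -> 'I_n -> {RV P >-> bool}).
Hypothesis hmodel : data_model mo p M X O.
Local Notation D := (free_entries mo n).

(** The entries are bounded by 1 only almost surely. Clipping makes this hold at every outcome and
    preserves independence and means. *)
Definition clipped (e : 'I_n * 'I_n) w : R := truncate (X e.1 e.2 w).
Definition observed (e : 'I_n * 'I_n) w : R := (O e.1 e.2 w)%:R.

Lemma measurable_truncate : measurable_fun [set: R] (@truncate R).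
Proof.
apply: measurable_minr; first exact: measurable_cst.
by apply: measurable_maxr; first exact: measurable_cst.
Qed.

Lemma clipped_le1 e w : `|clipped e w| <= 1.
Proof. by rewrite ler_norml; exact: truncate_le1. Qed.

Lemma bounded_clipped e : bounded_rv (clipped e).
Proof.
split; last by exists 1; exact: clipped_le1.
by apply: measurableT_comp => //; exact: measurable_truncate.
Qed.

Lemma observed01 e w : observed e w = 0 \/ observed e w = 1.
Proof. by rewrite /observed; case: (O _ _ _); [right|left]. Qed.

Lemma observedE e : observed e = \1_(O e.1 e.2 @^-1` [set true]).
Proof.
apply/funext => w; rewrite /observed indicE /=.
by case E: (O _ _ w); [rewrite mem_set|rewrite memNset//= E].
Qed.

Lemma measurable_observed e : measurable (O e.1 e.2 @^-1` [set true]).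
Proof. by rewrite -[X in measurable X]setTI; exact: measurable_funP. Qed.

Lemma bounded_observed e : bounded_rv (observed e).
Proof.
by rewrite observedE; apply: bounded_rv_indic; exact: measurable_observed.
Qed.

Lemma Ex_observed e : e \in D -> Ex P (observed e) = p.
Proof.
case: e => i j eD; apply: EFin_inj; rewrite observedE Ex_indic.
  exact: (data_observed hmodel).
exact: measurable_observed.
Qed.

Lemma Ex_clipped e : e \in D -> Ex P (clipped e) = M e.1 e.2.
Proof.
case: e => i j eD; apply: EFin_inj.
rewrite -(data_mean hmodel eD) Ex_expectation; last exact: bounded_clipped.
rewrite unlock; apply: ae_eq_integral => //.
- by apply/measurable_EFinP; case: (bounded_clipped (i, j)).
- by apply/measurable_EFinP; exact: measurable_funP.
- move: (data_bounded hmodel eD); apply: filterS => w X1 _ /=.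
  rewrite /clipped /truncate /=; move: X1; rewrite ler_norml => /andP[X1 X2].
  by rewrite max_r// min_r.
Qed.

Lemma clipped_observed_indep (s : seq ('I_n * 'I_n)) (a : 'I_n * 'I_n -> {poly R})
    (c : 'I_n * 'I_n -> R * R) : uniq s -> {subset s <= D} ->
  Ex P (fun w => \prod_(e <- s)
    ((a e).[clipped e w] * ((c e).1 * observed e w + (c e).2))) =
  \prod_(e <- s) (Ex P (fun w => (a e).[clipped e w]) * ((c e).1 * p + (c e).2)).
Proof.
move=> us sD.
pose f (u : ('I_n * 'I_n) + ('I_n * 'I_n)) w : R := match u with
  | inl e => (a e).[clipped e w] | inr e => (c e).1 * observed e w + (c e).2 end.
have bf u : bounded_rv (f u).
  case: u => e; first by apply: bounded_rv_horner; exact: bounded_clipped.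
  apply: bounded_rvD; last exact: bounded_rv_cst.
  by apply: bounded_rvM; [exact: bounded_rv_cst|exact: bounded_observed].
pose s2 := map inl s ++ map inr s : seq (('I_n * 'I_n) + ('I_n * 'I_n)).
have := indep_Ex_prod (f := f) (s := s2) (data_independent hmodel) _ bf _ _ _.
rewrite /s2 big_cat !big_map /= => H.
transitivity (\prod_(e <- s) Ex P (f (inl e)) * \prod_(e <- s) Ex P (f (inr e))).
  rewrite -H.
  - congr Ex; apply/funext => w; rewrite big_split /=.
    by rewrite big_cat !big_map.
  - move=> [e|e] A [B mB <-].
      exact: (measurable_funP (X e.1 e.2)).
    exact: (measurable_funP (O e.1 e.2)).
  - move=> [e|e] B _ mB.
      exists ((fun x => (a e).[truncate x]) @^-1` B); last by rewrite setTI.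
      have bt : bounded_rv (@truncate R).
        split; first exact: measurable_truncate.
        by exists 1 => x; rewrite ler_norml; exact: truncate_le1.
      have [mh _] := bounded_rv_horner (a e) bt.
      by rewrite -[X in measurable X]setTI; exact: mh.
    exists [set b : bool | B ((c e).1 * b%:R + (c e).2)] => //.
    by rewrite setTI.
  - rewrite cat_uniq !map_inj_uniq ?us ?andbT; last 2 first.
    + by move=> ? ? [].
    + by move=> ? ? [].
    by apply/hasPn => u /mapP[e _ ->]; apply/mapP => -[].
  - move=> u; rewrite mem_cat => /orP[] /mapP[e es ->]; rewrite inE; exact: sD.
rewrite -big_split; apply: eq_big_seq => e /sD eD /=; congr (_ * _).
rewrite /f (ExD P) ?ExZ//; last 3 first.
- exact: bounded_observed.
- by apply: bounded_rvM; [exact: bounded_rv_cst|exact: bounded_observed].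
- exact: bounded_rv_cst.
by rewrite Ex_observed// (Ex_cst P (c e).2).
Qed.

Lemma masked_entry_indep (s : seq ('I_n * 'I_n)) (f : 'I_n * 'I_n -> {poly R}) :
  uniq s -> {subset s <= D} ->
  Ex P (fun w => \prod_(e <- s) (f e).[observed e w * clipped e w]) =
  \prod_(e <- s) Ex P (fun w => (f e).[observed e w * clipped e w]).
Proof.
apply: (masked_indep bounded_clipped bounded_observed observed01).
exact: clipped_observed_indep.
Qed.

Lemma Ex_masked_entry (f : {poly R}) e : e \in D ->
  Ex P (fun w => f.[observed e w * clipped e w]) =
  Ex P (fun w => f.[clipped e w]) * p + f.[0] * (1 - p).
Proof.
apply: (Ex_masked bounded_clipped bounded_observed observed01).
exact: clipped_observed_indep.
Qed.

Definition noise w : 'M[R]_n :=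
  \matrix_(i, j) (observed (i, j) w * clipped (i, j) w - p * M i j).

Hypothesis M_le1 : forall i j, -1 <= M i j <= 1.
Hypothesis p01 : 0 <= p <= 1.

Lemma masked_le1 e w : `|observed e w * clipped e w| <= 1.
Proof.
by case: (observed01 e w) => ->; rewrite ?mul0r ?normr0// mul1r clipped_le1.
Qed.

Lemma noise_entry_le2 i j w : `|noise w i j| <= 2.
Proof.
have /andP[p0 p1] := p01.
rewrite mxE; apply: le_trans (ler_normB _ _) _; rewrite (_ : 2 = 1 + 1)// lerD//.
  exact: masked_le1.
by rewrite normrM ger0_norm// mulr_ile1// ler_norml.
Qed.

Lemma bounded_noise i j : bounded_rv (fun w => noise w i j).
Proof.
under eq_fun do rewrite mxE; apply: bounded_rvB; last exact: bounded_rv_cst.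
by apply: bounded_rvM; [exact: bounded_observed|exact: bounded_clipped].
Qed.

Lemma Ex_noise i j : (i, j) \in D -> Ex P (fun w => noise w i j) = 0.
Proof.
move=> ijD; under eq_fun do rewrite mxE.
rewrite ExB; [|apply: bounded_rvM|exact: bounded_rv_cst].
- rewrite (Ex_cst P (p * M i j)).
  have := Ex_masked_entry 'X ijD; rewrite hornerX mul0r addr0.
  under eq_fun do rewrite hornerX; move=> ->.
  under eq_fun do rewrite hornerX.
  by rewrite Ex_clipped// mulrC subrr.
- exact: bounded_observed.
- exact: bounded_clipped.
Qed.

(** At every outcome the square of the noise is at most O - 2 c times the noise, with c = p M i j,
    because O X is at most 1 in absolute value and vanishes with O. Taking means leaves p. *)
Lemma Ex_noise_sqr i j : (i, j) \in D -> Ex P (fun w => noise w i j ^+ 2) <= p.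
Proof.
move=> ijD; set c := p * M i j.
have bY : bounded_rv (fun w => observed (i, j) w * clipped (i, j) w).
  by apply: bounded_rvM; [exact: bounded_observed|exact: bounded_clipped].
have bO := bounded_observed (i, j).
have bc1 : bounded_rv (fun w => 2 * c * (noise w i j)).
  by apply: bounded_rvM; [exact: bounded_rv_cst|exact: bounded_noise].
apply: (@le_trans _ _ (Ex P (fun w => observed (i, j) w - 2 * c * noise w i j))).
  apply: le_Ex; first by apply: bounded_rvX; exact: bounded_noise.
    exact: bounded_rvB.
  move=> w; rewrite mxE -/c; have := clipped_le1 (i, j) w.
  rewrite ler_norml => /andP[h1 h2].
  by case: (observed01 (i, j) w) => ->; nra.
rewrite ExB// ExZ ?Ex_noise ?mulr0 ?subr0 ?Ex_observed//.
exact: bounded_noise.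
Qed.

Lemma noise_entry_indep (s : seq ('I_n * 'I_n)) (f : 'I_n * 'I_n -> {poly R}) c :
  uniq s -> {subset s <= D} ->
  Ex P (fun w => \prod_(e <- s) (f e).[c * noise w e.1 e.2]) =
  \prod_(e <- s) Ex P (fun w => (f e).[c * noise w e.1 e.2]).
Proof.
move=> us sD.
(* Centring and scaling are affine, so they are absorbed into the polynomial. *)
pose g e := f e \Po (c *: 'X - (c * (p * M e.1 e.2))%:P).
have gE e w : (f e).[c * noise w e.1 e.2] = (g e).[observed e w * clipped e w].
  rewrite horner_comp hornerD hornerN hornerZ hornerX hornerC mxE mulrBr.
  by rewrite -surjective_pairing.
under eq_fun do under eq_bigr do rewrite gE.
rewrite masked_entry_indep//; apply: eq_bigr => e _.
by congr Ex; apply/funext => w; rewrite gE.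
Qed.

(** The variance of a mean of independent indicators. In both models the diagonal alone supplies n
    free entries, which is enough for the bound 1 / n. *)
Lemma Ex_observed_proportion : (0 < n)%N ->
  Ex P (fun w => (observed_proportion R mo (fun i j => O i j w) - p) ^+ 2) <=
  n%:R^-1.
Proof.
move=> n0.
have nD : (n <= #|D|)%N.
  pose g (i : 'I_n) := (i, i).
  have gi : injective g by move=> i j [].
  rewrite -[X in (X <= _)%N]card_ord -(card_imset _ gi) subset_leq_card//.
  apply/fintype.subsetP => e /imsetP[i _ ->].
  by rewrite /free_entries; case: (mo); rewrite inE/=.
have D0 : (0 < #|D|%:R :> R) by rewrite ltr0n (leq_trans n0).
have propE w : observed_proportion R mo (fun i j => O i j w) - p =
    (#|D|%:R)^-1 * \sum_(e in D) (observed e w - p).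
  rewrite sumrB sumr_const mulrBr -[p *+ _]mulr_natr mulrCA mulVf ?gt_eqF// mulr1.
  rewrite /observed_proportion mulrC; congr (_ * _ - _).
  rewrite -sum1_card natr_sum big_mkcond [RHS]big_mkcond /=.
  apply: eq_bigr => e _; rewrite inE /observed.
  by case: (e \in D) => //=; case: (O _ _ _).
have bop e : bounded_rv (fun w => observed e w - p).
  by apply: bounded_rvB; [exact: bounded_observed|exact: bounded_rv_cst].
have Ex0 e : e \in D -> Ex P (fun w => observed e w - p) = 0.
  move=> eD; rewrite ExB ?Ex_observed ?(Ex_cst P p) ?subrr//.
    exact: bounded_observed.
  exact: bounded_rv_cst.
have cross e e' : e \in D -> e' \in D ->
    Ex P (fun w => (observed e w - p) * (observed e' w - p)) <= (e == e')%:R.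
  move=> eD e'D; case: eqVneq => [<-|ee'].
    rewrite (_ : true%:R = 1 :> R)//.
    apply: Ex_le_cst; first exact: bounded_rvM.
    by have /andP[? ?] := p01; move=> w; case: (observed01 e w) => ->; nra.
  (* The pair (1, - p) makes the affine factor O - p, of mean zero. *)
  have := @clipped_observed_indep [:: e; e'] (fun=> 1) (fun=> (1, - p)).
  rewrite /= !big_cons big_nil mulr1 inE ee' !mul1r subrr !mulr0 => H.
  rewrite (_ : Ex _ _ = 0)// -H//.
    congr Ex; apply/funext => w; rewrite !big_cons big_nil !hornerC.
    by rewrite !mul1r mulr1.
  by move=> x; rewrite !inE => /orP[]/eqP->.
under eq_fun do rewrite propE exprMn.
have bsum : bounded_rv (fun w => \sum_(e in D) (observed e w - p)).
  exact: bounded_rv_sum.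
rewrite ExZ; last exact: bounded_rvX.
have -> : (fun w => (\sum_(e in D) (observed e w - p)) ^+ 2) =
    (fun w => \sum_(e in D) \sum_(e' in D) (observed e w - p) * (observed e' w - p)).
  apply/funext => w; rewrite expr2 mulr_suml; apply: eq_bigr => e _.
  by rewrite mulr_sumr.
have bee e e' : bounded_rv (fun w => (observed e w - p) * (observed e' w - p)).
  exact: bounded_rvM.
rewrite Ex_sum; last by move=> e; exact: bounded_rv_sum.
apply: (@le_trans _ _ ((#|D|%:R^-1) ^+ 2 * #|D|%:R)).
  rewrite ler_wpM2l ?sqr_ge0// -sum1_card natr_sum; apply: ler_sum => e eD.
  rewrite Ex_sum//; apply: (@le_trans _ _ (\sum_(e' in D) (e == e')%:R)).
    by apply: ler_sum => e' e'D; exact: cross.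
  rewrite (bigD1 e)//= eqxx big1 ?addr0// => e' /andP[_ /negbTE ee'].
  by rewrite eq_sym ee'.
rewrite expr2 -mulrA mulVf ?gt_eqF// mulr1 lef_pV2 ?posrE ?ltr0n//.
  by rewrite ler_nat.
by rewrite (leq_trans n0).
Qed.

End ModelNoise.

(** * Approximation by averaging over cells *)

Section Cells.
Context {R : realType}.
Variables (k : nat) (K : set 'rV[R]_k) (f : 'rV[R]_k * 'rV[R]_k -> R).
Hypothesis cf : {within K `*` K, continuous f}.

Lemma within_near (u : 'rV[R]_k * 'rV[R]_k) (e : R) : (K `*` K) u -> 0 < e ->
  \forall v \near u, (K `*` K) v -> `|f u - f v| < e.
Proof.
move=> Ku e0.
have /subspace_continuousP/(_ u Ku)/cvgrPdist_lt/(_ e e0) := cf.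
by [].
Qed.

(** A tube argument: joint continuity gives product neighbourhoods of (z, x), and compactness of K
    makes the neighbourhood of x independent of z. Both argument positions are treated because f
    need not be symmetric. *)
Lemma near_slice (x : 'rV[R]_k) (e : R) : compact K -> K x -> 0 < e ->
  \forall y \near x, K y -> forall z, K z ->
    `|f (z, y) - f (z, x)| < e /\ `|f (y, z) - f (x, z)| < e.
Proof.
move=> /compact_near_coveringP cK Kx e0.
have e20 : 0 < e / 2 by rewrite divr_gt0.
pose Q y z := K y -> K z ->
    `|f (z, y) - f (z, x)| < e /\ `|f (y, z) - f (x, z)| < e.
have H : \forall y \near x, K `<=` Q y.
  apply: (cK _ (nbhs x) Q) => z0 Kz0.
  have zx : (K `*` K) (z0, x) by [].
  have xz : (K `*` K) (x, z0) by [].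
  have [[U V] /= [Uz Vx] UV] := within_near zx e20.
  have [[V' U'] /= [V'x U'z] UV'] := within_near xz e20.
  exists (U `&` U', V `&` V') => /=; first by split; exact: filterI.
  move=> [z y] /= [[Uz1 Uz1'] [Vy Vy']] Ky Kz.
  have Ux : V x by exact: nbhs_singleton.
  have Ux' : V' x by exact: nbhs_singleton.
  have h1 := UV (z, y) (conj Uz1 Vy) (conj Kz Ky).
  have h2 := UV (z, x) (conj Uz1 Ux) (conj Kz Kx).
  have h3 := UV' (y, z) (conj Vy' Uz1') (conj Ky Kz).
  have h4 := UV' (x, z) (conj Ux' Uz1') (conj Kx Kz).
  have split3 (a b c : R) : `|c - a| < e / 2 -> `|c - b| < e / 2 -> `|a - b| < e.
    move=> h h'; rewrite (_ : a - b = - (c - a) + (c - b)); last by ring.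
    by apply: le_lt_trans (ler_normD _ _) _; rewrite normrN; lra.
  by split; [exact: split3 h1 h2|exact: split3 h3 h4].
by apply: filterS H => y Hy Ky z Kz; exact: Hy.
Qed.

(** A finite subcover by the neighbourhoods of [near_slice]; a point belongs to the first member
    that contains it. Radius e / 2 around the centre gives e between two points of a cell. *)
Lemma exists_cells (e : R) : compact K -> 0 < e ->
  exists (N : nat) (cell : 'rV[R]_k -> 'I_N.+1), forall x y z,
    K x -> K y -> K z -> cell x = cell y ->
    `|f (z, x) - f (z, y)| <= e /\ `|f (x, z) - f (y, z)| <= e.
Proof.
move=> cK e0; have e20 : 0 < e / 2 by rewrite divr_gt0.
pose U x : set 'rV[R]_k := [set y | K y -> forall z, K z ->
    `|f (z, y) - f (z, x)| < e / 2 /\ `|f (y, z) - f (x, z)| < e / 2].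
have cK' : cover_compact K by rewrite -compact_cover.
have [||D DK KD] := cK' 'rV[R]_k K (fun x => interior (U x)).
- by move=> x _; exact: open_interior.
- move=> x Kx; exists x => //; exact: near_slice.
pose s := finmap.enum_fset D.
pose c y := find (fun x => `[< U x y >]) s.
(* [find] returns [size s] when no member contains the point, hence one more index than there are
   members. *)
exists (size s), (fun y => inord (c y)) => x y z Kx Ky Kz.
have cs w : K w -> (c w < size s)%N.
  move=> Kw; rewrite /c -has_find; apply/hasP.
  have [v Dv Uv] := KD _ Kw; exists v => //.
  by apply/asboolP; exact: interior_subset.
move=> /(congr1 val); rewrite /= !inordK ?ltnS; [|exact/ltnW/cs..].
move=> cxy.
have hU w : K w -> U (nth 0 s (c w)) w.
  move=> Kw; have := @nth_find _ 0 (fun x => `[< U x w >]) s.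
  by rewrite has_find => /(_ (cs _ Kw))/asboolP.
have [h1 h2] := hU _ Kx Kx z Kz; have [h3 h4] := hU _ Ky Ky z Kz.
rewrite -cxy in h3 h4.
have split3 (a b t : R) : `|a - t| < e / 2 -> `|b - t| < e / 2 -> `|a - b| <= e.
  move=> h h'; rewrite (_ : a - b = (a - t) + - (b - t)); last by ring.
  by apply: le_trans (ler_normD _ _) _; rewrite normrN; lra.
by split; [exact: split3 h1 h3|exact: split3 h2 h4].
Qed.

End Cells.

Section Averaging.
Context {R : realType}.
Variables (n N : nat) (cell : 'I_n -> 'I_N.+1).

Definition cell_size c : R := #|[set j | cell j == c]%SET|%:R.

(* Right multiplication by [avg_mx] averages the columns over each cell. *)
Definition avg_mx : 'M[R]_n :=
  \matrix_(i, j) ((cell i == cell j)%:R / cell_size (cell i)).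

Lemma cell_size_gt0 i : 0 < cell_size (cell i).
Proof. by rewrite ltr0n card_gt0; apply/set0Pn; exists i; rewrite inE. Qed.

Lemma sum_cell (a : R) i : \sum_j (cell i == cell j)%:R * a = cell_size (cell i) * a.
Proof.
rewrite -mulr_suml; congr (_ * _); rewrite -natr_sum; congr (_%:R).
rewrite -sum1_card [RHS]big_mkcond; apply: eq_bigr => j _.
by rewrite inE eq_sym; case: eqP.
Qed.

Lemma avg_mx_rank : (\rank avg_mx <= N.+1)%N.
Proof.
have -> : avg_mx = (\matrix_(i < n, c < N.+1) (cell i == c)%:R) *m
    (\matrix_(c < N.+1, j < n) ((c == cell j)%:R / cell_size c)).
  apply/matrixP => i j; rewrite !mxE (bigD1 (cell i))//= !mxE eqxx mul1r.
  rewrite big1 ?addr0// => c cc; rewrite !mxE eq_sym (negbTE cc) mul0r//.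
apply: leq_trans (mxrankM_maxl _ _) _; exact: rank_leq_col.
Qed.

(** A nonempty cell of size c consists of c columns of squared norm 1 / c, so it contributes exactly
    1. *)
Lemma sqfrob_avg_mx : sqfrob avg_mx <= N.+1%:R.
Proof.
have -> : sqfrob avg_mx = \sum_i (cell_size (cell i))^-1.
  apply: eq_bigr => i _.
  rewrite (eq_bigr (fun j => (cell i == cell j)%:R * (cell_size (cell i))^-1 ^+ 2)).
    by rewrite sum_cell expr2 mulrA divff ?mul1r// gt_eqF// cell_size_gt0.
  by move=> j _; rewrite mxE exprMn; case: eqP => _; rewrite ?expr1n ?expr0n.
rewrite (partition_big cell xpredT)//=.
rewrite -[X in _ <= X%:R]card_ord -sum1_card natr_sum; apply: ler_sum => c _.
rewrite (eq_bigr (fun=> (cell_size c)^-1)); last by move=> i /eqP->.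
rewrite sumr_const -[_ *+ _]mulr_natr.
have -> : #|[pred i | cell i == c]|%:R = cell_size c.
  by rewrite /cell_size; congr (_%:R); apply: eq_card => i; rewrite !inE.
have [->|c0] := eqVneq (cell_size c) 0; first by rewrite mulr0.
by rewrite mulVf.
Qed.

Lemma avg_mx_close (M : 'M[R]_n) (e : R) : 0 <= e ->
  (forall i j j', cell j = cell j' -> `|M i j - M i j'| <= e) ->
  sqfrob (M - M *m avg_mx) <= n%:R ^+ 2 * e ^+ 2.
Proof.
move=> e0 Me; rewrite (_ : n%:R ^+ 2 * e ^+ 2 = \sum_(i < n) \sum_(j < n) e ^+ 2).
  apply: ler_sum => i _; apply: ler_sum => j _.
  rewrite -(real_normK (num_real _)) lerXn2r ?nnegrE// !mxE.
  have s0 := cell_size_gt0 j.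
  have -> : M i j - \sum_l M i l * avg_mx l j =
      \sum_l (cell j == cell l)%:R * ((M i j - M i l) / cell_size (cell j)).
    rewrite [RHS](eq_bigr (fun l => (cell j == cell l)%:R * (M i j / cell_size (cell j)) -
        M i l * avg_mx l j)).
      by rewrite sumrB sum_cell mulrCA divff ?mulr1// gt_eqF.
    move=> l _; rewrite mxE (eq_sym (cell l)).
    by case: eqP => [->|_]; rewrite ?mul0r ?mulr0 ?subr0 ?mul1r ?mulrBl.
  apply: le_trans (ler_norm_sum _ _ _) _.
  apply: (@le_trans _ _ (\sum_l (cell j == cell l)%:R * (e / cell_size (cell j)))).
    apply: ler_sum => l _; case: eqP => [jl|_]; last by rewrite !mul0r normr0.
    have si0 : 0 <= (cell_size (cell j))^-1 by rewrite invr_ge0 ltW.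
    rewrite !mul1r normrM (ger0_norm si0).
    by apply: ler_wpM2r => //; exact: Me.
  by rewrite sum_cell mulrCA divff ?mulr1// gt_eqF.
by rewrite !sumr_const !card_ord -mulrnA -[RHS]mulr_natr natrM mulrC expr2.
Qed.

End Averaging.

(** * Expected statistics of the noise *)

Section NoiseStatistics.
Context {d : measure_display} {T : measurableType d} {R : realType}.
Variable P : probability T R.

Definition error_bound (C : R) m : R := 4 ^+ m * (4 * (C ^+ m.+1 * (m.+1 ^ m.+2)%:R)).

Lemma error_bound_ge0 C m : 0 <= C -> 0 <= error_bound C m.
Proof. by move=> C0; rewrite !mulr_ge0// exprn_ge0. Qed.

Variables (N : nat) (xi : 'I_N * 'I_N -> T -> R) (b C : R).
Hypothesis xiP : independent_noise P xi b.
Hypothesis row_le1 : forall x : 'I_N, \sum_y entry_var P xi (edge x y) <= 1.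
Hypothesis b_ge0 : 0 <= b.
Hypothesis C_ge1 : 1 <= C.
Hypothesis bC : b ^+ 2 * N%:R <= C.
Local Notation S := (states_mx P xi).
Local Notation E := (states_error P xi).
Local Notation A := (noise_mx xi).

Let bS m i x : bounded_rv (fun w => S m w i x) := bounded_rv_states xiP m i x.
Let bE m i x : bounded_rv (fun w => E m w i x) := bounded_rv_states_error xiP m i x.

Let C_ge0 : 0 <= C. Proof. exact: le_trans C_ge1. Qed.

Let Ex_E m : Ex P (fun w => sqfrob (E m w)) <= error_bound C m.
Proof. exact: (Ex_sqfrob_states_error xiP row_le1 b_ge0). Qed.

Let Ex_S m : Ex P (fun w => sqfrob (S m w)) <= 4 ^+ m * N%:R.
Proof.
have := Ex_sqfrob_states_mul xiP row_le1 m 1%:M; rewrite sqfrob1.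
by under eq_fun do rewrite mulmx1.
Qed.

Let AE w : A w = S 1%N w + E 0%N w.
Proof. by rewrite -states_mx_mul states_mx0 mul1mx. Qed.

Let bscale (c : R) (f : T -> R) : bounded_rv f -> bounded_rv (fun w => c * f w).
Proof. by move=> bf; apply: bounded_rvM => //; exact: bounded_rv_cst. Qed.

Lemma bounded_rv_noise_mx i j : bounded_rv (fun w => A w i j).
Proof. by under eq_fun do rewrite mxE; exact: noise_bounded xiP _. Qed.

Lemma bounded_rv_noise_mx_sqr i j : bounded_rv (fun w => (A w *m A w) i j).
Proof.
under eq_fun do rewrite mxE; apply: bounded_rv_sum => l.
by apply: bounded_rvM; exact: bounded_rv_noise_mx.
Qed.

(** With A = S 1 + E 0, the path part enlarges the squared norm of D by at most 4, and the error
    part is bounded crudely by submultiplicativity because its norm is already O(1). *)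
Lemma Ex_sqfrob_noise_mul r (D : 'M[R]_(N, r)) :
  Ex P (fun w => sqfrob (A w *m D)) <= (8 + 2 * error_bound C 0) * sqfrob D.
Proof.
have bSD : bounded_rv (fun w => sqfrob (S 1%N w *m D)).
  by apply: bounded_rv_sqfrob; exact: bounded_rv_mulmx.
have bED : bounded_rv (fun w => sqfrob (E 0%N w) * sqfrob D).
  by apply: bounded_rvM; [exact: bounded_rv_sqfrob|exact: bounded_rv_cst].
apply: (@le_trans _ _ (Ex P (fun w => 2 * sqfrob (S 1%N w *m D) +
    2 * (sqfrob (E 0%N w) * sqfrob D)))).
  apply: le_Ex.
  - by apply: bounded_rv_sqfrob; apply: bounded_rv_mulmx; exact: bounded_rv_noise_mx.
  - by apply: bounded_rvD; exact: bscale.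
  - move=> w; rewrite AE mulmxDl; apply: le_trans (sqfrobD _ _) _.
    by rewrite lerD// ler_wpM2l// sqfrob_mul_le.
rewrite (ExD P (bscale 2 bSD) (bscale 2 bED)) !ExZ//.
have -> : Ex P (fun w => sqfrob (E 0%N w) * sqfrob D) =
    sqfrob D * Ex P (fun w => sqfrob (E 0%N w)).
  rewrite -ExZ; last exact: bounded_rv_sqfrob.
  by congr Ex; apply/funext => w; rewrite mulrC.
have D0 := sqfrob_ge0 D.
have := Ex_sqfrob_states_mul xiP row_le1 1 D; rewrite expr1.
by have := Ex_E 0; nra.
Qed.

(** The expansion A^2 = S 2 + E 1 + E 0 A. Only the last term uses the deterministic bound C N on
    the squared norm of A; the result is of order N, where submultiplicativity alone would give
    N^2. *)
Lemma Ex_sqfrob_noise_sqr : Ex P (fun w => sqfrob (A w *m A w)) <=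
  3 * (16 * N%:R + error_bound C 1 + C * N%:R * error_bound C 0).
Proof.
have bS2 : bounded_rv (fun w => sqfrob (S 2%N w)) by exact: bounded_rv_sqfrob.
have bE1 : bounded_rv (fun w => sqfrob (E 1%N w)) by exact: bounded_rv_sqfrob.
have bE0 : bounded_rv (fun w => sqfrob (E 0%N w)) by exact: bounded_rv_sqfrob.
have A_le w : sqfrob (A w) <= C * N%:R.
  apply: (@le_trans _ _ (b ^+ 2 * N%:R * N%:R)); last by rewrite ler_wpM2r.
  rewrite (_ : _ * _ * _ = \sum_(i < N) \sum_(j < N) b ^+ 2).
    apply: ler_sum => i _; apply: ler_sum => j _.
    by rewrite mxE; exact: noise_sqr_le xiP _ _.
  by rewrite !sumr_const !card_ord -mulrnA -[RHS]mulr_natr natrM mulrA.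
apply: (@le_trans _ _ (Ex P (fun w => 3 * sqfrob (S 2%N w) + 3 * sqfrob (E 1%N w) +
    3 * (C * N%:R) * sqfrob (E 0%N w)))).
  apply: le_Ex.
  - by apply: bounded_rv_sqfrob; exact: bounded_rv_noise_mx_sqr.
  - by apply: bounded_rvD; [apply: bounded_rvD|]; exact: bscale.
  - move=> w; rewrite {1}AE mulmxDl states_mx_mul.
    apply: le_trans (sqfrobD3 _ _ _) _; rewrite lerD// -mulrA ler_wpM2l//.
    apply: le_trans (sqfrob_mul_le _ _) _; rewrite mulrC ler_wpM2r ?sqfrob_ge0//.
rewrite !ExD; [|exact: bscale..| |exact: bscale]; last first.
  by apply: bounded_rvD; exact: bscale.
rewrite !ExZ// !mulrDr !lerD//.
- by rewrite ler_wpM2l//; have := Ex_S 2; rewrite -natrX.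
- by rewrite ler_wpM2l.
- by rewrite -mulrA ler_wpM2l// ler_wpM2l// mulr_ge0.
Qed.

(** The right-hand side of [trace_expansion_le]. No singular vector occurs in it, so its expectation
    is accessible. *)
Definition rank_statistic (B Q : 'M[R]_N) (t : R) (m : nat) (w : T) : R :=
  (m * \rank Q)%:R + 2 * (t ^+ m) ^+ 2 * sqfrob (S m w) +
    4 * m%:R * \sum_(j < m) (sqfrob (E j w) + sqfrob (S j w *m (B - B *m Q))).

Lemma bounded_rank_statistic B Q t m : bounded_rv (rank_statistic B Q t m).
Proof.
apply: bounded_rvD; first apply: bounded_rvD.
- exact: bounded_rv_cst.
- by apply: bscale; exact: bounded_rv_sqfrob.
- apply: bscale; apply: bounded_rv_sum => j; apply: bounded_rvD.
    exact: bounded_rv_sqfrob.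
  by apply: bounded_rv_sqfrob; exact: bounded_rv_mulmx.
Qed.

Lemma Ex_rank_statistic B Q t m : Ex P (rank_statistic B Q t m) <=
  (m * \rank Q)%:R + 2 * (4 * t ^+ 2) ^+ m * N%:R +
  4 * m%:R * \sum_(j < m) (error_bound C j + 4 ^+ j * sqfrob (B - B *m Q)).
Proof.
have bSm : bounded_rv (fun w => sqfrob (S m w)) by exact: bounded_rv_sqfrob.
have bEj j : bounded_rv (fun w => sqfrob (E j w)) by exact: bounded_rv_sqfrob.
have bSj j : bounded_rv (fun w => sqfrob (S j w *m (B - B *m Q))).
  by apply: bounded_rv_sqfrob; exact: bounded_rv_mulmx.
have bj j : bounded_rv (fun w => sqfrob (E j w) + sqfrob (S j w *m (B - B *m Q))).
  exact: bounded_rvD.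
have bsum : bounded_rv (fun w => \sum_(j < m)
    (sqfrob (E j w) + sqfrob (S j w *m (B - B *m Q)))) by exact: bounded_rv_sum.
have bc := bounded_rv_cst (d := d) (T := T) ((m * \rank Q)%:R : R).
rewrite /rank_statistic (ExD P (bounded_rvD bc (bscale _ bSm)) (bscale _ bsum)).
rewrite (ExD P bc (bscale _ bSm)) (Ex_cst P (m * \rank Q)%:R) !ExZ//.
rewrite lerD// ?lerD//.
  rewrite -[leLHS]mulrA -[leRHS]mulrA ler_wpM2l// (exprMn m 4).
  have -> : (4 : R) ^+ m * (t ^+ 2) ^+ m * N%:R = (t ^+ m) ^+ 2 * (4 ^+ m * N%:R).
    by rewrite -!exprM (mulnC 2%N); ring.
  by rewrite ler_wpM2l// sqr_ge0.
rewrite ler_wpM2l ?mulr_ge0// Ex_sum//; apply: ler_sum => j _.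
by rewrite ExD// lerD// (Ex_sqfrob_states_mul xiP).
Qed.

End NoiseStatistics.

(** * Statistics free of singular vectors, obtained from a symmetric lift *)

Section ControlledNoise.
Context {d : measure_display} {T : measurableType d} {R : realType}.
Variable P : probability T R.

(* The three statistics bound, at every outcome, the number of singular values
   of p M + E above the threshold and the two quadratic forms in E that enter
   the loss; their expectations do not see the singular vectors. *)
Definition controlled_noise (n : nat) (p th : R) (k : nat) (C dl : R)
    (M Q : 'M[R]_n) (E : T -> 'M[R]_n) : Prop :=
  exists r t1 t2 : T -> R,
  [/\ bounded_rv r, bounded_rv t1 & bounded_rv t2] /\
  [/\ forall w (U V : 'M[R]_n) s (S : pred 'I_n), is_svd (p *: M + E w) U s V ->
        (forall i, S i -> th * Num.sqrt (n%:R * p) <= s i) ->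
        \tr (mask S : 'M[R]_n) <= r w,
      forall w, sqfrob (E w *m (E w)^T) <= t1 w &
      forall w, sqfrob (E w *m Q) <= t2 w] /\
  [/\ Ex P r <= (k * (2 * \rank Q))%:R + 2 * (4 * (th^-1) ^+ 2) ^+ k * (2 * n%:R) +
        4 * k%:R * \sum_(j < k) (error_bound C j + 4 ^+ j * (2 * p * dl / n%:R)),
      Ex P t1 <= (n%:R * p) ^+ 2 * (3 * (16 * (2 * n%:R) + error_bound C 1 +
        C * (2 * n%:R) * error_bound C 0)) &
      Ex P t2 <= (n%:R * p) * ((8 + 2 * error_bound C 0) * (2 * sqfrob Q))].

Section Lift.
Variables (n N : nat) (p th C dl b : R) (k : nat) (M Q : 'M[R]_n).
Variables (E : T -> 'M[R]_n) (xi : 'I_N * 'I_N -> T -> R).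
Variables (B QN : 'M[R]_N) (J0 J1 : 'M[R]_n -> 'M[R]_n -> pred 'I_n -> 'M[R]_(N, n)).
Hypothesis n_gt0 : (0 < n)%N.
Hypothesis p_gt0 : 0 < p.
Hypothesis th_gt1 : 1 <= th.
Hypothesis xiP : independent_noise P xi b.
Hypothesis row_le1 : forall x : 'I_N, \sum_y entry_var P xi (edge x y) <= 1.
Hypothesis b_ge0 : 0 <= b.
Hypothesis C_ge1 : 1 <= C.
Hypothesis bC : b ^+ 2 * N%:R <= C.
Hypothesis Nn : (N <= 2 * n)%N.
Hypothesis rankQ : (\rank QN <= 2 * \rank Q)%N.
Hypothesis sqfrobQ : sqfrob QN <= 2 * sqfrob Q.
Hypothesis sqfrobB : sqfrob (B - B *m QN) <= 2 * p * dl / n%:R.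
Local Notation sg := (Num.sqrt (n%:R * p)).
Local Notation A := (noise_mx xi).
Hypothesis EE_le : forall w,
  sqfrob (E w *m (E w)^T) <= (n%:R * p) ^+ 2 * sqfrob (A w *m A w).
Hypothesis EQ_le : forall w,
  sqfrob (E w *m Q) <= (n%:R * p) * sqfrob (A w *m QN).
Hypothesis J0_le : forall U V S (X : 'M[R]_N), U *m U^T = 1%:M ->
  V *m V^T = 1%:M -> sqfrob (X *m J0 U V S) <= sqfrob X.
Hypothesis J1_le : forall U V S (X : 'M[R]_N), U *m U^T = 1%:M ->
  V *m V^T = 1%:M -> sqfrob (X *m J1 U V S) <= sqfrob X.
Hypothesis J0T_le : forall U V S (X : 'M[R]_(N, n)), U *m U^T = 1%:M ->
  V *m V^T = 1%:M -> sqfrob ((J0 U V S)^T *m X) <= sqfrob X.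
Hypothesis J00 : forall U V S, U^T *m U = 1%:M -> V^T *m V = 1%:M ->
  (J0 U V S)^T *m J0 U V S = mask S.
Hypothesis J01 : forall w U s V S, is_svd (p *: M + E w) U s V ->
  (A w + B) *m J1 U V S = J0 U V S *m diag_mx (\row_i (s i / sg)).
Hypothesis J10 : forall w U s V S, is_svd (p *: M + E w) U s V ->
  (A w + B) *m J0 U V S = J1 U V S *m diag_mx (\row_i (s i / sg)).
Hypothesis J0_mask : forall U V S, J0 U V S *m mask S = J0 U V S.
Hypothesis J1_mask : forall U V S, J1 U V S *m mask S = J1 U V S.

Let sg_gt0 : 0 < sg.
Proof. by rewrite sqrtr_gt0 mulr_gt0// ltr0n. Qed.

Let th_gt0 : 0 < th.
Proof. by apply: lt_le_trans th_gt1. Qed.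

(** Common to both models. [J0] and [J1] carry the kept left and right singular vectors; A + B
    exchanges them up to the scaled singular values, so they alternate in the power expansion. *)
Lemma lifted_noise_controlled : controlled_noise p th k C dl M Q E.
Proof.
have C0 : 0 <= C by exact: le_trans C_ge1.
have np0 : 0 < n%:R * p by rewrite mulr_gt0// ltr0n.
have Nn' : N%:R <= 2 * n%:R :> R by rewrite -natrM ler_nat.
have bA := bounded_rv_noise_mx xiP.
have bsA : bounded_rv (fun w => sqfrob (A w *m A w)).
  by apply: bounded_rv_sqfrob; exact: bounded_rv_noise_mx_sqr xiP.
have bsQ : bounded_rv (fun w => sqfrob (A w *m QN)).
  by apply: bounded_rv_sqfrob; exact: bounded_rv_mulmx.
exists (rank_statistic P xi B QN th^-1 k),
  (fun w => (n%:R * p) ^+ 2 * sqfrob (A w *m A w)),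
  (fun w => (n%:R * p) * sqfrob (A w *m QN)); split; first split.
- exact: bounded_rank_statistic xiP _ _ _ _.
- by apply: bounded_rvM => //; exact: bounded_rv_cst.
- by apply: bounded_rvM => //; exact: bounded_rv_cst.
split; last split.
- split=> // w U V s S svd Ss.
  have [UU VV s0 _] := svd.
  have UU' := svd_left svd; have VV' := svd_right svd.
  (* Inverse scaled singular values, at most 1 / th on S by the threshold. The value 0 off S avoids
     singular values that may vanish. *)
  pose l : 'rV[R]_n := \row_i (if S i then sg / s i else 0).
  pose J j := if odd j then J1 U V S else J0 U V S.
  have s_gt0 i : S i -> 0 < s i.
    by move=> Si; apply: lt_le_trans (Ss i Si); rewrite mulr_gt0.
  have maskE : diag_mx (\row_i (s i / sg)) *m diag_mx l = mask S.
    rewrite mulmx_diag; congr diag_mx; apply/rowP => i; rewrite !mxE.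
    case: ifPn => Si; last by rewrite mulr0.
    by rewrite mulrA divfK ?divff// gt_eqF// s_gt0.
  apply: (@trace_expansion_le _ _ _ (A w) B QN (fun m => states_mx P xi m w)
    (fun m => states_error P xi m w) J l).
  + exact: states_mx0.
  + by move=> j; exact: states_mx_mul.
  + move=> j; rewrite /J /=; case: (odd j) => /=.
      by rewrite (J10 _ svd) -mulmxA maskE J1_mask.
    by rewrite (J01 _ svd) -mulmxA maskE J0_mask.
  + by move=> j X; rewrite /J; case: (odd j); [exact: J1_le|exact: J0_le].
  + exact: mask_tr.
  + exact: mask_idem.
  + exact: J00.
  + by move=> X; exact: J0T_le.
  + by rewrite invr_ge0 ltW//= invf_le1.
  + move=> i; rewrite mxE; case: ifPn => Si; last by rewrite normr0 invr_ge0 ltW.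
    rewrite ger0_norm; last by rewrite divr_ge0// ltW// s_gt0.
    rewrite ler_pdivrMr ?s_gt0//.
    by rewrite -ler_pdivrMl ?invr_gt0// invrK Ss.
- apply: le_trans (Ex_rank_statistic xiP row_le1 b_ge0 C_ge1 bC B QN th^-1 k) _.
  apply: lerD; first apply: lerD.
  + by rewrite ler_nat leq_mul2l rankQ orbT.
  + by rewrite ler_wpM2l// mulr_ge0// exprn_ge0// mulr_ge0// sqr_ge0.
  + rewrite ler_wpM2l ?mulr_ge0//; apply: ler_sum => j _.
    by rewrite lerD2l ler_wpM2l// exprn_ge0.
- rewrite (ExZ P ((n%:R * p) ^+ 2) bsA); apply: ler_wpM2l; first exact: sqr_ge0.
  apply: le_trans (Ex_sqfrob_noise_sqr xiP row_le1 b_ge0 C_ge1 bC) _.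
  rewrite ler_wpM2l// !lerD// ?ler_wpM2l//.
  by rewrite ler_wpM2r ?error_bound_ge0// ler_wpM2l.
- rewrite (ExZ P (n%:R * p) bsQ); apply: ler_wpM2l; first exact: ltW.
  apply: le_trans (Ex_sqfrob_noise_mul xiP row_le1 b_ge0 C_ge1 bC _) _.
  by rewrite ler_wpM2l// addr_ge0// mulr_ge0// error_bound_ge0.
Qed.

End Lift.

(** The noise matrix has more index pairs than the model has free entries; a pair that decodes to no
    entry gets zero noise. Since [enc] recovers the pair, decoded entries are distinct and the
    independence of the free entries applies. *)
Lemma independent_noise_decode (E0 E1 : finType) (D : {set E0}) (Z : E0 -> T -> R)
    (dec : E1 -> option E0) (enc : E0 -> E1) (b : R) : 0 <= b ->
  (forall e u, dec e = Some u -> enc u = e /\ u \in D) ->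
  (forall u, bounded_rv (Z u)) ->
  (forall u w, `|Z u w| <= b) ->
  (forall u, u \in D -> Ex P (Z u) = 0) ->
  (forall (s : seq E0) (f : E0 -> {poly R}), uniq s -> {subset s <= D} ->
    Ex P (fun w => \prod_(u <- s) (f u).[Z u w]) =
    \prod_(u <- s) Ex P (fun w => (f u).[Z u w])) ->
  independent_noise P (fun e w => if dec e is Some u then Z u w else 0) b.
Proof.
move=> b0 decP bZ Zb Z0 indZ; split.
- by move=> e; case: (dec e) => [u|]; [exact: bZ|exact: bounded_rv_cst].
- by move=> e w; case: (dec e) => [u|]; [exact: Zb|rewrite normr0].
- move=> e; case E: (dec e) => [u|]; last exact: (Ex_cst P 0).
  by have [_ /Z0] := decP _ _ E.
move=> phi; pose s := pmap dec (enum E1).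
have us : uniq s.
  apply: (@pmap_uniq _ _ dec enc) => [e|]; last exact: enum_uniq.
  by rewrite /ocancel; case E: (dec e) => [u|] //=; case: (decP _ _ E).
have sD : {subset s <= D}.
  by move=> u; rewrite mem_pmap => /mapP[e _ E]; case: (decP e u).
(* Collects the constant factors of the pairs without noise, where the polynomial is evaluated at
   0. *)
pose c e := if dec e is Some _ then 1 else (phi e).[0].
have prodE (F : E0 -> R) : \prod_e (c e * oapp F 1 (dec e)) =
    (\prod_e c e) * \prod_(u <- s) F u.
  by rewrite big_split /s big_pmap big_enum.
transitivity (Ex P (fun w => (\prod_e c e) * \prod_(u <- s) (phi (enc u)).[Z u w])).
  congr Ex; apply/funext => w; rewrite -prodE; apply: eq_bigr => e _.
  rewrite /c; case E: (dec e) => [u|] /=; last by rewrite mulr1.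
  by rewrite mul1r; have [->] := decP _ _ E.
rewrite ExZ; last by apply: bounded_rv_prod => u; exact: bounded_rv_horner.
rewrite indZ// -prodE; apply: eq_bigr => e _.
rewrite /c; case E: (dec e) => [u|] /=; last by rewrite mulr1 (Ex_cst P (phi e).[0]).
by rewrite mul1r; have [->] := decP _ _ E.
Qed.

End ControlledNoise.

(** * The symmetric and the asymmetric model as symmetric noise *)

Section ModelControlled.
Context {d : measure_display} {T : measurableType d} {R : realType}.
Variable P : probability T R.
Variables (mo : model) (n : nat) (p : R) (M Q : 'M[R]_n).
Variables (X : 'I_n -> 'I_n -> {RV P >-> R}) (O : 'I_n -> 'I_n -> {RV P >-> bool}).
Hypothesis hmodel : data_model mo p M X O.
Hypothesis M_le1 : forall i j, -1 <= M i j <= 1.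
Hypothesis p_gt0 : 0 < p.
Hypothesis p_le1 : p <= 1.
Hypothesis n_gt0 : (0 < n)%N.
Variables (th C dl : R) (k : nat).
Hypothesis th_gt1 : 1 <= th.
Hypothesis C_ge1 : 1 <= C.
Hypothesis C_ge : 8 / p <= C.
Hypothesis MQ : sqfrob (M - M *m Q) <= dl.
Hypothesis MTQ : sqfrob (M^T - M^T *m Q) <= dl.
Local Notation sg := (Num.sqrt (n%:R * p)).
Local Notation E := (noise p M X O).

Let np_gt0 : 0 < n%:R * p. Proof. by rewrite mulr_gt0// ltr0n. Qed.
Let sg_gt0 : 0 < sg. Proof. by rewrite sqrtr_gt0. Qed.
Let sg2 : sg ^+ 2 = n%:R * p. Proof. by rewrite sqr_sqrtr// ltW. Qed.
Let p01 : 0 <= p <= 1. Proof. by rewrite ltW. Qed.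
Let dl_ge0 : 0 <= dl. Proof. exact: le_trans (sqfrob_ge0 _) MQ. Qed.

Let Z (u : 'I_n * 'I_n) w : R := sg^-1 * E w u.1 u.2.

Let bE i j : bounded_rv (fun w => E w i j). Proof. exact: bounded_noise. Qed.

Let bZ u : bounded_rv (Z u).
Proof. by apply: bounded_rvM => //; exact: bounded_rv_cst. Qed.

Let Z_le u w : `|Z u w| <= 2 / sg.
Proof.
rewrite normrM ger0_norm ?invr_ge0 ?(ltW sg_gt0)// mulrC.
rewrite ler_wpM2r ?invr_ge0 ?(ltW sg_gt0)//.
exact: noise_entry_le2.
Qed.

Let Z_mean u : u \in free_entries mo n -> Ex P (Z u) = 0.
Proof. by case: u => i j uD; rewrite ExZ// (Ex_noise hmodel)// mulr0. Qed.

Let Z_indep (s : seq ('I_n * 'I_n)) (f : 'I_n * 'I_n -> {poly R}) :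
  uniq s -> {subset s <= free_entries mo n} ->
  Ex P (fun w => \prod_(u <- s) (f u).[Z u w]) =
  \prod_(u <- s) Ex P (fun w => (f u).[Z u w]).
Proof. exact: (noise_entry_indep hmodel). Qed.

(** The reason for dividing by the square root of n p: variances become at most 1 / n, and row sums
    at most 1. *)
Let Z_var u : u \in free_entries mo n -> Ex P (fun w => Z u w ^+ 2) <= n%:R^-1.
Proof.
case: u => i j uD; under eq_fun do rewrite exprMn.
rewrite ExZ; last exact: bounded_rvX.
rewrite exprVn sg2 invfM -mulrA -[leRHS]mulr1 ler_wpM2l ?invr_ge0//.
by rewrite mulrC ler_pdivrMr// mul1r (Ex_noise_sqr hmodel).
Qed.

Let b_ge0 : 0 <= 2 / sg. Proof. by rewrite divr_ge0// ltW. Qed.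

(** The origin of 8 / p: an entry is at most 2 / sg, so its square is at most 4 / (n p), multiplied
    by at most 2n vertices. *)
Let bC (N : nat) : (N <= 2 * n)%N -> (2 / sg) ^+ 2 * N%:R <= C.
Proof.
move=> Nn; apply: le_trans C_ge; rewrite exprMn exprVn sg2.
have n0 : 0 < n%:R :> R by rewrite ltr0n.
have -> : 8 / p = 2 ^+ 2 / (n%:R * p) * (2 * n%:R).
  by field; rewrite ?gt_eqF.
rewrite ler_wpM2l//; first by rewrite mulr_ge0// invr_ge0 ltW.
by rewrite -natrM ler_nat.
Qed.

Let scaled_svd w U s V : is_svd (p *: M + E w) U s V ->
  sg^-1 *: (p *: M + E w) = U *m diag_mx (\row_i (s i / sg)) *m V^T.
Proof.
move=> svd; rewrite (svd_prod svd) scalemxAl scalemxAr.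
congr (_ *m _ *m _); apply/matrixP => i j; rewrite !mxE.
by rewrite mulrnAr mulrC.
Qed.

Let p_sg : (p / sg) ^+ 2 * dl = p * dl / n%:R.
Proof.
have n0 : 0 < n%:R :> R by rewrite ltr0n.
by rewrite exprMn exprVn sg2; field; rewrite ?gt_eqF.
Qed.

Let mul_mask_diag m (U : 'M[R]_(m, n)) (S : pred 'I_n) (a : 'rV[R]_n) :
  U *m diag_mx a *m mask S = U *m mask S *m diag_mx a.
Proof. by rewrite -!mulmxA /mask !mulmx_diag; congr (_ *m diag_mx _); apply/rowP => i; rewrite !mxE mulrC. Qed.

Let mask_le m (S : pred 'I_n) (A : 'M[R]_(m, n)) : sqfrob (A *m mask S) <= sqfrob A.
Proof.
have -> : sqfrob A = 1 ^+ 2 * sqfrob A by rewrite expr1n mul1r.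
apply: sqfrob_mul_diag => i; by rewrite mxE; case: (S i); rewrite ?normr1 ?normr0.
Qed.

(** Even for symmetric Y the left and right singular vectors may differ, for instance by signs at
    negative eigenvalues. Both Y V = U s and its transpose Y U = V s hold, which gives the
    alternation with N = n. *)
Lemma symmetric_controlled : mo = Symmetric -> controlled_noise P p th k C dl M Q E.
Proof.
move=> moS; have [MT XT OT] := data_symmetric hmodel moS.
have Dle i j : ((i, j) \in free_entries mo n) = (i <= j)%N by rewrite moS inE.
have ET w i j : E w i j = E w j i.
  by rewrite !mxE /observed /clipped /= XT OT MT.
have ETw w : (E w)^T = E w by apply/matrixP => i j; rewrite mxE ET.
have MTw : M^T = M by apply/matrixP => i j; rewrite mxE MT.
pose dec (e : 'I_n * 'I_n) := if (e.1 <= e.2)%N then Some e else None.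
have xiP := @independent_noise_decode d T R P _ _ (free_entries mo n) Z dec id _
  b_ge0 _ bZ Z_le Z_mean Z_indep.
have {}xiP : independent_noise P (fun e w => if dec e is Some u then Z u w else 0)
    (2 / sg).
  apply: xiP => -[i j] u; rewrite /dec /=; case: ifP => // ij [<-].
  by split=> //; rewrite Dle.
have dec_edge x y : exists2 u, dec (edge x y) = Some u & u \in free_entries mo n /\
    forall w, Z u w = sg^-1 * E w x y.
  rewrite /dec /edge; case: (leqP x y) => [xy|/ltnW xy] /=; rewrite xy.
    by exists (x, y) => //; rewrite Dle.
  by exists (y, x) => //; rewrite Dle; split=> // w; rewrite /Z /= ET.
have AE w : noise_mx (fun e w => if dec e is Some u then Z u w else 0) w =
    sg^-1 *: E w.
  apply/matrixP => x y; rewrite mxE [RHS]mxE.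
  by have [u -> [_ ->]] := dec_edge x y.
have EA w : E w = sg *: noise_mx (fun e w => if dec e is Some u then Z u w else 0) w.
  by rewrite AE scalerA divff ?scale1r// gt_eqF.
apply: (@lifted_noise_controlled d T R P n n p th C dl (2 / sg) k M Q _
  (fun e w => if dec e is Some u then Z u w else 0) ((p / sg) *: M) Q
  (fun U V S => U *m mask S) (fun U V S => V *m mask S)) => //.
- move=> x; have n0 : 0 < n%:R :> R by rewrite ltr0n.
  rewrite -(mulfV (lt0r_neq0 n0)) -[X in X%:R / _](card_ord n) -sum1_card natr_sum.
  rewrite mulr_suml; apply: ler_sum => y _; rewrite mul1r.
  by rewrite /entry_var; have [u -> [uD _]] := dec_edge x y; exact: Z_var.
- by apply: bC; rewrite leq_pmull.
- by rewrite leq_pmull.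
- by rewrite leq_pmull.
- by rewrite ler_peMl ?sqfrob_ge0// ler1n.
- rewrite -scalemxAl -scalerBr sqfrobZ.
  apply: (@le_trans _ _ ((p / sg) ^+ 2 * dl)).
    by rewrite ler_wpM2l// sqr_ge0.
  rewrite p_sg; have : 0 <= p * dl / n%:R by rewrite !mulr_ge0// ltW.
  by rewrite -!mulrA; lra.
- move=> w; rewrite ETw EA -scalemxAl -scalemxAr scalerA -expr2 sqfrobZ sg2//.
- by move=> w; rewrite EA -scalemxAl sqfrobZ sg2.
- by move=> U V S A UU VV; rewrite mulmxA; apply: le_trans (mask_le _ _) _; rewrite sqfrob_mul_isometry.
- by move=> U V S A UU VV; rewrite mulmxA; apply: le_trans (mask_le _ _) _; rewrite sqfrob_mul_isometry.
- move=> U V S A UU VV; rewrite -sqfrobT trmx_mul trmxK mulmxA.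
  by apply: le_trans (mask_le _ _) _; rewrite sqfrob_mul_isometry// sqfrobT.
- move=> U V S UU VV; rewrite trmx_mul mask_tr -mulmxA (mulmxA U^T) UU mul1mx.
  exact: mask_idem.
- move=> w U s V S svd; case: (svd) => UU VV _ _.
  have -> : noise_mx (fun e w => if dec e is Some u then Z u w else 0) w +
      (p / sg) *: M = sg^-1 *: (p *: M + E w).
    by rewrite AE scalerDr scalerA addrC mulrC.
  rewrite (scaled_svd svd) mulmxA -(mulmxA _ V^T) VV mulmx1.
  exact: mul_mask_diag.
- move=> w U s V S svd; case: (svd) => UU VV _ _.
  have -> : noise_mx (fun e w => if dec e is Some u then Z u w else 0) w +
      (p / sg) *: M = (sg^-1 *: (p *: M + E w))^T.
    by rewrite AE scalerDr scalerA addrC mulrC !linearD !linearZ /= ETw MTw.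
  rewrite (scaled_svd svd) !trmx_mul trmxK tr_diag_mx !mulmxA -(mulmxA _ U^T) UU.
  by rewrite mulmx1; exact: mul_mask_diag.
- by move=> U V S; rewrite -mulmxA mask_idem.
- by move=> U V S; rewrite -mulmxA mask_idem.
Qed.

(** The bipartite graph of the dilation: the first n vertices are rows, the last n columns, and only
    an edge from a row to a column carries an entry. *)
Let dec_asym (e : 'I_(n + n) * 'I_(n + n)) : option ('I_n * 'I_n) :=
  match fintype.split e.1, fintype.split e.2 with inl i, inr j => Some (i, j) | _, _ => None end.

Let xi_asym e w : R := if dec_asym e is Some u then Z u w else 0.

Let split_lshift (i : 'I_n) : fintype.split (lshift n i) = inl i.
Proof. exact: (unsplitK (inl i : 'I_n + 'I_n)). Qed.

Let split_rshift (i : 'I_n) : fintype.split (rshift n i) = inr i.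
Proof. exact: (unsplitK (inr i : 'I_n + 'I_n)). Qed.

Let edge_ll (i j : 'I_n) : dec_asym (edge (lshift n i) (lshift n j)) = None.
Proof. by rewrite /dec_asym /edge; case: ifP => _ /=; rewrite !split_lshift. Qed.

Let edge_rr (i j : 'I_n) : dec_asym (edge (rshift n i) (rshift n j)) = None.
Proof. by rewrite /dec_asym /edge; case: ifP => _ /=; rewrite !split_rshift. Qed.

Let edge_lr (i j : 'I_n) : dec_asym (edge (lshift n i) (rshift n j)) = Some (i, j).
Proof.
rewrite /dec_asym /edge /= (leq_trans (ltnW (ltn_ord i)) (leq_addr _ _)) /=.
by rewrite split_lshift split_rshift.
Qed.

Let asym_mx w : noise_mx xi_asym w = sg^-1 *: block_mx 0 (E w) (E w)^T 0.
Proof.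
apply/matrixP => x y; rewrite mxE [RHS]mxE /xi_asym.
case: (split_ordP x) => i ->; case: (split_ordP y) => j ->.
- by rewrite edge_ll block_mxEul mxE mulr0.
- by rewrite edge_lr block_mxEur.
- by rewrite edgeC edge_lr block_mxEdl [(E w)^T _ _]mxE.
- by rewrite edge_rr block_mxEdr mxE mulr0.
Qed.

(** The lift is the dilation with blocks E and E^T off the diagonal. Left vectors are padded below
    and right vectors above, so the number of columns stays n while order, rank and norms at most
    double. The lower block of the signal is M^T, hence [MTQ]. *)
Lemma asymmetric_controlled : mo = Asymmetric -> controlled_noise P p th k C dl M Q E.
Proof.
move=> moA; have DT u : u \in free_entries mo n by rewrite moA inE.
have n0 : 0 < n%:R :> R by rewrite ltr0n.
have xiP : independent_noise P xi_asym (2 / sg).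
  apply: (@independent_noise_decode d T R P _ _ (free_entries mo n) Z dec_asym
    (fun u => (lshift n u.1, rshift n u.2)) _ b_ge0 _ bZ Z_le Z_mean Z_indep).
  move=> [x y] u; rewrite /dec_asym /=.
  case: (split_ordP x) => i -> //; case: (split_ordP y) => j -> // [<-].
  by split.
have var_asym e : entry_var P xi_asym e <= n%:R^-1.
  rewrite /entry_var /xi_asym; case: (dec_asym e) => [u|]; first exact: Z_var.
  under eq_fun do rewrite expr0n.
  by rewrite (Ex_cst P 0) invr_ge0.
have var_None e : dec_asym e = None -> entry_var P xi_asym e = 0.
  rewrite /entry_var /xi_asym => ->.
  under eq_fun do rewrite expr0n.
  by rewrite (Ex_cst P 0).
have EA w : block_mx 0 (E w) (E w)^T 0 = sg *: noise_mx xi_asym w.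
  by rewrite asym_mx scalerA divff ?scale1r// gt_eqF.
have sum_invn : \sum_(i < n) n%:R^-1 = 1 :> R.
  by rewrite sumr_const card_ord -[LHS]mulr_natr mulVf// gt_eqF.
have svd_block w U s V : is_svd (p *: M + E w) U s V ->
    noise_mx xi_asym w + (p / sg) *: block_mx 0 M M^T 0 =
    block_mx 0 (U *m diag_mx (\row_i (s i / sg)) *m V^T)
      (V *m diag_mx (\row_i (s i / sg)) *m U^T) 0.
  move=> svd.
  have -> : V *m diag_mx (\row_i (s i / sg)) *m U^T =
      (U *m diag_mx (\row_i (s i / sg)) *m V^T)^T.
    by rewrite !trmx_mul trmxK tr_diag_mx mulmxA.
  rewrite -(scaled_svd svd) asym_mx -[p / sg]mulrC -scalerA -scalerDr.
  rewrite !scale_block_mx add_block_mx !scale_block_mx !scaler0 !addr0 scaler0.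
  by congr block_mx; rewrite ?linearZ /= ?linearD /= ?linearZ /= addrC.
apply: (@lifted_noise_controlled d T R P n (n + n) p th C dl (2 / sg) k M Q _
  xi_asym ((p / sg) *: block_mx 0 M M^T 0) (block_mx Q 0 0 Q)
  (fun U V S => col_mx (U *m mask S) 0) (fun U V S => col_mx 0 (V *m mask S))) => //.
- move=> x; rewrite big_split_ord /=; case: (split_ordP x) => i ->.
    rewrite big1 => [|j _]; last by rewrite var_None// edge_ll.
    by rewrite add0r -sum_invn; apply: ler_sum => j _.
  rewrite [X in _ + X]big1 => [|j _]; last by rewrite var_None// edge_rr.
  by rewrite addr0 -sum_invn; apply: ler_sum => j _.
- by apply: bC; rewrite mul2n addnn.
- by rewrite mul2n addnn.
- by rewrite rank_diag_block_mx mul2n addnn.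
- by rewrite sqfrob_block_mx !sqfrob0 addr0 add0r mulrDl mul1r.
- rewrite -scalemxAl -scalerBr sqfrobZ mulmx_block !mul0mx !mulmx0 !addr0 !add0r.
  rewrite opp_block_mx add_block_mx !subr0 sqfrob_block_mx !sqfrob0 add0r addr0.
  apply: (@le_trans _ _ ((p / sg) ^+ 2 * (dl + dl))).
    by rewrite ler_wpM2l ?sqr_ge0// lerD.
  by rewrite mulrDr p_sg; rewrite -!mulrA; lra.
- move=> w; rewrite asym_mx -scalemxAl -scalemxAr scalerA -expr2 sqfrobZ.
  rewrite exprVn sg2 exprVn mulrA divff ?gt_eqF ?exprn_gt0// mul1r.
  rewrite mulmx_block !mul0mx !mulmx0 !addr0 !add0r sqfrob_block_mx.
  by rewrite !sqfrob0 addr0 lerDl add0r sqfrob_ge0.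
- move=> w; rewrite asym_mx -scalemxAl sqfrobZ exprVn sg2 mulrA divff ?gt_eqF// mul1r.
  rewrite mulmx_block !mul0mx !mulmx0 !addr0 !add0r sqfrob_block_mx !sqfrob0.
  by rewrite add0r lerDl addr0 sqfrob_ge0.
- move=> U V S A UU VV; rewrite -[A]hsubmxK mul_row_col mulmx0 addr0 mulmxA.
  apply: le_trans (mask_le _ _) _; rewrite sqfrob_mul_isometry// sqfrob_row_mx.
  by rewrite lerDl sqfrob_ge0.
- move=> U V S A UU VV; rewrite -[A]hsubmxK mul_row_col mulmx0 add0r mulmxA.
  apply: le_trans (mask_le _ _) _; rewrite sqfrob_mul_isometry// sqfrob_row_mx.
  by rewrite lerDr sqfrob_ge0.
- move=> U V S A UU VV; rewrite tr_col_mx trmx0 -[A]vsubmxK mul_row_col mul0mx addr0.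
  rewrite -sqfrobT trmx_mul trmxK mulmxA.
  apply: le_trans (mask_le _ _) _; rewrite sqfrob_mul_isometry// sqfrobT.
  by rewrite sqfrob_col_mx lerDl sqfrob_ge0.
- move=> U V S UU VV; rewrite tr_col_mx mul_row_col mulmx0 addr0.
  rewrite trmx_mul mask_tr -mulmxA (mulmxA U^T) UU mul1mx.
  exact: mask_idem.
- move=> w U s V S svd; rewrite (svd_block _ _ _ _ svd); case: (svd) => UU VV _ _.
  rewrite mul_block_col mul_col_mx !mul0mx !mulmx0 add0r addr0; congr col_mx.
  rewrite mulmxA -(mulmxA _ V^T) VV mulmx1.
  exact: mul_mask_diag.
- move=> w U s V S svd; rewrite (svd_block _ _ _ _ svd); case: (svd) => UU VV _ _.
  rewrite mul_block_col mul_col_mx !mul0mx !mulmx0 add0r addr0; congr col_mx.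
  rewrite mulmxA -(mulmxA _ U^T) UU mulmx1.
  exact: mul_mask_diag.
- by move=> U V S; rewrite mul_col_mx mul0mx -mulmxA mask_idem.
- by move=> U V S; rewrite mul_col_mx mul0mx -mulmxA mask_idem.
Qed.

Lemma model_controlled : controlled_noise P p th k C dl M Q E.
Proof.
have : mo = Asymmetric \/ mo = Symmetric by case: (mo); [left|right].
by case; [exact: asymmetric_controlled|exact: symmetric_controlled].
Qed.

End ModelControlled.

(** * The loss and its limit *)

Section LossBound.
Context {d : measure_display} {T : measurableType d} {R : realType}.
Variable P : probability T R.

(* The integral of a nonnegative function is the supremum over the simple
   functions below it, so this holds even if [f] is not measurable. *)
Lemma expectation_le_ae (f g : T -> R) (c : R) (G : set T) : bounded_rv g ->
  (forall w, 0 <= f w <= c) ->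
  {ae P, forall w, G w} -> (forall w, G w -> f w <= g w) ->
  ('E_P[f] <= (Ex P g)%:E)%E.
Proof.
move=> bg fc [N [mN PN0 GN]] fg.
(* On the null set g is raised by c + D, which exceeds f there since g is at least - D; the
   expectation does not change. *)
have [_ [D gD]] := bg; pose g' w := g w + (c + D) * \1_N w.
have bI : bounded_rv (\1_N : T -> R) by exact: bounded_rv_indic.
have bcI : bounded_rv (fun w => (c + D) * \1_N w : R).
  by apply: bounded_rvM => //; exact: bounded_rv_cst.
have bg' : bounded_rv g' by exact: bounded_rvD.
have Eg' : Ex P g' = Ex P g.
  rewrite ExD// ExZ// (_ : Ex P (\1_N) = 0) ?mulr0 ?addr0//.
  by apply: EFin_inj; rewrite Ex_indic.
have fg' w : f w <= g' w.
  rewrite /g' indicE; case: (boolP (w \in N)) => [_|/negP wN].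
    have /andP[_ fcw] := fc w; rewrite mulr1.
    by have := gD w; rewrite ler_norml => /andP[gw _]; lra.
  rewrite mulr0 addr0; apply: fg; apply: contrapT => Gw; apply: wN.
  by rewrite inE; exact: GN.
rewrite -Eg' Ex_expectation// unlock.
have g'0 w : 0 <= g' w by have /andP[f0 _] := fc w; exact: le_trans (fg' w).
rewrite !ge0_integralTE; last 2 first.
- by move=> w; rewrite lee_fin.
- by move=> w; rewrite lee_fin; have /andP[] := fc w.
apply: ereal_sup_le => _ [h hf <-]; exists h => // w.
by apply: le_trans (hf w) _; rewrite lee_fin.
Qed.

Variables (mo : model) (n : nat) (p eta : R) (M Q : 'M[R]_n).
Variables (X : 'I_n -> 'I_n -> {RV P >-> R}) (O : 'I_n -> 'I_n -> {RV P >-> bool}).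
Variable Mhat : T -> 'M[R]_n.
Hypothesis hmodel : data_model mo p M X O.
Hypothesis husvt : usvt_estimator mo eta X O Mhat.
Hypothesis eta01 : 0 < eta < 1.
Hypothesis M_le1 : forall i j, -1 <= M i j <= 1.
Hypothesis p_gt0 : 0 < p.
Hypothesis p_le1 : p <= 1.
Hypothesis n_gt0 : (0 < n)%N.
Variables (C dl : R) (k : nat).
Hypothesis MQ : sqfrob (M - M *m Q) <= dl.
Local Notation th := (2 + eta / 2).
Local Notation E := (noise p M X O).
Variables r t1 t2 : T -> R.
Hypothesis br : bounded_rv r.
Hypothesis bt1 : bounded_rv t1.
Hypothesis bt2 : bounded_rv t2.
Hypothesis rP : forall w (U V : 'M[R]_n) s (S : pred 'I_n),
  is_svd (p *: M + E w) U s V ->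
  (forall i, S i -> th * Num.sqrt (n%:R * p) <= s i) ->
  \tr (mask S : 'M[R]_n) <= r w.
Hypothesis t1P : forall w, sqfrob (E w *m (E w)^T) <= t1 w.
Hypothesis t2P : forall w, sqfrob (E w *m Q) <= t2 w.

Definition good : set T := [set w | forall e, e \in free_entries mo n ->
  `|X e.1 e.2 w| <= 1].

Lemma good_ae : {ae P, forall w, good w}.
Proof.
apply: filter_forall => -[i j] /=.
case: (boolP ((i, j) \in free_entries mo n)) => ijD.
  by apply: filterS (data_bounded hmodel ijD) => w + _.
by apply: nearW.
Qed.

Local Notation ph w := (observed_proportion R mo (fun i j => O i j w)).
Local Notation Y w :=
  (observed_matrix (\matrix_(i, j) X i j w) (fun i j => O i j w)).

Lemma good_le1 w i j : good w -> `|X i j w| <= 1.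
Proof.
have [moA|moS] : mo = Asymmetric \/ mo = Symmetric by case: (mo); [left|right].
  by move=> /(_ (i, j)); apply; rewrite moA inE.
have [_ XT _] := data_symmetric hmodel moS.
move=> gw; case: (leqP i j) => ij.
  by apply: (gw (i, j)); rewrite moS inE.
by rewrite XT; apply: (gw (j, i)); rewrite moS inE ltnW.
Qed.

Lemma observed_matrixE w : good w -> Y w = p *: M + E w.
Proof.
move=> gw; apply/matrixP => i j; rewrite !mxE addrC subrK /observed /clipped /=.
have := good_le1 i j gw; rewrite ler_norml => /andP[X1 X2].
by rewrite /truncate max_r// min_r//; case: (O i j w); rewrite ?mul1r ?mul0r.
Qed.

Definition loss w : R :=
  (n%:R ^+ 2)^-1 * \sum_(i < n) \sum_(j < n) (Mhat w i j - M i j) ^+ 2.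

Lemma n2_gt0 : 0 < n%:R ^+ 2 :> R.
Proof. by rewrite exprn_gt0// ltr0n. Qed.

Lemma loss_ge0_le4 w : 0 <= loss w <= 4.
Proof.
apply/andP; split.
  rewrite mulr_ge0 ?invr_ge0 ?sqr_ge0//; apply: sumr_ge0 => i _.
  by apply: sumr_ge0 => j _; exact: sqr_ge0.
rewrite /loss mulrC ler_pdivrMr ?n2_gt0//.
have -> : 4 * n%:R ^+ 2 = \sum_(i < n) \sum_(j < n) 4 :> R.
  by rewrite !sumr_const !card_ord -mulrnA -[RHS]mulr_natr natrM expr2.
apply: ler_sum => i _; apply: ler_sum => j _.
have [U [V [s [_ ->]]]] := husvt w; rewrite mxE.
have /andP[h1 h2] := M_le1 i j.
by set x := (X in truncate X); have /andP[h3 h4] := truncate_le1 x; nra.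
Qed.

Lemma observed_proportion01 w : 0 <= ph w <= 1.
Proof.
rewrite /observed_proportion divr_ge0//=; have [->|D0] := eqVneq #|free_entries mo n| 0%N.
  by rewrite invr0 mulr0.
rewrite ler_pdivrMr ?ltr0n ?lt0n// mul1r ler_nat subset_leq_card//.
by apply/fintype.subsetP => e; rewrite inE => /andP[].
Qed.

(** The empty selection of singular values satisfies the threshold vacuously and has trace 0. *)
Lemma r_ge0 w : good w -> 0 <= r w.
Proof.
move=> gw; have [U [V [s [svd _]]]] := husvt w.
rewrite observed_matrixE// in svd.
have := rP (S := pred0) svd (fun i => ltac:(by [])).
by rewrite /mask mxtrace_diag big1// => i _; rewrite mxE.
Qed.

(** The tolerance eta / 10 is chosen so that (2 + eta)^2 (1 - eta / 10) is at least (2 + eta / 2)^2: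
    a singular value above the threshold for the observed proportion q is then above [th] for p, and
    [rP] applies. The 9 bounds (2 + eta)^2, and 8 is twice the 4 of q^-2 <= 4 / p^2. *)
Lemma loss_good_le w (a : R) : 0 < a -> good w ->
  `|ph w - p| <= eta / 10 * p ->
  loss w <= 8 / p ^+ 2 * (ph w - p) ^+ 2 + 8 / p ^+ 2 / n%:R ^+ 2 *
    (3 / 2 * (a * r w + a^-1 * t1 w) + 6 * (9 * n%:R * sqfrob Q + t2 w) +
     3 * (p ^+ 2 * dl)).
Proof.
move=> a0 gw pw; have /andP[e0 e1] := eta01.
have [U [V [s [svd NE]]]] := husvt w.
have /andP[ph0 ph1] := observed_proportion01 w.
move: svd NE; rewrite observed_matrixE//; set q := ph w in pw ph0 ph1 *; clearbody q.
move=> svd; move: pw; rewrite ler_norml => /andP[q1 q2].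
have q_ge : p / 2 <= q by nra.
have q_gt0 : 0 < q by apply: lt_le_trans q_ge; rewrite divr_gt0.
rewrite gt_eqF//= => NE.
set t := (2 + eta) * Num.sqrt (n%:R * q) in NE.
pose S i := t <= s i.
have nq0 : 0 <= n%:R * q by rewrite mulr_ge0.
have t0 : 0 <= t by rewrite mulr_ge0 ?sqrtr_ge0//; lra.
have t2E : t ^+ 2 = (2 + eta) ^+ 2 * (n%:R * q) by rewrite exprMn sqr_sqrtr.
have St i : ~~ S i -> s i <= t by rewrite -ltNge => /ltW.
have n0 : 0 <= n%:R :> R by [].
have trS : \tr (mask S : 'M[R]_n) <= r w.
  apply: rP svd _ => i; apply: le_trans.
  rewrite -(@ler_pXn2r _ 2)// ?nnegrE// ?mulr_ge0 ?sqrtr_ge0//; last by lra.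
  rewrite t2E exprMn sqr_sqrtr; last by rewrite mulr_ge0// ltW.
  by rewrite mulrCA [leRHS]mulrCA ler_wpM2l//; nra.
have err := sqfrob_threshold_error svd Q (erefl _) a0 t0 St.
have W_E : Mhat w = map_mx truncate (q^-1 *: (top_proj U S *m (p *: M + E w))).
  by rewrite -(thresholded_svd svd).
have trunc_le : \sum_(i < n) \sum_(j < n) (Mhat w i j - M i j) ^+ 2 <=
    sqfrob (q^-1 *: (top_proj U S *m (p *: M + E w)) - M).
  apply: ler_sum => i _; apply: ler_sum => j _.
  by rewrite W_E [map_mx _ _ _ _]mxE [X in _ <= X ^+ 2]mxE [(- M) i j]mxE truncate_sqr_le.
set F := 3 / 2 * _ + _ + _.
have F_ge : sqfrob (top_proj U S *m (p *: M + E w) - p *: M) <= F.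
  apply: le_trans err _; rewrite /F; apply: lerD; first apply: lerD.
  - rewrite ler_wpM2l// lerD// ler_wpM2l ?t1P ?invr_ge0// ltW//.
  - rewrite ler_wpM2l// lerD// ler_wpM2r ?sqfrob_ge0// t2E.
    by rewrite mulrCA [leRHS]mulrC ler_wpM2l//; nra.
  - by rewrite ler_wpM2l// ler_wpM2l// sqr_ge0.
have M_le : sqfrob M <= n%:R ^+ 2.
  have -> : n%:R ^+ 2 = \sum_(i < n) \sum_(j < n) 1 :> R.
    by rewrite !sumr_const !card_ord -mulrnA natrM expr2.
  apply: ler_sum => i _; apply: ler_sum => j _.
  by have /andP[h1 h2] := M_le1 i j; nra.
(* Rescaling by q instead of p leaves a multiple of M, whose squared norm is at most n^2. *)
have WM : q^-1 *: (top_proj U S *m (p *: M + E w)) - M =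
    q^-1 *: (top_proj U S *m (p *: M + E w) - p *: M) + (q^-1 * (p - q)) *: M.
  rewrite scalerBr scalerA -addrA; congr (_ + _).
  by rewrite mulrBr mulVf ?gt_eqF// scalerBl scale1r addrA addNr add0r.
have qp : q^-1 ^+ 2 <= 4 / p ^+ 2.
  rewrite (_ : 4 / p ^+ 2 = (2 / p) ^+ 2); last first.
    by rewrite exprMn exprVn -natrX.
  have h : q^-1 <= 2 / p.
    by rewrite -[2 / p]invrK lef_pV2 ?posrE ?invf_div// divr_gt0.
  by apply: lerXn2r h; rewrite nnegrE ?invr_ge0 ?divr_ge0// ltW.
rewrite /loss mulrC ler_pdivrMr ?n2_gt0//.
apply: le_trans trunc_le _; rewrite WM; apply: le_trans (sqfrobD _ _) _.
rewrite !sqfrobZ.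
have G0 := sqfrob_ge0 (top_proj U S *m (p *: M + E w) - p *: M).
set G := sqfrob _ in F_ge G0 *.
have H0 := sqfrob_ge0 M; set H := sqfrob M in M_le H0 *.
have i20 : 0 <= q^-1 ^+ 2 by exact: sqr_ge0.
have GF : q^-1 ^+ 2 * G <= 4 / p ^+ 2 * F by rewrite ler_pM.
have HF : (q^-1 * (p - q)) ^+ 2 * H <= 4 / p ^+ 2 * (q - p) ^+ 2 * n%:R ^+ 2.
  rewrite [X in X * _ <= _]exprMn -[p - q]opprB sqrrN.
  apply: ler_pM => //; first by apply: mulr_ge0; exact: sqr_ge0.
  by apply: ler_wpM2r => //; exact: sqr_ge0.
have n1 : n%:R != 0 :> R by rewrite pnatr_eq0 -lt0n.
have -> : (8 / p ^+ 2 * (q - p) ^+ 2 + 8 / p ^+ 2 / n%:R ^+ 2 * F) * n%:R ^+ 2 =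
    2 * (4 / p ^+ 2 * F) + 2 * (4 / p ^+ 2 * (q - p) ^+ 2 * n%:R ^+ 2).
  by field; rewrite n1 gt_eqF.
by rewrite lerD// ler_wpM2l.
Qed.

Definition loss_majorant (a : R) w : R :=
  (4 / (eta / 10 * p) ^+ 2 + 8 / p ^+ 2) * (ph w - p) ^+ 2 +
  8 / p ^+ 2 / n%:R ^+ 2 *
    (3 / 2 * (a * r w + a^-1 * t1 w) + 6 * (9 * n%:R * sqfrob Q + t2 w) +
     3 * (p ^+ 2 * dl)).

(** If the observed proportion is far from p, the trivial bound 4 is dominated by 4 ([ph w] - p)^2 /
    (eta p / 10)^2. This is Chebyshev's inequality before integration, so no conditioning on the
    event is required. *)
Lemma loss_le_majorant w (a : R) : 0 < a -> good w -> loss w <= loss_majorant a w.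
Proof.
move=> a0 gw; have /andP[e0 e1] := eta01.
have F0 : 0 <= 8 / p ^+ 2 / n%:R ^+ 2 *
    (3 / 2 * (a * r w + a^-1 * t1 w) + 6 * (9 * n%:R * sqfrob Q + t2 w) +
     3 * (p ^+ 2 * dl)).
  have dl0 : 0 <= dl by exact: le_trans (sqfrob_ge0 _) MQ.
  have t10 : 0 <= t1 w by exact: le_trans (sqfrob_ge0 _) (t1P w).
  have t20 : 0 <= t2 w by exact: le_trans (sqfrob_ge0 _) (t2P w).
  have Q0 := sqfrob_ge0 Q; have r0 := r_ge0 gw.
  apply: mulr_ge0; first by rewrite !mulr_ge0// invr_ge0 sqr_ge0.
  have p20 : 0 <= p ^+ 2 by exact: sqr_ge0.
  apply: addr_ge0; last by apply: mulr_ge0 => //; apply: mulr_ge0.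
  apply: addr_ge0; last by rewrite mulr_ge0// addr_ge0// !mulr_ge0.
  rewrite mulr_ge0// addr_ge0// mulr_ge0//; first exact: ltW.
  by rewrite invr_ge0 ltW.
have s0 := sqr_ge0 (ph w - p).
have [small|large] := leP `|ph w - p| (eta / 10 * p).
  apply: le_trans (loss_good_le a0 gw small) _.
  apply: lerD => //; apply: ler_wpM2r => //.
  by rewrite lerDr divr_ge0// sqr_ge0.
have /andP[_ l4] := loss_ge0_le4 w; apply: le_trans l4 _.
rewrite /loss_majorant -[leLHS]addr0; apply: lerD => //; rewrite mulrDl.
rewrite -[leLHS]addr0; apply: lerD; last by rewrite mulr_ge0// divr_ge0// sqr_ge0.
have ep0 : 0 < eta / 10 * p by rewrite mulr_gt0// divr_gt0.
rewrite -mulrA ler_peMr// mulrC ler_pdivlMr ?exprn_gt0// mul1r.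
rewrite -(real_normK (num_real (ph w - p))) lerXn2r ?nnegrE//; exact: ltW.
Qed.

Lemma bounded_observed_proportion : bounded_rv (fun w => ph w).
Proof.
have -> : (fun w => ph w) = (fun w => (\sum_(e in free_entries mo n)
    observed O e w) * #|free_entries mo n|%:R^-1).
  apply/funext => w; rewrite /observed_proportion; congr (_ / _).
  rewrite -sum1_card natr_sum big_mkcond [RHS]big_mkcond /=.
  apply: eq_bigr => e _; rewrite inE /observed.
  by case: (e \in _) => //=; case: (O _ _ _).
apply: bounded_rvM; last exact: bounded_rv_cst.
by apply: bounded_rv_sum => e; exact: bounded_observed.
Qed.

Lemma MSE_le_majorant (a : R) : 0 < a ->
  (MSE P Mhat M <= ((4 / (eta / 10 * p) ^+ 2 + 8 / p ^+ 2) / n%:R +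
  8 / p ^+ 2 / n%:R ^+ 2 *
    (3 / 2 * (a * Ex P r + a^-1 * Ex P t1) +
     6 * (9 * n%:R * sqfrob Q + Ex P t2) + 3 * (p ^+ 2 * dl)))%:E)%E.
Proof.
move=> a0.
have bc (c : R) (f : T -> R) : bounded_rv f -> bounded_rv (fun w => c * f w).
  by move=> bf; apply: bounded_rvM => //; exact: bounded_rv_cst.
have bk (c : R) : bounded_rv (fun _ : T => c) by exact: bounded_rv_cst.
have bph : bounded_rv (fun w => (ph w - p) ^+ 2).
  by apply: bounded_rvX; apply: bounded_rvB => //; exact: bounded_observed_proportion.
have b1 : bounded_rv (fun w => a * r w + a^-1 * t1 w).
  by apply: bounded_rvD; exact: bc.
have b2 : bounded_rv (fun w => 9 * n%:R * sqfrob Q + t2 w) by exact: bounded_rvD.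
have b3 : bounded_rv (fun w => 3 / 2 * (a * r w + a^-1 * t1 w) +
    6 * (9 * n%:R * sqfrob Q + t2 w)).
  by apply: bounded_rvD; exact: bc.
have b4 : bounded_rv (fun w => 3 / 2 * (a * r w + a^-1 * t1 w) +
    6 * (9 * n%:R * sqfrob Q + t2 w) + 3 * (p ^+ 2 * dl)) by exact: bounded_rvD.
have bL : bounded_rv (loss_majorant a) by apply: bounded_rvD; exact: bc.
have -> : MSE P Mhat M = ('E_P[loss])%E by [].
apply: le_trans (expectation_le_ae bL loss_ge0_le4 good_ae _) _.
  by move=> w gw; exact: loss_le_majorant.
rewrite lee_fin /loss_majorant (ExD P (bc _ _ bph) (bc _ _ b4)) !ExZ//.
rewrite (ExD P b3 (bk _)) (Ex_cst P (3 * (p ^+ 2 * dl))).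
rewrite (ExD P (bc _ _ b1) (bc _ _ b2)) !ExZ//.
rewrite (ExD P (bc _ _ br) (bc _ _ bt1)) !ExZ//.
rewrite (ExD P (bk _) bt2) (Ex_cst P (9 * n%:R * sqfrob Q)) lerD2r.
rewrite ler_wpM2l//; first by rewrite addr_ge0// divr_ge0// sqr_ge0.
by apply: (Ex_observed_proportion hmodel) => //; rewrite ltW.
Qed.

End LossBound.

(** * An explicit bound, uniform over the observation probability *)

Section Limit.
Context {R : realType}.

Lemma exists_pow_le (rho e : R) : 0 <= rho < 1 -> 0 < e -> exists k : nat, rho ^+ k <= e.
Proof.
move=> /andP[r0 r1] e0.
have /cvgrPdist_le/(_ e e0) : (fun k => rho ^+ k) @ \oo --> (0 : R).
  by apply: cvg_expr; rewrite ger0_norm.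
move=> [k _ /(_ k (leqnn k))]; rewrite /= sub0r normrN ger0_norm ?exprn_ge0//.
by exists k.
Qed.

Variable eta : R.
Hypothesis eta01 : 0 < eta < 1.
Local Notation th := (2 + eta / 2).

(** Here a is the AM-GM weight divided by n, [N'] the bound on the number of cells, and [del] the
    lower bound that replaces p. Apart from the terms over n, everything is governed by a^-1, by the
    k-th power of 4 / th^2 and by e^2. *)
Definition mse_bound (del a : R) (k N' : nat) (e n : R) : R :=
  let C := 8 / del in
  (4 / (eta / 10 * del) ^+ 2 + 8 / del ^+ 2) / n + 8 / del ^+ 2 *
    (3 / 2 * (a * (((2 * k%:R * N'%:R) + 4 * k%:R * \sum_(j < k) error_bound C j) / n +
                   4 * (4 * (th^-1) ^+ 2) ^+ k +
                   (8 * k%:R * \sum_(j < k) 4 ^+ j) * e ^+ 2) +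
              a^-1 * (3 * (32 + error_bound C 1 + 2 * C * error_bound C 0))) +
     (6 * (9 + 2 * (8 + 2 * error_bound C 0)) * N'%:R) / n + 3 * e ^+ 2).

Lemma MSE_le_bound (d : measure_display) (T : measurableType d) (P : probability T R)
    (mo : model) (n : nat) (p del a e : R) (k N : nat) (M : 'M[R]_n)
    (cell : 'I_n -> 'I_N.+1)
    (X : 'I_n -> 'I_n -> {RV P >-> R}) (O : 'I_n -> 'I_n -> {RV P >-> bool})
    (Mhat : T -> 'M[R]_n) :
  data_model mo p M X O -> usvt_estimator mo eta X O Mhat ->
  (forall i j, -1 <= M i j <= 1) -> (0 < n)%N -> 0 < del -> del <= p -> p <= 1 ->
  0 < a -> 0 <= e ->
  (forall i j j', cell j = cell j' ->
     `|M i j - M i j'| <= e /\ `|M j i - M j' i| <= e) ->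
  (MSE P Mhat M <= (mse_bound del a k N.+1 e n%:R)%:E)%E.
Proof.
move=> hmodel husvt M1 n0 del0 delp p1 a0 e0 Mcell; have /andP[h0 h1] := eta01.
have p0 : 0 < p by exact: lt_le_trans delp.
have del1 : del <= 1 by exact: le_trans p1.
pose Q := avg_mx (R := R) cell; pose C := 8 / del; pose dl := n%:R ^+ 2 * e ^+ 2.
have n0' : 0 < n%:R :> R by rewrite ltr0n.
have n1' : 1 <= n%:R :> R by rewrite ler1n.
have C1 : 1 <= C by rewrite /C ler_pdivlMr// mul1r; apply: le_trans del1 _; rewrite ler1n.
have C0 : 0 <= C by exact: le_trans C1.
have Cp : 8 / p <= C by rewrite /C ler_wpM2l// lef_pV2 ?posrE.
have th1 : 1 <= th by lra.
have MQ : sqfrob (M - M *m Q) <= dl.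
  by apply: avg_mx_close => // i j j' jj'; case: (Mcell i j j' jj').
have MTQ : sqfrob (M^T - M^T *m Q) <= dl.
  by apply: avg_mx_close => // i j j' jj'; rewrite !mxE; case: (Mcell i j j' jj').
have [r [t1 [t2 [[br bt1 bt2] [[rP t1P t2P] [Er Et1 Et2]]]]]] :=
  model_controlled hmodel M1 p0 p1 n0 k th1 C1 Cp MQ MTQ.
(* The weight is n a because the bound on the rank is of order n and that on t1 of order n^3: both
   contributions become of order n^2 and cancel the 1 / n^2 of the loss. *)
have na0 : 0 < n%:R * a by rewrite mulr_gt0.
apply: le_trans (MSE_le_majorant hmodel husvt eta01 M1 p0 p1 n0 MQ br bt1 bt2
  rP t1P t2P na0) _.
rewrite lee_fin.
have Qrank : (\rank Q)%:R <= N.+1%:R :> R by rewrite ler_nat avg_mx_rank.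
have Qfrob : sqfrob Q <= N.+1%:R by exact: sqfrob_avg_mx.
have Q0 := sqfrob_ge0 Q.
have EB0 j : 0 <= error_bound C j by exact: error_bound_ge0.
set sE := \sum_(j < k) error_bound C j.
set s4 := \sum_(j < k) 4 ^+ j : R.
have s40 : 0 <= s4 by apply: sumr_ge0 => j _; exact: exprn_ge0.
have sE0 : 0 <= sE by apply: sumr_ge0.
set rk := (4 * th^-1 ^+ 2) ^+ k in Er *.
have N0 : 0 <= N.+1%:R :> R by [].
set N1 : R := N.+1%:R in Qrank Qfrob N0 *.
have sumE x : \sum_(j < k) (error_bound C j + 4 ^+ j * x) = sE + s4 * x.
  by rewrite big_split /= -mulr_suml.
rewrite sumE in Er.
have rk0 : 0 <= rk.
  by rewrite /rk exprn_ge0// mulr_ge0// sqr_ge0.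
have K00 := EB0 0%N; have K10 := EB0 1%N.
rewrite /mse_bound -/C -/sE -/s4 -/rk -/N1; clear sumE; clearbody C N1 rk sE s4; move: Et1 Et2 K00 K10.
move: (error_bound C 0) (error_bound C 1) => K0 K1 Et1 Et2 K00 K10.
have k0 : 0 <= k%:R :> R by [].
have Er' : Ex P r <= 2 * k%:R * N1 + 4 * n%:R * rk + 4 * k%:R * sE +
    8 * k%:R * s4 * (n%:R * e ^+ 2).
  apply: le_trans Er _; rewrite -[leRHS]addrA; apply: lerD; first apply: lerD.
  - rewrite !natrM mulrCA -mulrA ler_wpM2l// ler_wpM2l//.
  - by rewrite le_eqVlt; apply/orP; left; apply/eqP; ring.
  - rewrite mulrDr lerD2l.
    have -> : 8 * k%:R * s4 * (n%:R * e ^+ 2) = 4 * k%:R * (s4 * (2 * 1 * dl / n%:R)).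
      by rewrite /dl; field; rewrite gt_eqF.
    rewrite ler_wpM2l ?mulr_ge0// ler_wpM2l// ler_wpM2r ?invr_ge0 ?(ltW n0')//.
    by rewrite ler_wpM2r ?mulr_ge0 ?sqr_ge0// ler_wpM2l.
have c10 : 0 <= 3 * (32 + K1 + 2 * C * K0).
  by rewrite mulr_ge0// !addr_ge0// !mulr_ge0.
have Et1' : Ex P t1 <= n%:R ^+ 2 * (n%:R * (3 * (32 + K1 + 2 * C * K0))).
  apply: le_trans Et1 _; apply: ler_pM; rewrite ?sqr_ge0//.
  - by rewrite mulr_ge0// !addr_ge0// !mulr_ge0// ltW.
  - by rewrite lerXn2r ?nnegrE ?mulr_ge0 ?(ltW n0') ?(ltW p0)// ler_piMr// ltW.
  - have : K1 <= n%:R * K1 by rewrite ler_peMl.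
    by nra.
have Et2' : Ex P t2 <= n%:R * (2 * (8 + 2 * K0) * N1).
  apply: le_trans Et2 _; apply: ler_pM.
  - by rewrite mulr_ge0 ?(ltW n0') ?(ltW p0).
  - by rewrite mulr_ge0 ?addr_ge0 ?mulr_ge0.
  - by rewrite ler_piMr// ltW.
  - by rewrite mulrCA mulrA ler_wpM2l// mulr_ge0// addr_ge0// mulr_ge0.
have ip : (p ^+ 2)^-1 <= (del ^+ 2)^-1.
  by rewrite lef_pV2 ?posrE ?exprn_gt0// lerXn2r ?nnegrE// ltW.
have d20 : 0 <= (del ^+ 2)^-1 by rewrite invr_ge0 sqr_ge0.
have B0 : (4 / (eta / 10 * p) ^+ 2 + 8 / p ^+ 2) / n%:R <=
    (4 / (eta / 10 * del) ^+ 2 + 8 / del ^+ 2) / n%:R.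
  rewrite ler_wpM2r ?invr_ge0 ?(ltW n0')//; apply: lerD; rewrite ler_wpM2l//.
  have eta10 : 0 < eta / 10 by rewrite divr_gt0.
  have dp : eta / 10 * del <= eta / 10 * p by rewrite ler_wpM2l// ltW.
  have d0 : 0 < eta / 10 * del by rewrite mulr_gt0.
  have d0' : 0 < eta / 10 * p by rewrite mulr_gt0.
  rewrite lef_pV2 ?posrE ?exprn_gt0//; apply: lerXn2r dp; rewrite nnegrE; exact: ltW.
have inv_n0 : 0 <= (n%:R^-1 : R) by rewrite invr_ge0 ltW.
have ia0 : 0 <= a^-1 by rewrite invr_ge0 ltW.
have -> : (4 / (eta / 10 * del) ^+ 2 + 8 / del ^+ 2) / n%:R + 8 / del ^+ 2 *
    (3 / 2 * (a * ((2 * k%:R * N1 + 4 * k%:R * sE) / n%:R + 4 * rk +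
                   8 * k%:R * s4 * e ^+ 2) +
              a^-1 * (3 * (32 + K1 + 2 * C * K0))) +
     6 * (9 + 2 * (8 + 2 * K0)) * N1 / n%:R + 3 * e ^+ 2) =
  (4 / (eta / 10 * del) ^+ 2 + 8 / del ^+ 2) / n%:R + 8 / del ^+ 2 / n%:R ^+ 2 *
    (3 / 2 * ((n%:R * a) * (2 * k%:R * N1 + 4 * n%:R * rk + 4 * k%:R * sE +
        8 * k%:R * s4 * (n%:R * e ^+ 2)) +
      (n%:R * a)^-1 * (n%:R ^+ 2 * (n%:R * (3 * (32 + K1 + 2 * C * K0))))) +
     6 * (9 * n%:R * N1 + n%:R * (2 * (8 + 2 * K0) * N1)) + 3 * (1 * dl)).
  by rewrite /dl; field; rewrite !gt_eqF//= mulr_gt0// divr_gt0.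
apply: lerD => //.
set F := (X in _ <= _ * X).
have n00 := ltW n0'; have na00 := ltW na0; have e20 := sqr_ge0 e.
have dl0 : 0 <= dl by rewrite mulr_ge0 ?sqr_ge0.
have n20 : 0 <= n%:R ^+ 2 :> R by exact: sqr_ge0.
have ina0 : 0 <= (n%:R * a)^-1 by rewrite invr_ge0.
have F0 : 0 <= F.
  apply: addr_ge0; last by rewrite !mulr_ge0.
  apply: addr_ge0; apply: mulr_ge0 => //; apply: addr_ge0.
  - apply: mulr_ge0 => //; apply: addr_ge0; last by rewrite !mulr_ge0.
    apply: addr_ge0; last by rewrite !mulr_ge0.
    by apply: addr_ge0; rewrite !mulr_ge0.
  - by apply: mulr_ge0 => //; apply: mulr_ge0 => //; exact: mulr_ge0.
  - by rewrite !mulr_ge0.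
  - by apply: mulr_ge0 => //; rewrite !mulr_ge0// addr_ge0// mulr_ge0.
apply: (@le_trans _ _ (8 / p ^+ 2 / n%:R ^+ 2 * F)); last first.
  by rewrite ler_wpM2r// ler_wpM2r ?invr_ge0// ler_wpM2l.
rewrite ler_wpM2l ?mulr_ge0 ?invr_ge0 ?sqr_ge0//.
apply: lerD; first apply: lerD.
- rewrite ler_wpM2l//; apply: lerD; rewrite ler_wpM2l// ?invr_ge0 ltW//.
- rewrite ler_wpM2l// lerD// ler_wpM2l// mulr_ge0// ltW//.
- rewrite ler_wpM2l// ler_wpM2r ?mulr_ge0 ?sqr_ge0// exprn_ile1// ltW//.
Qed.

End Limit.

(** * Choice of the parameters and of the constant in the theorem *)

Section Conclusion.
Context {R : realType}.
Variable eta : R.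
Hypothesis eta01 : 0 < eta < 1.

(** The order of choices breaks the circularity: a makes the term in a^-1 small, k then beats the
    factor a, e beats the factors depending on a and k, and n comes last because the number of cells
    N depends on e. *)
Lemma mse_bound_small (del eps : R) : 0 < del -> 0 < eps ->
  exists (a : R) (k : nat) (e : R), [/\ 0 < a, 0 < e &
    forall N : nat, exists n0 : nat, forall n : nat, (n0 <= n)%N ->
      mse_bound eta del a k N e n%:R <= eps].
Proof.
move=> d0 eps0; have /andP[h0 h1] := eta01.
pose C := 8 / del; have C0 : 0 <= C by rewrite divr_ge0// ltW.
have EB0 j : 0 <= error_bound C j by exact: error_bound_ge0.
pose D := 8 / del ^+ 2; have D0 : 0 < D by rewrite divr_gt0// exprn_gt0.
pose c1 := 3 * (32 + error_bound C 1 + 2 * C * error_bound C 0).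
have c10 : 0 < c1.
  apply: mulr_gt0 => //; apply: ltr_wpDr.
    by apply: mulr_ge0; [exact: mulr_ge0|exact: EB0].
  by apply: ltr_wpDr => //; exact: EB0.
(* Four groups of terms are each made at most eps / 5; this value makes the term in a^-1 equal to
   eps / 5. *)
pose a := 15 / 2 * D * c1 / eps.
have a0 : 0 < a.
  by apply: divr_gt0 => //; apply: mulr_gt0 => //; apply: mulr_gt0.
pose rho : R := 4 * ((2 + eta / 2)^-1) ^+ 2.
have rho01 : 0 <= rho < 1.
  have th0 : 0 < 2 + eta / 2 by rewrite addr_gt0// divr_gt0.
  apply/andP; split; first by rewrite mulr_ge0 ?sqr_ge0.
  by rewrite /rho exprVn ltr_pdivrMr ?exprn_gt0//; nra.
have [k kP] : exists k, rho ^+ k <= eps / (30 * D * a).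
  apply: exists_pow_le => //; apply: divr_gt0 => //.
  by apply: mulr_gt0 => //; exact: mulr_gt0.
pose sE := \sum_(j < k) error_bound C j; pose s4 : R := \sum_(j < k) 4 ^+ j.
have s40 : 0 <= s4 by apply: sumr_ge0 => j _; exact: exprn_ge0.
pose c5 := D * (3 / 2 * (a * (8 * k%:R * s4)) + 3).
have c50 : 0 < c5.
  apply: mulr_gt0 => //; apply: ltr_wpDl => //; apply: mulr_ge0 => //.
  by apply: mulr_ge0; [exact: ltW|apply: mulr_ge0].
have c55 : 0 < 5 * c5 by exact: mulr_gt0.
pose e := Num.min 1 (eps / (5 * c5)).
have e0 : 0 < e by rewrite lt_min ltr01 divr_gt0// mulr_gt0.
have e1 : e <= 1 by rewrite ge_min lexx.
have e5 : c5 * e ^+ 2 <= eps / 5.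
  have : e <= eps / (5 * c5) by rewrite ge_min lexx orbT.
  rewrite ler_pdivlMr// => he.
  have : e ^+ 2 <= e by rewrite expr2 ler_piMr// ltW.
  by move=> hee; rewrite ler_pdivlMr//; nra.
exists a, k, e; split=> // N.
pose A := 4 / (eta / 10 * del) ^+ 2 + 8 / del ^+ 2 +
  D * (3 / 2 * (a * (2 * k%:R * N%:R + 4 * k%:R * sE)) +
    6 * (9 + 2 * (8 + 2 * error_bound C 0)) * N%:R).
exists (Num.truncn (5 * A / eps)).+1 => n nn0.
have nA : 5 * A / eps < n%:R.
  by apply: lt_le_trans (truncnS_gt _) _; rewrite ler_nat.
have n0 : 0 < n%:R :> R by rewrite ltr0n (leq_trans _ nn0).
have An : A / n%:R <= eps / 5.
  rewrite ler_pdivrMr//; move: nA; rewrite ltr_pdivrMr// => nA.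
  by rewrite mulrAC ler_pdivlMr//; lra.
have ->: mse_bound eta del a k N e n%:R = A / n%:R + D * (6 * a) * rho ^+ k +
    c5 * e ^+ 2 + 3 / 2 * D * c1 / a.
  rewrite /mse_bound -/C -/D -/c1 -/sE -/s4 -/rho /A /c5 -/D.
  by field; rewrite !gt_eqF.
have t1 : D * (6 * a) * rho ^+ k <= eps / 5.
  have : D * (6 * a) * rho ^+ k <= D * (6 * a) * (eps / (30 * D * a)).
    apply: ler_wpM2l => //; apply: mulr_ge0; first exact: ltW.
    by apply: mulr_ge0 => //; exact: ltW.
  by move=> /le_trans; apply; rewrite le_eqVlt; apply/orP; left; apply/eqP;
     field; rewrite !gt_eqF.
have t2 : 3 / 2 * D * c1 / a = eps / 5.
  by rewrite /a; field; rewrite !gt_eqF.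
rewrite t2; lra.
Qed.

Lemma MSE_bounds (d : measure_display) (T : measurableType d) (P : probability T R)
    (mo : model) (n : nat) (M : 'M[R]_n)
    (X : 'I_n -> 'I_n -> {RV P >-> R}) (O : 'I_n -> 'I_n -> {RV P >-> bool})
    (Mhat : T -> 'M[R]_n) : usvt_estimator mo eta X O Mhat ->
  (forall i j, -1 <= M i j <= 1) -> (0 < n)%N ->
  (0 <= MSE P Mhat M <= 4%:E)%E.
Proof.
move=> husvt M1 n0; have l4 := loss_ge0_le4 husvt M1 n0.
apply/andP; split.
  by apply: expectation_ge0 => w; have /andP[] := l4 w.
have -> : MSE P Mhat M = ('E_P[loss M Mhat])%E by [].
rewrite -[4 in leRHS](Ex_cst P 4).
apply: (expectation_le_ae (bounded_rv_cst 4) l4 (G := setT)).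
  exact: nearW.
by move=> w _; have /andP[] := l4 w.
Qed.

(* The constant C(K, k, f, n) is the supremum of this set, which contains 0 only
   to be nonempty. *)
Definition scaled_MSE (k : nat) (K : set 'rV[R]_k) (f : 'rV[R]_k * 'rV[R]_k -> R)
    (n : nat) : set R :=
  [set x | x = 0 \/ exists (beta : 'I_n -> 'rV[R]_k) (p : R) (mo : model)
    (d : measure_display) (T : measurableType d) (P : probability T R)
    (X : 'I_n -> 'I_n -> {RV P >-> R}) (O : 'I_n -> 'I_n -> {RV P >-> bool})
    (Mhat : T -> 'M[R]_n) (m : R),
    let M : 'M[R]_n := \matrix_(i, j) f (beta i, beta j) in
    [/\ (0 < n)%N, forall i, K (beta i) & 0 < p <= 1] /\
    [/\ data_model mo p M X O, usvt_estimator mo eta X O Mhat,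
        MSE P Mhat M = m%:E & x = Num.sqrt p * m]].

Variables (k : nat) (K : set 'rV[R]_k) (f : 'rV[R]_k * 'rV[R]_k -> R).
Hypothesis f_le1 : forall x, (K `*` K) x -> -1 <= f x <= 1.

Let M_le1 n (beta : 'I_n -> 'rV[R]_k) : (forall i, K (beta i)) ->
  forall i j, -1 <= (\matrix_(i, j) f (beta i, beta j)) i j <= 1.
Proof. by move=> Kb i j; rewrite mxE; apply: f_le1; split; exact: Kb. Qed.

Lemma scaled_MSE_bounds n x : scaled_MSE K f n x -> 0 <= x <= 4.
Proof.
move=> [->|[beta [p [mo [d [T [P [X [Ob [Mhat [m]]]]]]]]]]].
  by rewrite lexx ler0n.
move=> [[n0 Kb /andP[p0 p1]] [hm hu mE ->]].
have := MSE_bounds hu (M_le1 Kb) n0; rewrite mE !lee_fin => /andP[m0 m4].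
have s1 : Num.sqrt p <= 1 by rewrite -sqrtr1 ler_sqrt.
have s0 := sqrtr_ge0 p; rewrite mulr_ge0//=.
by rewrite -[leRHS]mul1r ler_pM.
Qed.

Lemma scaled_MSE_eventually_le (e : R) : compact K ->
  {within K `*` K, continuous f} -> 0 < e ->
  exists n0, forall n, (n0 <= n)%N -> forall x, scaled_MSE K f n x -> x <= e.
Proof.
(* For p below this value, [Num.sqrt p] times the trivial bound 4 is at most e. *)
move=> cK cf e0; pose del := (e / 4) ^+ 2.
have del0 : 0 < del by rewrite exprn_gt0// divr_gt0.
have [a [q [h [a0 h0 small]]]] := mse_bound_small del0 e0.
have [N [cell cellP]] := exists_cells cf cK h0.
have [n0 n0P] := small N.+1; exists n0 => n nn0 x.
move=> [->|[beta [p [mo [d [T [P [X [Ob [Mhat [m]]]]]]]]]]]; first exact: ltW.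
move=> [[n1 Kb /andP[p0 p1]] [hm hu mE ->]].
have := MSE_bounds hu (M_le1 Kb) n1; rewrite mE !lee_fin => /andP[m0 m4].
have s1 : Num.sqrt p <= 1 by rewrite -sqrtr1 ler_sqrt.
have s0 := sqrtr_ge0 p.
have [dp|pd] := leP del p; last first.
  have : Num.sqrt p <= e / 4.
    by rewrite -[e / 4]ger0_norm ?divr_ge0 ?(ltW e0)// -sqrtr_sqr ler_sqrt// ?ltW.
  by nra.
have close i j j' : cell (beta j) = cell (beta j') ->
    `|(\matrix_(i, j) f (beta i, beta j)) i j -
      (\matrix_(i, j) f (beta i, beta j)) i j'| <= h /\
    `|(\matrix_(i, j) f (beta i, beta j)) j i -
      (\matrix_(i, j) f (beta i, beta j)) j' i| <= h.
  by move=> jj; rewrite !mxE; exact: cellP.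
have := MSE_le_bound eta01 q hm hu (M_le1 Kb) n1 del0 dp p1 a0 (ltW h0) close.
rewrite mE lee_fin => mb; apply: (@le_trans _ _ m); first by rewrite ler_piMl.
exact: le_trans mb (n0P _ nn0).
Qed.

(** Since 0 belongs to the set, the supremum is nonnegative and the eventual upper bound on its
    elements suffices. *)
Lemma sup_scaled_MSE_cvg : compact K -> {within K `*` K, continuous f} ->
  (fun n => sup (scaled_MSE K f n)) @ \oo --> (0 : R).
Proof.
move=> cK cf; apply/cvgrPdist_le => e e0.
have [n0 n0P] := scaled_MSE_eventually_le cK cf e0.
exists n0 => // n /= nn0; have S0 : scaled_MSE K f n 0 by left.
rewrite sub0r normrN ger0_norm; last first.
  by apply: ub_le_sup => //; exists 4 => x /scaled_MSE_bounds/andP[].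
apply: ge_sup; first by exists 0.
by move=> x; exact: n0P.
Qed.

End Conclusion.

Theorem theorem2p6 (R : realType) (eta : R) (eta_gt0 : 0 < eta)
    (eta_lt1 : eta < 1) :
  exists (c : R) (Ceps : R -> R), 0 < c /\
  forall (k : nat) (K : set 'rV[R]_k) (f : 'rV[R]_k * 'rV[R]_k -> R),
    (1 <= k)%N -> bounded_set K -> closed K ->
    {within K `*` K, continuous f} ->
    (forall x, (K `*` K) x -> -1 <= f x <= 1) ->
  exists CK : nat -> R, CK @ \oo --> (0 : R) /\
  forall (n : nat) (beta : 'I_n -> 'rV[R]_k) (p eps : R),
    (1 <= n)%N -> (forall i, K (beta i)) -> 0 <= p <= 1 ->
    0 < eps -> n%:R `^ (-1 + eps) <= p ->
  forall (mo : model) (d : measure_display) (T : measurableType d)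
    (P : probability T R)
    (X : 'I_n -> 'I_n -> {RV P >-> R}) (O : 'I_n -> 'I_n -> {RV P >-> bool})
    (Mhat : T -> 'M[R]_n),
    let M : 'M[R]_n := \matrix_(i, j) f (beta i, beta j) in
    data_model mo p M X O ->
    usvt_estimator mo eta X O Mhat ->
    (MSE P Mhat M <=
      (CK n / Num.sqrt p + Ceps eps * expR (- (c * n%:R * p)))%:E)%E.
Proof.
have eta01 : 0 < eta < 1 by rewrite eta_gt0.
exists 1, (fun=> 0); split=> // k K f _ bK clK cf f1.
have cK : compact K by exact: bounded_closed_compact.
exists (fun n => sup (scaled_MSE eta K f n)); split.
  exact: sup_scaled_MSE_cvg.
move=> n beta p eps n0 Kb /andP[_ p1] _ np mo d T P X O Mhat M hm hu.
have p0 : 0 < p by apply: lt_le_trans np; rewrite powR_gt0// ltr0n.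
rewrite mul0r addr0.
have M1 i j : -1 <= M i j <= 1 by rewrite mxE; apply: f1; split; exact: Kb.
have /andP[m0 m4] := MSE_bounds hu M1 n0.
(* The MSE lies between 0 and 4, so it is a real number and its scaled value is an element of the
   set whose supremum is the constant. *)
have mE : MSE P Mhat M = (fine (MSE P Mhat M))%:E.
  by rewrite fineK// ge0_fin_numE// (le_lt_trans m4)// ltry.
rewrite mE lee_fin ler_pdivlMr ?sqrtr_gt0// mulrC.
apply: ub_le_sup.
  by exists 4 => x /(scaled_MSE_bounds f1)/andP[].
right; exists beta, p, mo, d, T, P, X, O, Mhat, (fine (MSE P Mhat M)).
by split; split=> //; rewrite p0.
Qed.
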